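(* Let $k\ge 2$ be even, let $p$ be a prime coprime to $N$ satisfying $\log p \geq \frac{4\log \log kN}{3(k - 1)}$, and let $\sigma$ be an admissible sign pattern for $N$ with $S_k^\sigma(N)\neq 0$. Then if $kN \geq e^8$, $$\frac{\#\left\{ \lambda \in \operatorname{eigen}_{ S_k^\sigma(N)} ( \mathbf{T}_{p} ) : |\lambda| \geq \left\lfloor 2 p^{(k - 1)/2} \right\rfloor \right\}}{\dim S_k^\sigma(N)} \leq 83.5853 \cdot C_0 \left( \frac{p + 1}{p - 1} \right)^2 \cdot \frac{ \log p \cdot \left(\log \left( \log kN + 1000 \right)\right)^2}{\log kN}.$$ The same result also holds for $S_k^{\mathrm{new}, \sigma}(N)$ in place of $S_k^\sigma(N)$, with $C_0^{\mathrm{new}}$ in place of $C_0$.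
   Context: For even $k\ge 2$ and $N\ge 1$, $S_k(N)$ is the space of weight $k$ cusp forms for $\Gamma_0(N)$ and $S_k^{\mathrm{new}}(N)$ is its new subspace. Write $Q\parallel N$ if $Q\mid N$ and $\gcd(Q,N/Q)=1$; $W_Q$ denotes the corresponding Atkin--Lehner involution. A sign pattern for $N$ is a multiplicative function $\sigma:\{Q: Q\parallel N\}\to\{\pm1\}$. Put $S_k^\sigma(N)=\{f\in S_k(N): W_Qf=\sigma(Q)f \text{ for all } Q\parallel N\}$ and $S_k^{\mathrm{new},\sigma}(N)=S_k^{\mathrm{new}}(N)\cap S_k^\sigma(N)$. Over $S_k(N)$ every sign pattern is admissible; over $S_k^{\mathrm{new}}(N)$, $\sigma$ is admissible unless $4\parallel N$ and $\sigma(4)=+1$. $\mathbf{T}_p$ is the (unnormalized) Hecke operator and $\mathbf{T}_p'=p^{-(k-1)/2}\mathbf{T}_p$. $\operatorname{eigen}_V(T)$ is the multiset of eigenvalues of $T$ on $V$ (counts are with multiplicity). Let $$d\mu_p(x) = \frac{p + 1}{2\pi} \cdot \frac{\sqrt{4 - x^2}}{( p^{1/2} + p^{-1/2} )^2 - x^2} \,dx \quad\text{on }[-2,2].$$ $C_0$ denotes an absolute constant such that $$\left| \frac{\# \operatorname{eigen}_{S_k^{\sigma}(N)}(\mathbf{T}'_p) \cap I}{\dim S_k^{\sigma}(N)} - \int_I d \mu_p(x) \right| \le C_0 \frac{\log p}{\log kN}$$ for all primes $p$, levels $N$ coprime to $p$, admissible $\sigma$, even $k\ge2$ and intervals $I\subseteq[-2,2]$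 (with $S_k^\sigma(N)\neq0$); $C_0^{\mathrm{new}}$ denotes such a constant for the spaces $S_k^{\mathrm{new},\sigma}(N)$. *)

(* Defs.v *)
From HB Require Import structures.
From mathcomp Require Import all_boot all_order all_algebra.
From mathcomp Require Export complex.
From mathcomp Require Import all_classical all_reals all_analysis.

Set Implicit Arguments.
Unset Strict Implicit.
Unset Printing Implicit Defensive.

Import Order.TTheory GRing.Theory Num.Theory.
Import numFieldNormedType.Exports.

Local Open Scope classical_set_scope.
Local Open Scope ring_scope.

(* Subspaces of a possibly infinite-dimensional vector space [E] are given by
   predicates.  The notions below are meant for finite-dimensional [V]; without
   a finite basis, [vdim V = 0] and [eigen V T = [::]]. *)
Section LinearAlgebra.
Variables (K : fieldType) (E : lmodType K).
Implicit Types (V : set E) (T : E -> E).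

Definition is_basis V (n : nat) (e : 'I_n -> E) : Prop :=
  V = [set f | exists c : 'I_n -> K, f = \sum_i c i *: e i] /\
  (forall c : 'I_n -> K, \sum_i c i *: e i = 0 -> forall i, c i = 0).

Definition vdim V : nat :=
  xget 0%N [set n | exists e : 'I_n -> E, is_basis V e].

(* The multiset of eigenvalues of [T] on a [T]-stable [V]: the roots of the
   characteristic polynomial, with multiplicity, in an unspecified order. *)
Definition eigen V T : seq K :=
  xget [::] [set s : seq K | exists n (e : 'I_n -> E) (A : 'M[K]_n),
    [/\ is_basis V e,
        forall j, T (e j) = \sum_i A i j *: e i
      & char_poly A = \prod_(x <- s) ('X - x%:P)]].

Definition linear_span (G : set E) : set E :=
  [set f | exists (n : nat) (c : 'I_n -> K) (g : 'I_n -> E),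
    (forall i, G (g i)) /\ f = \sum_i c i *: g i].

End LinearAlgebra.

Definition mx22 (a b c d : int) : 'M[int]_2 :=
  \matrix_(i, j) if i == 0 then if j == 0 then a else b
                 else if j == 0 then c else d.

Definition SL2Z : set 'M[int]_2 := [set g | \det g = 1].

Definition Gamma0 (N : nat) : set 'M[int]_2 :=
  [set g | \det g = 1 /\ (N%:Z %| g 1%R 0%R)%Z].

Definition exact_dvd (Q N : nat) : bool := (Q %| N)%N && coprime Q (N %/ Q).

(* Only the values of [sigma] at the exact divisors of [N] matter. *)
Definition sign_pattern (N : nat) (sigma : nat -> int) : Prop :=
  (forall Q, exact_dvd Q N -> sigma Q = 1 \/ sigma Q = -1) /\
  (forall Q Q', exact_dvd Q N -> exact_dvd Q' N -> coprime Q Q' ->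
     sigma (Q * Q')%N = sigma Q * sigma Q').

(* Admissibility over the new subspace. *)
Definition new_admissible (N : nat) (sigma : nat -> int) : Prop :=
  ~ (exact_dvd 4 N /\ sigma 4%N = 1).

Section ModularForms.
Variable R : realType.
Local Notation C := (R[i]).

Definition upper_half_plane : set C := [set z | 0 < complex.Im z].

Definition mobius (g : 'M[int]_2) (z : C) : C :=
  ((g 0 0)%:~R * z + (g 0 1)%:~R) / ((g 1 0)%:~R * z + (g 1 1)%:~R).

(* Functions on the upper half-plane are represented by functions on [C] that
   vanish outside it (see [is_cuspform]), so that equality and linear
   combinations are those of the function space [C -> C]. *)
Local Notation half_plane_fun := (C -> C^o).
Implicit Types f : half_plane_fun.

(* For even [k] and [\det g > 0], normalized by (det g)^(k/2), so that scalar
   matrices act trivially. *)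
Definition slash (k : nat) (g : 'M[int]_2) f : half_plane_fun := fun z =>
  (\det g)%:~R ^+ k./2 * ((g 1 0)%:~R * z + (g 1 1)%:~R) ^- k * f (mobius g z).

Definition holomorphic_on_half_plane f : Prop :=
  forall z, upper_half_plane z -> derivable (f : C^o -> C^o) z 1.

Definition vanishes_at_infinity f : Prop :=
  forall eps : R, 0 < eps -> exists A : R,
    forall z : C, A < complex.Im z -> ComplexField.Normc.normc (f z) < eps.

(* S_k(N), for even [k]; every cusp is the image of infinity under some [g] in
   SL_2(Z). *)
Definition cuspforms (k N : nat) : set half_plane_fun := [set f |
  [/\ forall z, ~ upper_half_plane z -> f z = 0,
      holomorphic_on_half_plane f,
      forall g, Gamma0 N g -> slash k g f = f
    & forall g, SL2Z g -> vanishes_at_infinity (slash k g f)]].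

(* The unnormalized Hecke operator for a prime [p] not dividing the level:
   f |-> p^(k-1) f(p z) + p^-1 \sum_(b < p) f((z + b) / p). *)
Definition hecke (k p : nat) f : half_plane_fun :=
  (p%:R ^+ (k./2 - 1) : C) *:
    (slash k (mx22 p 0 0 1) f + \sum_(b < p) slash k (mx22 1 b 0 p) f).

Definition hecke_normalized (k p : nat) f : half_plane_fun :=
  real_complex R (p%:R `^ (- ((k%:R - 1) / 2))) *: hecke k p f.

(* W_Q is the action of any integral matrix [Q x, y; N z, Q w] of determinant
   Q, the choice being irrelevant on S_k(N).  Here z = w = 1, and (x, y) are
   the Bezout coefficients with Q x - (N/Q) y = 1. *)
Definition atkin_lehner (k N Q : nat) f : half_plane_fun :=
  let xy := egcdn Q (N %/ Q) in
  slash k (mx22 (Q * xy.1)%N xy.2 N Q) f.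

(* A strict measurable fundamental domain for Gamma0(N), in the coordinates
   (x, y) of z = x + i y. *)
Definition fundamental_domain (N : nat) (D : set (R * R)) : Prop :=
  [/\ measurable D,
      forall u, D u -> upper_half_plane (Complex u.1 u.2)
    & forall z, upper_half_plane z -> exists! u : R * R,
        D u /\ exists2 g, Gamma0 N g & Complex u.1 u.2 = mobius g z].

(* The Petersson inner product as an integral over the fundamental domain [D];
   on cusp forms its value does not depend on [D]. *)
Definition petersson (k : nat) (D : set (R * R)) (f g : half_plane_fun) : C :=
  let mu := (@lebesgue_measure R \x @lebesgue_measure R)%E in
  let F (u : R * R) : C := f (Complex u.1 u.2) * (g (Complex u.1 u.2))^*%C
                           * real_complex R (u.2 ^+ k / u.2 ^+ 2) in
  Complex (\int[mu]_(u in D) complex.Re (F u)) (\int[mu]_(u in D) complex.Im (F u)).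

Definition old_subspace (k N : nat) : set half_plane_fun :=
  linear_span [set g | exists M d (f : half_plane_fun),
    [/\ (M %| N)%N, (M < N)%N, (d %| N %/ M)%N, cuspforms k M f
      & g = (fun z => f (d%:R * z))]].

(* The orthogonal complement of the old subspace in S_k(N). *)
Definition new_subspace (k N : nat) : set half_plane_fun := [set f |
  cuspforms k N f /\
  forall D g, fundamental_domain N D -> old_subspace k N g -> petersson k D f g = 0].

Definition cuspforms_sigma (k N : nat) (sigma : nat -> int) :
    set half_plane_fun := [set f | cuspforms k N f /\
  forall Q, exact_dvd Q N -> atkin_lehner k N Q f = ((sigma Q)%:~R : C) *: f].

Definition new_subspace_sigma (k N : nat) (sigma : nat -> int) :
    set half_plane_fun := new_subspace k N `&` cuspforms_sigma k N sigma.

Definition nonzero_space (V : set half_plane_fun) : Prop :=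
  exists f, V f /\ f <> 0.

Definition mu_density (p : nat) (x : R) : R :=
  (p%:R + 1) / (2 * pi) *
  (Num.sqrt (4 - x ^+ 2) /
   ((p%:R `^ (1 / 2) + p%:R `^ (- (1 / 2))) ^+ 2 - x ^+ 2)).

(* #(eigen_V(T) \cap I), for a real interval [I]. *)
Definition eigen_count_in (V : set half_plane_fun)
    (T : half_plane_fun -> half_plane_fun) (I : interval R) : nat :=
  count (fun l : C => (complex.Im l == 0) && (complex.Re l \in I)) (eigen V T).

(* #{l \in eigen_V(T_p) : |l| >= floor(2 p^((k-1)/2))}. *)
Definition large_eigen_count (V : set half_plane_fun) (k p : nat) : nat :=
  count (fun l : C =>
           (Num.floor (2 * p%:R `^ ((k%:R - 1) / 2) : R))%:~R <= ComplexField.Normc.normc l)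
        (eigen V (hecke k p)).

(* [c] is an equidistribution constant for the spaces [S k N sigma] with
   [sigma] ranging over the sign patterns satisfying [adm N]. *)
Definition equidistribution_constant
    (S : nat -> nat -> (nat -> int) -> set half_plane_fun)
    (adm : nat -> (nat -> int) -> Prop) (c : R) : Prop :=
  forall (p N k : nat) (sigma : nat -> int) (I : interval R),
    prime p -> (0 < N)%N -> coprime p N ->
    sign_pattern N sigma -> adm N sigma ->
    (2 <= k)%N -> ~~ odd k -> nonzero_space (S k N sigma) ->
    {subset I <= `[-2, 2]} ->
    `| (eigen_count_in (S k N sigma) (hecke_normalized k p) I)%:R
         / (vdim (S k N sigma))%:R
       - \int[lebesgue_measure]_(x in [set` I]) mu_density p x |
      <= c * (ln p%:R / ln (k * N)%:R).

End ModularForms.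

(* Main.v *)
(* Let I = [-2 + d, 2 - d] with d = p^(-(k-1)/2).  A large eigenvalue of T_p
   becomes, after normalization, one outside I, so the proportion in question is
   at most 1 - mu_p(I) plus the equidistribution error.  The explicit primitive
   of the density bounds 1 - mu_p(I) by a multiple of d^(3/2), and the lower
   bound on log p gives d^(3/2) <= 1 / log kN.

   To absorb this term into the error one needs a lower bound for C_0.  It comes
   from S_12(1) and p = 2: this space is nonzero, since the combination of the
   Eisenstein series E_12 and E_6^2 that vanishes at infinity is nonzero at i,
   and its dimension is bounded, so its eigenvalues cannot be equidistributed too
   well.  The dimension bound is a Schwarz-lemma argument: if f vanishes at
   enough points of the segment [i, 2i], then dividing these zeros out against
   their reflections in the line Im z = 1/2 makes f too small at -1/z, where z
   is a maximum of |f| on Im z >= 1/2.  The maximum modulus principle used there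
   is proved with discrete contour sums, without integration: by Goursat's
   bisection the sums of (g^n - g(w)^n) / (z - w) tend to 0, whence |g(w)|^n is
   at most a constant times the n-th power of the maximum on the boundary. *)
Require Import Defs.
From mathcomp Require Import all_boot all_order all_algebra.
From mathcomp Require Import all_classical all_reals all_analysis.
From mathcomp Require Import ring lra zify.

Set Implicit Arguments.
Unset Strict Implicit.
Unset Printing Implicit Defensive.

Import Order.TTheory GRing.Theory Num.Theory.
Import numFieldNormedType.Exports.
Local Open Scope ring_scope.

(** The claimed bound is proportional to C_0 whereas the deficit 1 - mu_p(I) is not, so a very small
    C_0 would break the estimate: a numerical lower bound must be extracted from one concrete space.
    The margin is wide. With M = log(log kN + 1000) >= 2 and A = C_0 log p >= 1/200, already 83.5853
    A M^2 exceeds 1 + A. Hence a crude dimension bound suffices (200, for a space whose true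
    dimension is 1), and any cusp form seen to be nonzero will do. Taking p = 2 bounds C_0 log 2
    from below, and this passes to every prime since the logarithm increases.

    In the general space nothing about the eigenvalues is computed: the counts enter only through
    the inequality between the number of eigenvalues and [vdim], which also covers the default
    values of [eigen] and [vdim]. *)

Section ComplexDerivative.
Variable R : realType.
Local Notation C := (R[i]).
Local Notation nm := (@ComplexField.Normc.normc R).
Local Notation "x %:C" := (real_complex R x).
Implicit Types (x y z w : C) (f g : C^o -> C^o).

Lemma normc_real_complex x : `|x| = (nm x)%:C.
Proof. by case: x. Qed.

Lemma ltC_real (x : C) : 0 < x -> exists2 r : R, 0 < r & x = r%:C.
Proof.
case: x => a b; rewrite ltcE /= => /andP[/eqP b0 a0]; exists a => //.
by rewrite b0.
Qed.

Lemma derivable_complexP f z : derivable f z 1 <->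
  exists l : C, forall e : R, 0 < e -> exists2 d : R, 0 < d &
    forall w, nm (w - z) < d -> nm (f w - f z - l * (w - z)) <= e * nm (w - z).
Proof.
split=> [/cvg_ex[l /= /cvgrPdist_le Hl]|[l Hl]].
  exists l => e e0.
  have eC : 0 < e%:C by rewrite ltcR.
  have /= := Hl _ eC; rewrite near_withinE => /nbhs_ballP[d /= d0 Hd].
  have [r r0 dr] := ltC_real d0; exists r => // w wz.
  have [->|nwz] := eqVneq w z.
    by rewrite !subrr mulr0 subrr ComplexField.Normc.normc0 mulr0.
  have h0 : w - z != 0 by rewrite subr_eq0.
  have := Hd (w - z); rewrite /ball /= sub0r normrN normc_real_complex dr ltcR.
  move=> /(_ wz h0); rewrite normc_real_complex lecR => H.
  have -> : f w - f z - l * (w - z)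
     = - ((l - (w - z)^-1 *: (f ((w - z) *: 1 + z) - f z)) * (w - z)).
    rewrite /GRing.scale /= mulr1 subrK.
    by field.
  rewrite normcN ComplexField.Normc.normcM ler_wpM2r//.
  by rewrite -lecR -normc_real_complex normr_ge0.
apply/cvg_ex; exists l => /=; apply/cvgrPdist_le => eC /ltC_real[e e0 ->].
rewrite near_withinE; apply/nbhs_ballP.
have [d d0 Hd] := Hl e e0.
exists d%:C => /=; first by rewrite ltcR.
move=> h; rewrite /ball /= sub0r normrN normc_real_complex ltcR => hd h0.
rewrite /GRing.scale /= mulr1 normc_real_complex lecR.
have := Hd (h + z); rewrite addrK => /(_ hd) H.
have nh : 0 < nm h by rewrite -ltcR -normc_real_complex normr_gt0.
rewrite -(ler_pM2r nh); apply: le_trans H.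
rewrite -ComplexField.Normc.normcM -normcN le_eqVlt; apply/orP; left; apply/eqP.
congr nm; by field.
Qed.

End ComplexDerivative.

(** * Modulus, real and imaginary parts *)

Section ComplexNorm.
Variable R : realType.
Local Notation C := (R[i]).
Local Notation nm := (@ComplexField.Normc.normc R).
Local Notation "x %:C" := (real_complex R x).
Local Notation Re := (@complex.Re R).
Local Notation Im := (@complex.Im R).
Implicit Types (x y z w : C).

Lemma normc_ge0 x : 0 <= nm x.
Proof. by rewrite -lecR -normc_real_complex normr_ge0. Qed.

Lemma normc_eq0 x : (nm x == 0) = (x == 0).
Proof.
apply/eqP/eqP => [/ComplexField.Normc.eq0_normc //|->].
exact: ComplexField.Normc.normc0.
Qed.

Lemma normc_gt0 x : (0 < nm x) = (x != 0).
Proof. by rewrite lt_def normc_ge0 andbT normc_eq0. Qed.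

Lemma normc_real (r : R) : nm r%:C = `|r|.
Proof. by rewrite /= expr0n addr0 sqrtr_sqr. Qed.

Lemma normcX x n : nm (x ^+ n) = nm x ^+ n.
Proof.
elim: n => [|n IH]; first by rewrite !expr0 ComplexField.Normc.normc1.
by rewrite !exprS ComplexField.Normc.normcM IH.
Qed.

Lemma normcB x y : nm (x - y) <= nm x + nm y.
Proof. by rewrite -(normcN y) le_normcD. Qed.

Lemma normc_sub_sym x y : nm (x - y) = nm (y - x).
Proof. by rewrite -normcN opprB. Qed.

Lemma normc_le_add x y : nm x <= nm (x - y) + nm y.
Proof. by rewrite -{1}(subrK y x) le_normcD. Qed.

Lemma normc_sum (I : Type) (s : seq I) (P : pred I) (F : I -> C) :
  nm (\sum_(i <- s | P i) F i) <= \sum_(i <- s | P i) nm (F i).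
Proof.
apply: (big_rec2 (fun (a : C) (b : R) => nm a <= b)) => [|i b a _ H].
  by rewrite ComplexField.Normc.normc0.
by apply: le_trans (le_normcD _ _) _; rewrite lerD2l.
Qed.

Lemma normc_sq x : nm x ^+ 2 = Re x ^+ 2 + Im x ^+ 2.
Proof. by case: x => a b /=; rewrite sqr_sqrtr// addr_ge0 ?sqr_ge0. Qed.

Lemma normRe_le x : `|Re x| <= nm x.
Proof.
rewrite -[X in _ <= X]ger0_norm ?normc_ge0// -ler_sqr ?nnegrE//.
by rewrite !real_normK ?num_real// normc_sq lerDl sqr_ge0.
Qed.

Lemma normIm_le x : `|Im x| <= nm x.
Proof.
rewrite -[X in _ <= X]ger0_norm ?normc_ge0// -ler_sqr ?nnegrE//.
by rewrite !real_normK ?num_real// normc_sq lerDr sqr_ge0.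
Qed.

Lemma normc_le_Re_Im x : nm x <= `|Re x| + `|Im x|.
Proof.
rewrite -ler_sqr ?nnegrE ?normc_ge0 ?addr_ge0// normc_sq sqrrD.
rewrite !real_normK ?num_real//.
have : 0 <= `|Re x| * `|Im x| by rewrite mulr_ge0.
by move=> h; rewrite lerD2r lerDl mulrn_wge0.
Qed.

Lemma ReD x y : Re (x + y) = Re x + Re y. Proof. by case: x; case: y. Qed.
Lemma ImD x y : Im (x + y) = Im x + Im y. Proof. by case: x; case: y. Qed.
Lemma ReB x y : Re (x - y) = Re x - Re y. Proof. by case: x; case: y. Qed.
Lemma ImB x y : Im (x - y) = Im x - Im y. Proof. by case: x; case: y. Qed.
Lemma ReM x y : Re (x * y) = Re x * Re y - Im x * Im y.
Proof. by case: x; case: y. Qed.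
Lemma ImM x y : Im (x * y) = Re x * Im y + Im x * Re y.
Proof. by case: x => a b; case: y => c d /=. Qed.

Lemma ReV x : Re x^-1 = Re x / nm x ^+ 2.
Proof. by rewrite normc_sq; case: x. Qed.

Lemma ImV x : Im x^-1 = - Im x / nm x ^+ 2.
Proof. by rewrite normc_sq; case: x => a b /=; rewrite mulNr. Qed.

Lemma Re_sum (I : Type) (s : seq I) (P : pred I) (F : I -> C) :
  Re (\sum_(i <- s | P i) F i) = \sum_(i <- s | P i) Re (F i).
Proof. exact: (big_morph Re ReD). Qed.

Lemma Im_sum (I : Type) (s : seq I) (P : pred I) (F : I -> C) :
  Im (\sum_(i <- s | P i) F i) = \sum_(i <- s | P i) Im (F i).
Proof. exact: (big_morph Im ImD). Qed.

Lemma natr_real_complex n : n%:R = (n%:R : R)%:C :> C.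
Proof. by rewrite rmorph_nat. Qed.

End ComplexNorm.

(** * Bisection of squares *)

Section Squares.
Variable R : realType.
Local Notation C := (R[i]).
Local Notation Re := (@complex.Re R).
Local Notation Im := (@complex.Im R).
Local Notation "x %:C" := (real_complex R x).
Local Notation nm := (@ComplexField.Normc.normc R).
Implicit Types (w z : C) (L : R).

Definition in_square z L w :=
  (Re z <= Re w <= Re z + L) && (Im z <= Im w <= Im z + L).

Lemma in_square_normc z L v w :
  in_square z L v -> in_square z L w -> nm (v - w) <= 2 * L.
Proof.
move=> /andP[/andP[a1 a2] /andP[a3 a4]] /andP[/andP[b1 b2] /andP[b3 b4]].
apply: le_trans (normc_le_Re_Im _) _; rewrite ReB ImB mulr_natl mulr2n.
by apply: lerD; rewrite ler_norml; apply/andP; split; lra.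
Qed.

Lemma nested_intervals_point (a b : nat -> R) :
  (forall n, a n <= a n.+1) -> (forall n, b n.+1 <= b n) ->
  (forall n, a n <= b n) -> exists x, forall n, a n <= x <= b n.
Proof.
move=> ha hb hab.
have ma m n : (m <= n)%N -> a m <= a n.
  by move=> mn; apply: (homo_leq (@lexx _ R) (@le_trans _ R)).
have mb m n : (m <= n)%N -> b n <= b m.
  by apply: (homo_leq (r := fun x y => y <= x)) => // x y w h1 h2; exact: le_trans h1.
have ub m n : a m <= b n.
  have := ma _ _ (leq_maxl m n); have := mb _ _ (leq_maxr m n).
  by move=> h1 h2; apply: le_trans h2 (le_trans (hab _) h1).
have hs : has_sup (range a).
  by split; [exists (a 0%N), 0%N|exists (b 0%N) => _ [n _ <-]].
exists (sup (range a)) => n; apply/andP; split.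
  by apply: ub_le_sup; [exact: hs.2|exists n].
by apply: ge_sup; [exact: hs.1|move=> _ [m _ <-]].
Qed.

(* Cousin's lemma, for squares. *)
Lemma square_bisection (P : C -> R -> Prop) z0 L0 :
  0 < L0 ->
  (forall z L, 0 < L -> P z (L / 2) -> P (z + (L / 2)%:C) (L / 2) ->
     P (z + Complex 0 (L / 2)) (L / 2) ->
     P (z + (L / 2)%:C + Complex 0 (L / 2)) (L / 2) -> P z L) ->
  (forall w, in_square z0 L0 w -> exists2 d, 0 < d &
     forall z L, 0 < L -> L < d -> in_square z L w -> P z L) ->
  P z0 L0.
Proof.
move=> L00 Psub Ploc; apply: contrapT => nP.
pose bad (q : C * R) := 0 < q.2 /\ ~ P q.1 q.2.
pose next (q q' : C * R) := [/\ bad q', q'.2 = q.2 / 2,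
  Re q.1 <= Re q'.1 <= Re q.1 + q.2 / 2 & Im q.1 <= Im q'.1 <= Im q.1 + q.2 / 2].
have step q : exists q', bad q -> next q q'.
  case: (pselect (bad q)) => [bq|nb]; last by exists q.
  case: q bq => z L [/= l0 nPz].
  have l2 : 0 < L / 2 by lra.
  suff : exists q', next (z, L) q' by move=> [q' h]; exists q'.
  apply: contrapT => H; apply: nPz.
  apply: Psub => //; apply: contrapT => nP1; apply: H.
  - exists (z, L / 2); split => //=; lra.
  - exists (z + (L / 2)%:C, L / 2); split => //=; rewrite ?ReD ?ImD /=; lra.
  - exists (z + Complex 0 (L / 2), L / 2); split => //=; rewrite ?ReD ?ImD /=; lra.
  - exists (z + (L / 2)%:C + Complex 0 (L / 2), L / 2); split => //=;
      rewrite ?ReD ?ImD /=; lra.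
have [nx Hnx] := choice step.
pose q n := iter n nx (z0, L0).
have bq n : bad (q n) by elim: n => [|n IH] //=; have [] := Hnx _ IH.
have nq n : next (q n) (q n.+1) by apply: Hnx.
have Lq n : (q n).2 = L0 / 2 ^+ n.
  elim: n => [|n IH]; first by rewrite expr0 divr1.
  have [_ -> _ _] := nq n; rewrite IH exprS; field.
  by rewrite expf_neq0// pnatr_eq0.
have [x Hx] : exists x, forall n, Re (q n).1 <= x <= Re (q n).1 + (q n).2.
  apply: nested_intervals_point => n; have [_ h1 h2 h3] := nq n; have [h4 _] := bq n; lra.
have [y Hy] : exists y, forall n, Im (q n).1 <= y <= Im (q n).1 + (q n).2.
  apply: nested_intervals_point => n; have [_ h1 h2 h3] := nq n; have [h4 _] := bq n; lra.
have inq n : in_square (q n).1 (q n).2 (Complex x y) by rewrite /in_square /= Hx Hy.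
have [d d0 Hd] := Ploc _ (inq 0%N).
have [n Hn] : exists n, (q n).2 < d.
  have [n Hn] : exists n : nat, L0 / d < n%:R.
    by exists (Num.bound (L0 / d)); apply: archi_boundP; rewrite divr_ge0 ?ltW.
  exists n; rewrite Lq ltr_pdivrMr ?exprn_gt0// mulrC -ltr_pdivrMr//.
  apply: lt_trans Hn _; rewrite -natrX ltr_nat; exact: ltn_expl.
by have [l0 []] := bq n; apply: Hd (inq n).
Qed.

End Squares.

(** * Discrete contour sums around squares *)

Section Contour.
Variable R : realType.
Local Notation C := (R[i]).
Local Notation Re := (@complex.Re R).
Local Notation Im := (@complex.Im R).
Local Notation "x %:C" := (real_complex R x).
Local Notation nm := (@ComplexField.Normc.normc R).
Local Notation I := (Complex (0 : R) 1).
Implicit Types (w z d h : C) (f g : C -> C) (L : R).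

Definition path_sum f z d n : C := \sum_(j < n) f (z + j%:R * d).

(* Left Riemann sum of the integral of [f] along the positively oriented
   boundary of the square with lower left corner [z] and side [n h]. *)
Definition contour f z h n : C :=
  h * (path_sum f z h n - path_sum f (z + I * (n%:R * h)) h n
       + I * (path_sum f (z + n%:R * h) (I * h) n - path_sum f z (I * h) n)).

Lemma path_sumD f z d m n :
  path_sum f z d (m + n) = path_sum f z d m + path_sum f (z + m%:R * d) d n.
Proof.
rewrite /path_sum big_split_ord /=; congr (_ + _).
by apply: eq_bigr => j _; rewrite natrD mulrDl addrA.
Qed.

(** An edge common to two of the quarters is sampled at the same points by both and counted with
    opposite signs, so the inner edges cancel exactly, without any limit. *)
Lemma contour_split f z h n :
  contour f z h (n + n) = contour f z h n + contour f (z + n%:R * h) h n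
    + contour f (z + I * (n%:R * h)) h n
    + contour f (z + n%:R * h + I * (n%:R * h)) h n.
Proof.
rewrite /contour !path_sumD natrD.
have e1 : z + I * ((n%:R + n%:R) * h) = z + I * (n%:R * h) + I * (n%:R * h) by ring.
have e2 : z + (n%:R + n%:R) * h = z + n%:R * h + n%:R * h by ring.
have e3 : n%:R * (I * h) = I * (n%:R * h) by ring.
have e4 : z + I * (n%:R * h) + n%:R * h = z + n%:R * h + I * (n%:R * h) by ring.
have e5 : z + I * (n%:R * h) + I * (n%:R * h) + n%:R * h =
  z + n%:R * h + I * (n%:R * h) + I * (n%:R * h) by ring.
have e6 : z + n%:R * h + n%:R * h + I * (n%:R * h) =
  z + n%:R * h + I * (n%:R * h) + n%:R * h by ring.
rewrite e1 e2 e3 e4 e5 e6; ring.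
Qed.

Lemma eq_contour f g z h n : (forall w, f w = g w) -> contour f z h n = contour g z h n.
Proof. by move=> /funext ->. Qed.

Lemma contourD f g z h n :
  contour (fun w => f w + g w) z h n = contour f z h n + contour g z h n.
Proof. by rewrite /contour /path_sum !big_split /=; ring. Qed.

Lemma contourZ a f z h n :
  contour (fun w => a * f w) z h n = a * contour f z h n.
Proof. by rewrite /contour /path_sum -!mulr_sumr /=; ring. Qed.

(* Left Riemann sums are exact here: opposite sides cancel term by term. *)
Lemma contour_affine a b w z h n : contour (fun v => a + b * (v - w)) z h n = 0.
Proof.
rewrite /contour /path_sum -!sumrB.
rewrite (eq_bigr (fun=> - (b * I * (n%:R * h)))); last by move=> j _; ring.
rewrite [X in I * X](eq_bigr (fun=> b * (n%:R * h))); last by move=> j _; ring.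
by rewrite !sumr_const card_ord mulNrn -!(mulr_natr (_ * _)); ring.
Qed.

Definition on_boundary z L w := in_square z L w &&
  [|| Re w == Re z, Re w == Re z + L, Im w == Im z | Im w == Im z + L].

Section Bound.
Variables (f : C -> C) (z : C) (r K : R) (n : nat).
Hypothesis r0 : 0 < r.
Let L := n%:R * r.
Hypothesis fK : forall w, on_boundary z L w -> nm (f w) <= K.

Let jL (j : 'I_n) : 0 <= j%:R * r <= L.
Proof.
rewrite mulr_ge0 ?ler0n ?(ltW r0)//= /L ler_wpM2r ?(ltW r0)//.
by rewrite ler_nat ltnW.
Qed.

Lemma Re_natr_real (m : nat) : Re (m%:R * r%:C) = m%:R * r.
Proof. by rewrite natr_real_complex -rmorphM. Qed.

Lemma Im_natr_real (m : nat) : Im (m%:R * r%:C) = 0.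
Proof. by rewrite natr_real_complex -rmorphM. Qed.

Lemma Re_mulI w : Re (I * w) = - Im w.
Proof. by rewrite ReM /= mul0r mul1r sub0r. Qed.

Lemma Im_mulI w : Im (I * w) = Re w.
Proof. by rewrite ImM /= mul0r mul1r add0r. Qed.

Lemma boundary_bottom (j : 'I_n) : on_boundary z L (z + j%:R * r%:C).
Proof.
have /andP[h1 h2] := jL j.
rewrite /on_boundary /in_square !ReD !ImD !Re_natr_real !Im_natr_real addr0 eqxx !orbT.
by rewrite !andbT; apply/andP; split; apply/andP; split; lra.
Qed.

Lemma boundary_left (j : 'I_n) : on_boundary z L (z + j%:R * (I * r%:C)).
Proof.
have /andP[h1 h2] := jL j.
have -> : j%:R * (I * r%:C) = I * (j%:R * r%:C) by ring.
rewrite /on_boundary /in_square !ReD !ImD !Re_mulI !Im_mulI !Re_natr_real !Im_natr_real /=.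
rewrite ?oppr0 !(addr0, add0r) eqxx !andbT.
by apply/andP; split; apply/andP; split; lra.
Qed.

Lemma boundary_top (j : 'I_n) :
  on_boundary z L (z + I * (n%:R * r%:C) + j%:R * r%:C).
Proof.
have /andP[h1 h2] := jL j.
rewrite /on_boundary /in_square !ReD !ImD !Re_mulI !Im_mulI !Re_natr_real !Im_natr_real /=.
rewrite ?oppr0 !(addr0, add0r) eqxx !orbT !andbT.
by apply/andP; split; apply/andP; split; rewrite -/L; lra.
Qed.

Lemma boundary_right (j : 'I_n) :
  on_boundary z L (z + n%:R * r%:C + j%:R * (I * r%:C)).
Proof.
have /andP[h1 h2] := jL j.
have -> : j%:R * (I * r%:C) = I * (j%:R * r%:C) by ring.
rewrite /on_boundary /in_square !ReD !ImD !Re_mulI !Im_mulI !Re_natr_real !Im_natr_real /=.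
rewrite ?oppr0 !(addr0, add0r) eqxx !orbT !andbT.
by apply/andP; split; apply/andP; split; rewrite -/L; lra.
Qed.

Let path_le (F : 'I_n -> C) : (forall j, nm (F j) <= K) -> nm (\sum_j F j) <= n%:R * K.
Proof.
move=> H; apply: le_trans (normc_sum _ _ _) _.
apply: le_trans (ler_sum _ (fun j _ => H j)) _.
by rewrite sumr_const card_ord mulr_natl.
Qed.

Lemma contour_le : nm (contour f z r%:C n) <= 4 * K * L.
Proof.
rewrite /contour ComplexField.Normc.normcM normc_real gtr0_norm//.
have -> : 4 * K * L = r * (n%:R * K + n%:R * K + (n%:R * K + n%:R * K)).
  by rewrite /L; ring.
rewrite ler_wpM2l ?(ltW r0)//; apply: le_trans (le_normcD _ _) _; apply: lerD.
  apply: le_trans (normcB _ _) _; apply: lerD; apply: path_le => j; apply: fK.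
    exact: boundary_bottom.
  exact: boundary_top.
rewrite ComplexField.Normc.normcM.
have -> : nm I = 1 by rewrite /= expr0n add0r expr1n sqrtr1.
rewrite mul1r.
apply: le_trans (normcB _ _) _; apply: lerD; apply: path_le => j; apply: fK.
  exact: boundary_right.
exact: boundary_left.
Qed.

End Bound.
End Contour.

(** * Goursat's theorem with exceptional points *)

Section Goursat.
Variable R : realType.
Local Notation C := (R[i]).
Local Notation Re := (@complex.Re R).
Local Notation Im := (@complex.Im R).
Local Notation "x %:C" := (real_complex R x).
Local Notation nm := (@ComplexField.Normc.normc R).
Local Notation I := (Complex (0 : R) 1).
Implicit Types (w z e : C) (f g : C -> C) (L : R) (ex : seq C).

Definition locally_bounded f w := exists K d : R,
  0 < d /\ forall v, nm (v - w) < d -> nm (f v) <= K.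

(** With a power of two as the number of steps, the quarters of a square are summed with the same
    step as the square itself, so bisection stays exact. *)
Definition dyadic_contour f z L N := contour f z (L / 2 ^+ N)%:C (2 ^ N).

Lemma dyadic_contour_split f z L N :
  dyadic_contour f z L N.+1 =
    dyadic_contour f z (L / 2) N + dyadic_contour f (z + (L / 2)%:C) (L / 2) N
    + dyadic_contour f (z + Complex 0 (L / 2)) (L / 2) N
    + dyadic_contour f (z + (L / 2)%:C + Complex 0 (L / 2)) (L / 2) N.
Proof.
have n0 : (2 : R) ^+ N != 0 by rewrite expf_neq0// pnatr_eq0.
have eh : L / 2 ^+ N.+1 = L / 2 / 2 ^+ N by rewrite exprS; field.
have e1 : (2 ^ N)%:R * (L / 2 / 2 ^+ N)%:C = (L / 2)%:C :> C.
  by rewrite natr_real_complex -rmorphM /=; congr (_%:C); rewrite natrX; field.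
have e2 : I * (L / 2)%:C = Complex 0 (L / 2) :> C.
  by apply/eqP; rewrite eq_complex /= !mul0r !mul1r ?(subr0, oppr0, addr0, add0r) !eqxx.
by rewrite /dyadic_contour expnS mul2n -addnn contour_split eh e1 e2.
Qed.

(* [crossing e z L] is additive under subdivision of the square and at least
   [1] as soon as the closed square contains [e]; next to an exceptional point
   it dominates a contour sum that is small but not [o(L^2)]. *)
Definition jump (a x : R) : R := (a <= x)%R%:R + (a < x)%R%:R.

Definition crossing e z L : R :=
  (jump (Re e) (Re z + L) - jump (Re e) (Re z)) *
  (jump (Im e) (Im z + L) - jump (Im e) (Im z)).

Lemma jump_homo a x y : x <= y -> jump a x <= jump a y.
Proof.
move=> xy; have le_bool (b c : bool) : (b -> c) -> b%:R <= c%:R :> R.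
  by case: b; case: c => // h; rewrite ?ler01//; have := h isT.
by apply: lerD; apply: le_bool => h; [exact: le_trans xy|exact: lt_le_trans xy].
Qed.

Lemma jump_le2 a x : 0 <= jump a x <= 2.
Proof. by rewrite /jump; case: (a <= x); case: (a < x) => /=; apply/andP; split; lra. Qed.

Lemma jump_ge1 a x y : x < y -> x <= a <= y -> 1 <= jump a y - jump a x.
Proof.
rewrite /jump => xy /andP[xa ay]; rewrite ay (ltNge a x) xa /=.
case: (ltP a y) => h2; case: (leP a x) => h1 /=; lra.
Qed.

Lemma crossing_ge0 e z L : 0 <= L -> 0 <= crossing e z L.
Proof. by move=> L0; rewrite mulr_ge0// subr_ge0 jump_homo// lerDl. Qed.

Lemma crossing_le4 e z L : crossing e z L <= 4.
Proof.
have /andP[a1 a2] := jump_le2 (Re e) (Re z + L).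
have /andP[a3 a4] := jump_le2 (Re e) (Re z).
have /andP[b1 b2] := jump_le2 (Im e) (Im z + L).
have /andP[b3 b4] := jump_le2 (Im e) (Im z).
apply: le_trans (ler_norm _) _; rewrite normrM.
rewrite (_ : 4 = 2 * 2 :> R); last by ring.
by apply: ler_pM => //; rewrite ler_norml; apply/andP; split; lra.
Qed.

Lemma crossing_ge1 e z L : 0 < L -> in_square z L e -> 1 <= crossing e z L.
Proof.
move=> L0 /andP[h1 h2]; rewrite -[1]mulr1.
by apply: ler_pM => //; apply: jump_ge1; rewrite ?ltrDl.
Qed.

Lemma crossing_split e z L : crossing e z L =
  crossing e z (L / 2) + crossing e (z + (L / 2)%:C) (L / 2)
  + crossing e (z + Complex 0 (L / 2)) (L / 2)
  + crossing e (z + (L / 2)%:C + Complex 0 (L / 2)) (L / 2).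
Proof.
have eL (u : R) : u + L / 2 + L / 2 = u + L by rewrite -addrA -splitr.
by rewrite /crossing !ReD !ImD /= !addr0 !eL; ring.
Qed.

Lemma dyadic_side L N : (2 ^ N)%:R * (L / 2 ^+ N) = L.
Proof. by rewrite natrX; field; rewrite expf_neq0// pnatr_eq0. Qed.

Lemma dyadic_contour_le f z L N K : 0 < L ->
  (forall w, on_boundary z L w -> nm (f w) <= K) ->
  nm (dyadic_contour f z L N) <= 4 * K * L.
Proof.
move=> L0 H; rewrite -{2}(dyadic_side L N).
apply: contour_le; first by rewrite divr_gt0 ?exprn_gt0.
by move=> w; rewrite dyadic_side; apply: H.
Qed.

Lemma on_boundaryW z L w : on_boundary z L w -> in_square z L w.
Proof. by case/andP. Qed.

(** The affine part of the expansion at [w] has contour sum 0; what remains is o(L) on a boundary of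
    length 4L. The bound does not depend on the number of steps. *)
Lemma dyadic_contour_derivable f w c : 0 < c -> derivable (f : C^o -> C^o) w 1 ->
  exists2 d, 0 < d & forall z L N, 0 < L -> L < d -> in_square z L w ->
    nm (dyadic_contour f z L N) <= c * L ^+ 2.
Proof.
move=> c0 /derivable_complexP[l Hl].
have [|d d0 Hd] := Hl (c / 8); first by rewrite divr_gt0.
exists (d / 2) => [|z L N L0 Ld wL]; first by rewrite divr_gt0.
have -> : dyadic_contour f z L N =
    dyadic_contour (fun v => f v - f w - l * (v - w)) z L N.
  rewrite /dyadic_contour; transitivity
    (contour (fun v => (f v - f w - l * (v - w)) + (f w + l * (v - w)))
       z (L / 2 ^+ N)%:C (2 ^ N)).
    by apply: eq_contour => v; ring.
  by rewrite contourD contour_affine addr0.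
have -> : c * L ^+ 2 = 4 * (c / 8 * (2 * L)) * L by field.
apply: dyadic_contour_le => // v /on_boundaryW vL.
have h := in_square_normc vL wL.
apply: le_trans (Hd v _) _; first by apply: le_lt_trans h _; lra.
by rewrite ler_wpM2l// divr_ge0 ?ltW.
Qed.

(** The majorant [phi], area plus crossing numbers, is additive under bisection, so a bound by
    [c' * phi] passes from the quarters to the square. Near a regular point the area dominates the
    contour sum; near an exceptional point the sum is O(L) while [phi] is at least 1. The global
    bound [M] on [phi] fixes [c']. *)
Lemma goursat f z L ex c : 0 < L -> 0 < c ->
  (forall w, in_square z L w -> w \notin ex -> derivable (f : C^o -> C^o) w 1) ->
  (forall w, w \in ex -> locally_bounded f w) ->
  exists N0, forall N, (N0 <= N)%N -> nm (dyadic_contour f z L N) <= c.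
Proof.
move=> L0 c0 fd fb.
pose phi z L := L ^+ 2 + \sum_(e <- ex) crossing e z L.
have phi0 z' L' : 0 <= L' -> 0 <= \sum_(e <- ex) crossing e z' L'.
  by move=> h; apply: sumr_ge0 => e _; apply: crossing_ge0.
pose M := L ^+ 2 + \sum_(e <- ex) (4 : R).
have M0 : 0 < M.
  by rewrite ltr_pwDl ?exprn_gt0//; apply: sumr_ge0 => *; rewrite ler0n.
have phiM : phi z L <= M by rewrite lerD2l; apply: ler_sum => e _; exact: crossing_le4.
pose c' := c / M; have c'0 : 0 < c' by rewrite divr_gt0.
suff [N0 H] : exists N0, forall N, (N0 <= N)%N ->
    nm (dyadic_contour f z L N) <= c' * phi z L.
  exists N0 => N /H /le_trans; apply.
  have -> : c = c' * M by rewrite /c' divfK// gt_eqF.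
  by rewrite ler_wpM2l// ltW.
apply: (square_bisection (P := fun z L => exists N0, forall N, (N0 <= N)%N ->
    nm (dyadic_contour f z L N) <= c' * phi z L)) => //.
  move=> {phiM} z1 L1 L10 [n1 H1] [n2 H2] [n3 H3] [n4 H4].
  (* Passing to the quarters uses up one dyadic level, hence the successor. *)
  exists (maxn (maxn n1 n2) (maxn n3 n4)).+1 => -[//|N].
  rewrite ltnS !geq_max => /andP[/andP[h1 h2] /andP[h3 h4]].
  rewrite dyadic_contour_split.
  have -> : phi z1 L1 = phi z1 (L1 / 2) + phi (z1 + (L1 / 2)%:C) (L1 / 2)
      + phi (z1 + Complex 0 (L1 / 2)) (L1 / 2)
      + phi (z1 + (L1 / 2)%:C + Complex 0 (L1 / 2)) (L1 / 2).
    by rewrite /phi (eq_bigr _ (fun e _ => crossing_split e z1 L1)) !big_split /=; field.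
  rewrite [c' * (_ + phi (_ + _ + _) _)]mulrDr [c' * (_ + phi (_ + Complex 0 _) _)]mulrDr
    [c' * (phi _ _ + phi _ _)]mulrDr.
  apply: le_trans (le_normcD _ _) _; apply: lerD; last exact: H4.
  apply: le_trans (le_normcD _ _) _; apply: lerD; last exact: H3.
  by apply: le_trans (le_normcD _ _) _; apply: lerD; [exact: H1|exact: H2].
move=> w wL; case: (boolP (w \in ex)) => wex; last first.
  have [d d0 Hd] := dyadic_contour_derivable c'0 (fd w wL wex).
  exists d => // z1 L1 L10 L1d w1; exists 0%N => N _.
  apply: le_trans (Hd _ _ _ L10 L1d w1) _.
  by rewrite ler_wpM2l ?(ltW c'0)// lerDl phi0// ltW.
have [K [d [d0 Hd]]] := fb w wex.
pose K1 := Num.max K 1.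
have K10 : 0 < K1 by rewrite lt_max ltr01 orbT.
exists (Num.min (d / 2) (c' / (4 * K1))).
  by rewrite lt_min !divr_gt0 ?mulr_gt0.
move=> z1 L1 L10; rewrite lt_min => /andP[L1d L1K] w1; exists 0%N => N _.
apply: (@le_trans _ _ (4 * K1 * L1)).
  apply: dyadic_contour_le => // v /on_boundaryW v1.
  rewrite le_max Hd//; apply: le_lt_trans (in_square_normc v1 w1) _; lra.
apply: (@le_trans _ _ (c' * 1)).
  by rewrite mulr1 mulrC -ler_pdivlMr ?mulr_gt0// ltW.
rewrite ler_wpM2l ?(ltW c'0)//.
apply: le_trans (crossing_ge1 L10 w1) _.
rewrite /phi (big_rem w) //=.
have h : 0 <= \sum_(y <- rem w ex) crossing y z1 L1.
  by apply: sumr_ge0 => e _; rewrite crossing_ge0// ltW.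
have := sqr_ge0 L1; lra.
Qed.

End Goursat.

(** * Rules of complex differentiation in pointwise form *)

Section ComplexDerivativeRules.
Variable R : realType.
Local Notation C := (R[i]).
Implicit Types (w a : C) (f g : C^o -> C^o).

Lemma derivable_cst_fun a w : derivable ((fun=> a) : C^o -> C^o) w 1.
Proof. exact: (@derivable_cst _ C^o C^o a w 1). Qed.

Lemma derivable_id_fun w : derivable ((fun v => v) : C^o -> C^o) w 1.
Proof. exact: (@derivable_id _ C^o w 1). Qed.

Lemma derivable_sub_fun f g w : derivable f w 1 -> derivable g w 1 ->
  derivable ((fun v => f v - g v) : C^o -> C^o) w 1.
Proof. exact: (@derivableB _ C^o C^o f g w 1). Qed.

Lemma derivable_mul_fun f g w : derivable f w 1 -> derivable g w 1 ->
  derivable ((fun v => f v * g v) : C^o -> C^o) w 1.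
Proof. exact: (@derivableM _ C^o f g w 1). Qed.

Lemma derivable_inv_fun f w : f w != 0 -> derivable f w 1 ->
  derivable ((fun v => (f v)^-1) : C^o -> C^o) w 1.
Proof. exact: (@derivableV _ C^o f w 1). Qed.

Lemma derivable_exp_fun f w n : derivable f w 1 ->
  derivable ((fun v => f v ^+ n) : C^o -> C^o) w 1.
Proof.
move=> df; elim: n => [|n IH]; first exact: derivable_cst_fun.
rewrite (_ : (fun v => _) = (fun v => f v * f v ^+ n)); last first.
  by apply/funext => u; rewrite exprS.
exact: derivable_mul_fun df IH.
Qed.

End ComplexDerivativeRules.

(** * Maximum modulus principle on a square *)

Section MaximumModulus.
Variable R : realType.
Local Notation C := (R[i]).
Local Notation Re := (@complex.Re R).
Local Notation Im := (@complex.Im R).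
Local Notation "x %:C" := (real_complex R x).
Local Notation nm := (@ComplexField.Normc.normc R).
Local Notation I := (Complex (0 : R) 1).
Implicit Types (w z e : C) (f g : C^o -> C^o) (L : R) (ex : seq C).

Lemma bernoulli (t : R) n : 0 <= t -> 1 + n%:R * t <= (1 + t) ^+ n.
Proof.
move=> t0; elim: n => [|n IH]; first by rewrite mul0r addr0 expr0.
rewrite exprS -natr1; apply: (@le_trans _ _ ((1 + t) * (1 + n%:R * t))).
  have : 0 <= n%:R * t * t by rewrite !mulr_ge0 ?ler0n.
  nra.
by rewrite ler_wpM2l// addr_ge0.
Qed.

(** Constants disappear on taking n-th roots. Concretely, if [b < a], Bernoulli's inequality makes
    (a/b)^n exceed K/c for some n. *)
Lemma le_of_le_scaled_powers (a b c K : R) : 0 <= b -> 0 < c ->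
  (forall n, c * a ^+ n <= K * b ^+ n) -> a <= b.
Proof.
move=> b0 c0 H; rewrite leNgt; apply/negP => ba.
have a0 : 0 < a by apply: le_lt_trans ba.
have [be|bn] := eqVneq b 0.
  have := H 1%N; rewrite be !expr1 mulr0 => h.
  by have := mulr_gt0 c0 a0; rewrite ltNge h.
have b1 : 0 < b by rewrite lt_def bn.
pose t := a / b - 1; have t0 : 0 < t by rewrite subr_gt0 ltr_pdivlMr ?mul1r.
have [n Hn] : exists n : nat, K / (c * t) < n%:R.
  exists (Num.bound `|K / (c * t)|); apply: le_lt_trans (ler_norm _) _.
  by apply: archi_boundP.
have := H n; rewrite -ler_pdivrMr ?exprn_gt0// -mulrA -expr_div_n.
have -> : a / b = 1 + t by rewrite /t addrC subrK.
move=> h; have := bernoulli n (ltW t0) => h2.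
move: Hn; rewrite ltr_pdivrMr ?mulr_gt0// => h3.
have : c * (1 + n%:R * t) <= K by apply: le_trans h; rewrite ler_wpM2l ?(ltW c0).
nra.
Qed.

Lemma Im_real_mul (r : R) z : Im (r%:C * z) = r * Im z.
Proof. by rewrite ImM /= mul0r addr0. Qed.

Lemma Im_path_sum f z d n : Im (path_sum f z d n) = \sum_(j < n) Im (f (z + j%:R * d)).
Proof. exact: Im_sum. Qed.

Lemma Re_path_sum f z d n : Re (path_sum f z d n) = \sum_(j < n) Re (f (z + j%:R * d)).
Proof. exact: Re_sum. Qed.

(* Every term has nonnegative imaginary part because [w] lies inside. *)
Lemma contour_inv_ge w z (r : R) n : 0 < r -> (0 < n)%N ->
  let L := n%:R * r in
  Re z < Re w < Re z + L -> Im z < Im w < Im z + L ->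
  (Im w - Im z) / (4 * L) <= Im (contour (fun v => (v - w)^-1) z r%:C n).
Proof.
move=> r0 n0 L /andP[a1 a2] /andP[b1 b2].
have L0 : 0 < L by rewrite mulr_gt0// ltr0n.
have wL : in_square z L w by rewrite /in_square !ltW.
have jL (j : 'I_n) : 0 <= j%:R * r <= L.
  by rewrite mulr_ge0 ?ler0n ?(ltW r0)//= /L ler_wpM2r ?(ltW r0)// ler_nat ltnW.
rewrite /contour Im_real_mul ImD ImB Im_mulI ReB !Im_path_sum !Re_path_sum.
have top : \sum_(j < n) Im ((z + I * (n%:R * r%:C) + j%:R * r%:C - w)^-1) <= 0.
  apply: sumr_le0 => j _; rewrite ImV mulNr oppr_le0 divr_ge0 ?sqr_ge0//.
  by rewrite ImB !ImD Im_mulI Re_natr_real Im_natr_real -/L; lra.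
have right : 0 <= \sum_(j < n) Re ((z + n%:R * r%:C + j%:R * (I * r%:C) - w)^-1).
  apply: sumr_ge0 => j _; rewrite ReV divr_ge0 ?sqr_ge0//.
  have -> : j%:R * (I * r%:C) = I * (j%:R * r%:C) by ring.
  by rewrite ReB !ReD Re_mulI Re_natr_real Im_natr_real -/L; lra.
have left_ : \sum_(j < n) Re ((z + j%:R * (I * r%:C) - w)^-1) <= 0.
  apply: sumr_le0 => j _; rewrite ReV mulr_le0_ge0 ?invr_ge0 ?sqr_ge0//.
  have -> : j%:R * (I * r%:C) = I * (j%:R * r%:C) by ring.
  by rewrite ReB !ReD Re_mulI Im_natr_real; lra.
(* The bottom side alone supplies the lower bound: its points lie [Im w - Im z] below [w] and at
   distance at most 2L from it. *)
have bot : (Im w - Im z) / (4 * L ^+ 2) *+ n <= \sum_(j < n) Im ((z + j%:R * r%:C - w)^-1).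
  rewrite -[n in _ *+ n]card_ord -sumr_const; apply: ler_sum => j _.
  rewrite ImV ImB ImD Im_natr_real addr0 opprB.
  rewrite ler_wpM2l ?subr_ge0 ?(ltW b1)//.
  have vL := on_boundaryW (boundary_bottom z r0 j).
  have h := in_square_normc vL wL.
  have n1 : 0 < nm (z + j%:R * r%:C - w).
    rewrite normc_gt0; apply/eqP => /(congr1 Im); rewrite ImB ImD Im_natr_real /=; lra.
  have L2 : 0 < 4 * L ^+ 2 by rewrite mulr_gt0 ?exprn_gt0.
  rewrite lef_pV2 ?posrE ?exprn_gt0//.
  rewrite (_ : 4 * L ^+ 2 = (2 * L) ^+ 2); last by ring.
  by rewrite ler_sqr ?nnegrE ?normc_ge0// mulr_ge0 ?ltW.
apply: (@le_trans _ _ (r * ((Im w - Im z) / (4 * L ^+ 2) *+ n))).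
  rewrite -mulr_natr le_eqVlt; apply/orP; left; apply/eqP.
  rewrite /L; field; apply/andP; split; first by rewrite gt_eqF.
  by rewrite pnatr_eq0 -lt0n.
rewrite ler_wpM2l ?(ltW r0)//; lra.
Qed.

Lemma derivable_locally_bounded f w : derivable f w 1 -> locally_bounded f w.
Proof.
move=> /derivable_complexP[l Hl]; have [d d0 Hd] := Hl 1 ltr01.
exists ((1 + nm l) * d + nm (f w)), d; split => // v vd.
apply: le_trans (normc_le_add _ (f w)) _; rewrite lerD2r.
have -> : f v - f w = (f v - f w - l * (v - w)) + l * (v - w) by ring.
apply: le_trans (le_normcD _ _) _.
rewrite ComplexField.Normc.normcM; have := Hd v vd => h.
have := normc_ge0 l; have := normc_ge0 (v - w); nra.
Qed.

Lemma derivable_quotient_bounded f w : derivable f w 1 ->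
  locally_bounded (fun v => (f v - f w) / (v - w)) w.
Proof.
move=> /derivable_complexP[l Hl]; have [d d0 Hd] := Hl 1 ltr01.
exists (1 + nm l), d; split => // v vd.
have [->|vw] := eqVneq v w.
  by rewrite subrr mul0r ComplexField.Normc.normc0 addr_ge0 ?normc_ge0.
have v0 : 0 < nm (v - w) by rewrite normc_gt0 subr_eq0.
rewrite ComplexField.Normc.normcM ComplexField.Normc.normcV ler_pdivrMr//.
have -> : f v - f w = (f v - f w - l * (v - w)) + l * (v - w) by ring.
apply: le_trans (le_normcD _ _) _.
rewrite ComplexField.Normc.normcM mulrDl lerD2r; exact: Hd.
Qed.

Lemma locally_boundedM f g w : locally_bounded f w -> locally_bounded g w ->
  locally_bounded (fun v => f v * g v) w.
Proof.
move=> [K [d [d0 H]]] [K' [d' [d'0 H']]].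
exists (K * K'), (Num.min d d'); split; first by rewrite lt_min d0.
move=> v; rewrite lt_min => /andP[h h'].
by rewrite ComplexField.Normc.normcM ler_pM ?normc_ge0 ?H ?H'.
Qed.

Lemma locally_boundedX f w n : locally_bounded f w ->
  locally_bounded (fun v => f v ^+ n) w.
Proof.
move=> [K [d [d0 H]]]; exists (K ^+ n), d; split => // v /H h.
rewrite normcX lerXn2r ?nnegrE ?normc_ge0//; exact: le_trans (normc_ge0 _) h.
Qed.

Lemma locally_boundedBc f w c : locally_bounded f w ->
  locally_bounded (fun v => f v - c) w.
Proof.
move=> [K [d [d0 H]]]; exists (K + nm c), d; split => // v /H h.
by apply: le_trans (normcB _ _) _; rewrite lerD2r.
Qed.

Lemma derivable_sub_cst w v : derivable ((fun u => u - w) : C^o -> C^o) v 1.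
Proof.
apply: (@derivable_sub_fun _ (fun u => u) (fun=> w)); first exact: derivable_id_fun.
exact: derivable_cst_fun.
Qed.

Lemma derivable_inv_sub w v : v != w -> derivable ((fun u => (u - w)^-1) : C^o -> C^o) v 1.
Proof.
move=> vw; apply: (@derivable_inv_fun _ (fun u => u - w)); first by rewrite subr_eq0.
exact: derivable_sub_cst.
Qed.

(** The contour sum of 1/(v - w) is never evaluated: a positive lower bound independent of the power
    n and of the step is enough, because [le_of_le_scaled_powers] erases all such constants. The set
    [ex] is there for removable singularities. *)
Lemma max_modulus_square f z L (B : R) w ex : 0 < L ->
  Re z < Re w < Re z + L -> Im z < Im w < Im z + L -> w \notin ex ->
  (forall v, in_square z L v -> v \notin ex -> derivable f v 1) ->
  (forall v, v \in ex -> locally_bounded f v) ->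
  (forall v, on_boundary z L v -> nm (f v) <= B) -> nm (f w) <= B.
Proof.
move=> L0 wr wi wex fd fb fB.
have B0 : 0 <= B.
  apply: le_trans (normc_ge0 _) (fB z _).
  by rewrite /on_boundary /in_square !lexx eqxx /= !lerDl (ltW L0).
(* The distance from [w] to the nearest side, which bounds 1/(v - w) on the boundary. *)
pose del := Num.min (Num.min (Re w - Re z) (Re z + L - Re w))
                    (Num.min (Im w - Im z) (Im z + L - Im w)).
move: (wr) (wi) => /andP[a1 a2] /andP[b1 b2].
have del0 : 0 < del by rewrite !lt_min !subr_gt0 a1 a2 b1 b2.
have delP v : on_boundary z L v -> del <= nm (v - w).
  have /andP[/andP[d1 d2] /andP[d3 d4]] : [&& (del <= Re w - Re z) && (del <= Re z + L - Re w),
      del <= Im w - Im z & del <= Im z + L - Im w].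
    by rewrite /del !ge_min !lexx !orbT.
  have h1 := normRe_le (v - w); have h2 := normIm_le (v - w).
  move: h1 h2; rewrite ReB ImB !ler_norml => /andP[h1 h2] /andP[h3 h4].
  by case/andP => _ /or4P[]/eqP e; lra.
have wL : in_square z L w by rewrite /in_square !ltW.
pose c := (Im w - Im z) / (4 * L).
have c0 : 0 < c by rewrite divr_gt0 ?subr_gt0// mulr_gt0.
apply: (@le_of_le_scaled_powers _ _ c (4 * L / del)) => // n.
apply/ler_addgt0Pr => eps eps0.
pose g v := (f v ^+ n - f w ^+ n) / (v - w).
have [||N0 H] := @goursat _ g z L (w :: ex) eps L0 eps0.
- move=> v vL; rewrite inE negb_or => /andP[vw vex].
  apply: (@derivable_mul_fun _ (fun v => f v ^+ n - f w ^+ n) (fun v => (v - w)^-1)).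
    apply: (@derivable_sub_fun _ (fun v => f v ^+ n)); last exact: derivable_cst_fun.
    exact: derivable_exp_fun (fd v vL vex).
  exact: derivable_inv_sub.
- move=> v; rewrite inE => /predU1P[->|vex].
    apply: (@derivable_quotient_bounded (fun v => f v ^+ n)).
    exact: derivable_exp_fun (fd w wL wex).
  have vw : v != w by apply: contraNneq wex => <-.
  apply: (@locally_boundedM (fun v => f v ^+ n - f w ^+ n) (fun v => (v - w)^-1)).
    apply: (@locally_boundedBc (fun v => f v ^+ n)).
    exact: locally_boundedX (fb _ vex).
  exact/derivable_locally_bounded/derivable_inv_sub.
have := H N0 (leqnn _); rewrite /dyadic_contour.
set h := (L / 2 ^+ N0); set m := (2 ^ N0)%N => Hg.
have mh : m%:R * h = L by apply: dyadic_side.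
have h0 : 0 < h by rewrite divr_gt0 ?exprn_gt0.
have m0 : (0 < m)%N by rewrite expn_gt0.
have e1 : contour g z h%:C m = contour (fun v => f v ^+ n / (v - w)) z h%:C m
   - f w ^+ n * contour (fun v => (v - w)^-1) z h%:C m.
  rewrite -mulNr -contourZ -contourD; apply: eq_contour => v.
  by rewrite /g mulrBl mulNr.
have h1 : nm (contour (fun v => f v ^+ n / (v - w)) z h%:C m) <= 4 * (B ^+ n / del) * L.
  rewrite -[X in _ * X]mh; apply: contour_le => // v; rewrite mh => vb.
  rewrite ComplexField.Normc.normcM ComplexField.Normc.normcV normcX.
  apply: ler_pM; rewrite ?exprn_ge0 ?normc_ge0 ?invr_ge0 ?normc_ge0//.
    by rewrite lerXn2r ?nnegrE ?normc_ge0 ?fB.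
  have vd := delP v vb.
  by rewrite lef_pV2 ?posrE//; apply: lt_le_trans vd.
have h2 : c <= nm (contour (fun v => (v - w)^-1) z h%:C m).
  apply: le_trans (le_trans (ler_norm _) (normIm_le _)).
  by rewrite /c -mh; apply: contour_inv_ge; rewrite ?mh.
apply: (@le_trans _ _ (nm (f w ^+ n * contour (fun v => (v - w)^-1) z h%:C m))).
  by rewrite ComplexField.Normc.normcM normcX mulrC ler_wpM2l// exprn_ge0 ?normc_ge0.
rewrite (_ : f w ^+ n * _ = contour (fun v => f v ^+ n / (v - w)) z h%:C m - contour g z h%:C m).
  apply: le_trans (normcB _ _) _; apply: lerD => //.
  by rewrite (_ : 4 * L / del * B ^+ n = 4 * (B ^+ n / del) * L) //; field; rewrite gt_eqF.
by rewrite e1; ring.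
Qed.

End MaximumModulus.

(** * Cusp forms of level one *)

Section LevelOne.
Variable R : realType.
Local Notation C := (R[i]).
Local Notation Re := (@complex.Re R).
Local Notation Im := (@complex.Im R).
Local Notation "x %:C" := (real_complex R x).
Local Notation nm := (@ComplexField.Normc.normc R).
Implicit Types (w z e : C) (f g : C^o -> C^o) (L : R).

Lemma mx22E (a b c d : int) : [/\ mx22 a b c d 0 0 = a, mx22 a b c d 0 1 = b,
  mx22 a b c d 1 0 = c & mx22 a b c d 1 1 = d].
Proof. by rewrite !mxE. Qed.

Lemma det_mx2E (g : 'M[int]_2) : \det g = g 0 0 * g 1 1 - g 0 1 * g 1 0.
Proof.
rewrite (expand_det_row _ 0) !big_ord_recl big_ord0 /cofactor !det_mx11 !mxE.
rewrite (_ : lift 0 0 = 1 :> 'I_2); last exact: val_inj.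
rewrite (_ : lift 1 0 = 0 :> 'I_2); last exact: val_inj.
by rewrite expr0 expr1 mul1r mulN1r mulrN addr0.
Qed.

Lemma det_mx22 (a b c d : int) : \det (mx22 a b c d) = a * d - b * c.
Proof. by rewrite det_mx2E; case: (mx22E a b c d) => -> -> -> ->. Qed.

Lemma slash_det1 k (g : 'M[int]_2) f z : \det g = 1 ->
  slash k g f z = ((g 1 0)%:~R * z + (g 1 1)%:~R) ^- k * f (mobius g z).
Proof. by move=> g1; rewrite /slash g1 expr1n mul1r. Qed.

Lemma Gamma0_1 (g : 'M[int]_2) : Gamma0 1 g <-> \det g = 1.
Proof. by split => [[]//|h]; split => //; rewrite dvd1z. Qed.

Section Modularity.
Variables (k : nat) (f : C^o -> C^o).
Hypothesis cf : cuspforms k 1 f.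

Lemma cuspform_modular (g : 'M[int]_2) z : \det g = 1 ->
  ((g 1 0)%:~R * z + (g 1 1)%:~R) ^- k * f (mobius g z) = f z.
Proof.
move=> g1; rewrite -slash_det1//; case: cf => _ _ H _.
by rewrite H//; apply/Gamma0_1.
Qed.

Lemma cuspform_translate z (m : int) : f (z + m%:~R) = f z.
Proof.
have := @cuspform_modular (mx22 1 m 0 1) z; rewrite det_mx22 /mobius.
have d1 : 1 * 1 - m * 0 = 1 :> int by ring.
case: (mx22E 1 m 0 1) => -> -> -> -> /(_ d1).
by rewrite mulr0z mulr1z !mul0r !add0r invr1 expr1n invr1 !mul1r mulr1.
Qed.

Lemma cuspform_inversion z : 0 < Im z -> f (- z^-1) = z ^+ k * f z.
Proof.
move=> z0; have nz : z != 0 by apply: contraTneq z0 => ->; rewrite ltxx.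
have := @cuspform_modular (mx22 0 (-1) 1 0) z; rewrite det_mx22 /mobius.
case: (mx22E 0 (-1) 1 0) => -> -> -> -> /(_ erefl).
rewrite mulr0z mulr1z !mul0r !mul1r !addr0 !add0r => <-.
by rewrite mulrN1z mulN1r mulrA divff ?mul1r// expf_neq0.
Qed.

Lemma cuspform_derivable z : 0 < Im z -> derivable f z 1.
Proof. by case: cf => _ H _ _; apply: H. Qed.

Lemma cuspform_at_infinity (eps : R) : 0 < eps -> exists A : R,
  forall z, A < Im z -> nm (f z) < eps.
Proof.
move=> e0; case: cf => _ _ _ /(_ 1%:M); rewrite /SL2Z /= det1 => /(_ erefl).
move=> /(_ eps e0)[A HA]; exists A => z /HA.
rewrite slash_det1 ?det1// /mobius !mxE /=.
by rewrite !mul0r !mul1r !addr0 add0r invr1 expr1n invr1 mul1r mulr1.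
Qed.

Lemma exists_translate z : exists m : int, `|Re (z + m%:~R)| <= 1 / 2.
Proof.
exists (- Num.floor (Re z + 1 / 2)); rewrite ReD.
have e : Re ((- Num.floor (Re z + 1 / 2))%:~R) = - (Num.floor (Re z + 1 / 2))%:~R.
  by rewrite -(rmorph_int (real_complex R)) /= mulrNz.
rewrite e; have /andP[h1 h2] := floor_itv (Re z + 1 / 2).
move: h2; rewrite intrD => h2; rewrite ler_norml; apply/andP; split; lra.
Qed.

Lemma Im_translate z (m : int) : Im (z + m%:~R) = Im z.
Proof. by rewrite ImD -(rmorph_int (real_complex R)) /= addr0. Qed.

Lemma Im_inversion z : Im (- z^-1) = Im z / nm z ^+ 2.
Proof. by rewrite -sub0r ImB ImV /= sub0r mulNr opprK. Qed.

(* Translating into the strip and inverting at least doubles an imaginary part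
   below 1/2. *)
Lemma cuspform_eq0_of_strip : (forall z, 1 / 2 <= Im z -> f z = 0) -> f = 0.
Proof.
move=> H.
have Hn n z : 1 / 2 <= 2 ^+ n * Im z -> f z = 0.
  elim: n z => [|n IH] z; first by rewrite expr0 [1 * Im z]mul1r; apply: H.
  move=> zn; have z0 : 0 < Im z.
    by rewrite -(pmulr_rgt0 _ (exprn_gt0 n.+1 (@ltr0Sn R 1))); lra.
  case: (leP (1 / 2) (Im z)) => [/H //|z2].
  have [m zm] := exists_translate z.
  rewrite -(cuspform_translate z m); set u := z + m%:~R.
  have u0 : Im u = Im z by rewrite Im_translate.
  have u2 : nm u ^+ 2 <= 1 / 2.
    rewrite normc_sq u0; move: zm; rewrite -/u ler_norml => /andP[h1 h2]; nra.
  have n0 : 0 < nm u.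
    by rewrite normc_gt0; apply: contraTneq z0 => e; rewrite -u0 e ltxx.
  have := IH (- u^-1); rewrite cuspform_inversion ?u0// => IHu.
  have /IHu/eqP : 1 / 2 <= 2 ^+ n * Im (- u^-1).
    apply: (le_trans zn); rewrite Im_inversion u0 exprSr -mulrA ler_wpM2l ?exprn_ge0//.
    rewrite ler_pdivlMr ?exprn_gt0//; nra.
  rewrite mulf_eq0 => /orP[|/eqP //].
  rewrite expf_eq0 => /andP[_ /eqP e]; by move: n0; rewrite e ComplexField.Normc.normc0 ltxx.
apply/funext => z; case: (ltP 0 (Im z)) => z0; last first.
  by case: cf => h _ _ _; apply: h => /=; rewrite /upper_half_plane /= ltNge z0.
apply: (Hn (Num.bound (1 / 2 / Im z))); rewrite -ler_pdivrMr//.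
apply: ltW; apply: lt_le_trans (archi_boundP _) _; first by rewrite divr_ge0 ?ltW.
rewrite -natrX ler_nat; exact/ltnW/ltn_expl.
Qed.

End Modularity.
End LevelOne.

(** * Dividing out zeros against their reflections *)

Section CuspFormZeros.
Variable R : realType.
Local Notation C := (R[i]).
Local Notation Re := (@complex.Re R).
Local Notation Im := (@complex.Im R).
Local Notation "x %:C" := (real_complex R x).
Local Notation nm := (@ComplexField.Normc.normc R).
Local Notation normcM := ComplexField.Normc.normcM.
Local Notation normcV := ComplexField.Normc.normcV.
Implicit Types (w z a : C) (f g : C^o -> C^o) (L : R).

Lemma derivable_normc_continuous f w (e : R) : 0 < e -> derivable f w 1 ->
  exists2 d, 0 < d & forall v, nm (v - w) < d -> nm (f v - f w) <= e.
Proof.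
move=> e0 /derivable_complexP[l Hl]; have [d d0 Hd] := Hl 1 ltr01.
have l0 : 0 < 1 + nm l by rewrite ltr_wpDr ?normc_ge0.
exists (Num.min d (e / (1 + nm l))); first by rewrite lt_min d0 divr_gt0.
move=> v; rewrite lt_min => /andP[/Hd h]; rewrite ltr_pdivlMr// => h'.
have -> : f v - f w = (f v - f w - l * (v - w)) + l * (v - w) by ring.
apply: le_trans (le_normcD _ _) _; rewrite normcM.
by move: h h'; move: (nm (v - w)) (nm l) => x y; nra.
Qed.

Lemma in_square_quarter z L v : in_square z L v ->
  [\/ in_square z (L / 2) v, in_square (z + (L / 2)%:C) (L / 2) v,
      in_square (z + Complex 0 (L / 2)) (L / 2) v |
      in_square (z + (L / 2)%:C + Complex 0 (L / 2)) (L / 2) v].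
Proof.
rewrite /in_square !ReD !ImD /= => /andP[/andP[a1 a2] /andP[b1 b2]].
case: (leP (Re v) (Re z + L / 2)) => h1; case: (leP (Im v) (Im z + L / 2)) => h2.
- by apply: Or41; apply/andP; split; apply/andP; split; lra.
- by apply: Or43; apply/andP; split; apply/andP; split; lra.
- by apply: Or42; apply/andP; split; apply/andP; split; lra.
- by apply: Or44; apply/andP; split; apply/andP; split; lra.
Qed.

(** Two bisections. The first glues local bounds into a global one, so the supremum is finite. If it
    were not attained, every point would have a neighbourhood where the modulus stays below some a <
    sup, and the second bisection would glue these into one such bound. *)
Lemma square_max f z L : 0 < L ->
  (forall v, in_square z L v -> derivable f v 1) ->
  exists2 w, in_square z L w & forall v, in_square z L v -> nm (f v) <= nm (f w).
Proof.
move=> L0 fd.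
have zz : in_square z L z by rewrite /in_square !lexx !lerDl (ltW L0).
have [K HK] : exists K, forall v, in_square z L v -> nm (f v) <= K.
  apply: (@square_bisection _ (fun z L => exists K, forall v, in_square z L v -> nm (f v) <= K)) => //.
    move=> {L0 fd zz} z1 L1 _ [k1 H1] [k2 H2] [k3 H3] [k4 H4].
    exists (Num.max (Num.max k1 k2) (Num.max k3 k4)) => v /in_square_quarter.
    by case=> [/H1|/H2|/H3|/H4] h; rewrite !le_max h ?orbT.
  move=> w /fd/derivable_locally_bounded[K [d [d0 Hd]]].
  exists (d / 2); first by rewrite divr_gt0.
  move=> z1 L1 L10 L1d w1; exists K => v v1; apply: Hd.
  apply: le_lt_trans (in_square_normc v1 w1) _; lra.
apply: contrapT => nmax.
pose E := [set nm (f v) | v in [set v | in_square z L v]]%classic.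
have hE : has_sup E.
  split; first by exists (nm (f z)), z.
  by exists K => _ [v vL <-]; apply: HK.
have Eub v : in_square z L v -> nm (f v) <= sup E.
  by move=> vL; apply: ub_le_sup; [exact: hE.2|exists v].
have Elt v : in_square z L v -> nm (f v) < sup E.
  move=> vL; rewrite lt_neqAle Eub// andbT; apply/eqP => e; apply: nmax.
  by exists v => // u /Eub; rewrite e.
have [a aS Ha] : exists2 a, a < sup E & forall v, in_square z L v -> nm (f v) <= a.
  suff [a aS Ha] : exists2 a, a < sup E & forall v, in_square z L v ->
      in_square z L v -> nm (f v) <= a.
    by exists a => // v vL; apply: Ha.
  apply: (@square_bisection _ (fun z1 L1 => exists2 a, a < sup E & forall v,
    in_square z1 L1 v -> in_square z L v -> nm (f v) <= a)) => //.
    move=> z1 L1 _ [k1 h1 H1] [k2 h2 H2] [k3 h3 H3] [k4 h4 H4].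
    exists (Num.max (Num.max k1 k2) (Num.max k3 k4)); first by rewrite !gt_max h1 h2 h3.
    move=> v /in_square_quarter.
    by case=> [/H1|/H2|/H3|/H4] h /h {}h; rewrite !le_max h ?orbT.
  move=> w wL; have wS := Elt w wL.
  have e0 : 0 < (sup E - nm (f w)) / 2 by rewrite divr_gt0 ?subr_gt0.
  have [d d0 Hd] := derivable_normc_continuous e0 (fd w wL).
  exists (d / 2); first by rewrite divr_gt0.
  move=> z1 L1 L10 L1d w1; exists ((sup E + nm (f w)) / 2); first lra.
  move=> v v1 _; apply: le_trans (normc_le_add _ (f w)) _.
  have := Hd v; have := in_square_normc v1 w1 => h1 h2.
  have : nm (v - w) < d by lra.
  move=> /h2; lra.
have : sup E <= a by apply: ge_sup; [exact: hE.1|move=> _ [v vL <-]; apply: Ha].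
by rewrite leNgt aS.
Qed.

Lemma normc_prod (s : seq C) (F : C -> C) :
  nm (\prod_(a <- s) F a) = \prod_(a <- s) nm (F a).
Proof.
apply: (big_morph nm); first exact: normcM.
exact: ComplexField.Normc.normc1.
Qed.

Definition refl a : C := Complex (Re a) (1 - Im a).

Lemma refl_dist a v : Im v = 1 / 2 -> nm (v - refl a) = nm (v - a).
Proof.
move=> vi; apply/eqP; rewrite -(@eqrXn2 _ 2) ?normc_ge0// !normc_sq !ReB !ImB /= vi.
by apply/eqP; field.
Qed.

Lemma locally_bounded_prod w (s : seq C) (G : C -> C^o -> C^o) :
  (forall a, a \in s -> locally_bounded (G a) w) ->
  locally_bounded (fun v => \prod_(a <- s) G a v) w.
Proof.
elim: s => [|a s IH] H.
  exists 1, 1; split => // v _; by rewrite big_nil ComplexField.Normc.normc1.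
have [K [d [d0 Hd]]] := locally_boundedM (H a (mem_head _ _))
  (IH (fun b bs => H b (mem_behead (bs : b \in behead (a :: s))))).
by exists K, d; split => // v /Hd; rewrite big_cons.
Qed.

Lemma derivable_prod w (s : seq C) (G : C -> C^o -> C^o) :
  (forall a, a \in s -> derivable (G a) w 1) ->
  derivable ((fun v => \prod_(a <- s) G a v) : C^o -> C^o) w 1.
Proof.
elim: s => [|a s IH] H.
  rewrite (_ : (fun v => _) = (fun=> 1)); first exact: derivable_cst_fun.
  by apply/funext => v; rewrite big_nil.
rewrite (_ : (fun v => _) = (fun v => G a v * \prod_(b <- s) G b v)); last first.
  by apply/funext => v; rewrite big_cons.
apply: derivable_mul_fun; first exact: H (mem_head _ _).
by apply: IH => b bs; apply: H; exact: mem_behead.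
Qed.

Lemma derivable_ratio a w : w != a ->
  derivable ((fun v => (v - refl a) / (v - a)) : C^o -> C^o) w 1.
Proof.
move=> wa; apply: (@derivable_mul_fun _ (fun v => v - refl a) (fun v => (v - a)^-1)).
  exact: derivable_sub_cst.
exact: derivable_inv_sub.
Qed.

(* Schwarz-lemma argument: dividing out the zeros [s] against their reflections
   does not change the modulus on the line [Im z = 1/2], and hardly changes it
   far away. *)
Lemma reflection_bound f (A : R) (s : seq C) w : uniq s ->
  (forall z, 1 / 2 <= Im z -> derivable f z 1) ->
  (forall z, 1 / 2 <= Im z -> nm (f z) <= A) ->
  (forall a, a \in s -> 1 / 2 < Im a /\ f a = 0) ->
  1 / 2 < Im w -> w \notin s ->
  nm (f w) * \prod_(a <- s) (nm (w - refl a) / nm (w - a)) <= A.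
Proof.
move=> us fd fA fs wi ws.
have A0 : 0 <= A by apply: le_trans (normc_ge0 _) (fA w (ltW wi)).
pose g v := f v * \prod_(a <- s) ((v - refl a) / (v - a)).
have gw : nm (g w) = nm (f w) * \prod_(a <- s) (nm (w - refl a) / nm (w - a)).
  rewrite /g normcM; congr (_ * _).
  rewrite normc_prod.
  by apply: eq_bigr => a _; rewrite normcM normcV.
rewrite -gw.
have [B HB] : exists B, 0 <= B /\ forall a, a \in s -> nm a <= B.
  elim: (s) => [|a s' [B [B0 IH]]]; first by exists 0.
  exists (Num.max B (nm a)); split; first by rewrite le_max B0.
  by move=> b; rewrite inE le_max => /predU1P[->|/IH ->]; rewrite ?lexx ?orbT.
case: HB => B0 HB.
(* A factor [1 + e] may be lost for each zero: it comes from the far sides of a square that can be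
   taken arbitrarily large. *)
suff H (e : R) : 0 < e -> nm (g w) <= A * (1 + e) ^+ size s.
  have Hp n (e : R) : 0 < e -> e <= 1 -> (1 + e) ^+ n <= 1 + 3 ^+ n * e.
    move=> e0 e1; elim: n => [|n IH]; first by rewrite !expr0; lra.
    rewrite exprS; apply: (@le_trans _ _ ((1 + e) * (1 + 3 ^+ n * e))).
      by rewrite ler_wpM2l//; lra.
    have : 1 <= 3 ^+ n :> R by rewrite exprn_ege1// ler1n.
    rewrite exprS; move: (3 ^+ n) => t t1; have := ler_wpM2l (ltW e0) t1; have := ler_wpM2r (mulr_ge0 (ltW e0) (le_trans ler01 t1)) e1; nra.
  apply/ler_addgt0Pr => eps eps0.
  pose e := Num.min 1 (eps / (3 ^+ size s * (A + 1))).
  have p0 : 0 < 3 ^+ size s * (A + 1) by rewrite mulr_gt0 ?exprn_gt0//; lra.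
  have e0 : 0 < e by rewrite lt_min ltr01 divr_gt0.
  have e1 : e <= 1 by rewrite ge_min lexx.
  apply: le_trans (H e e0) _.
  apply: le_trans (ler_wpM2l A0 (Hp (size s) e e0 e1)) _.
  have : e * (3 ^+ size s * (A + 1)) <= eps.
    by rewrite -ler_pdivlMr// ge_min lexx orbT.
  have : 0 <= 3 ^+ size s * e by rewrite mulr_ge0 ?exprn_ge0 ?(ltW e0).
  move: (3 ^+ size s) => t h1 h2; nra.
move=> e0.
(* Beyond modulus [T] the distance to each zero exceeds (2B + 1)/e, and 2B + 1 bounds the distance
   between a zero and its reflection, so each ratio is at most [1 + e]. The term [nm w + 1] puts [w]
   inside the square. *)
pose T := B + (2 * B + 1) / e + nm w + 1.
have q0 : 0 <= (2 * B + 1) / e by rewrite divr_ge0 ?(ltW e0)//; lra.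
have nw0 := normc_ge0 w.
have T0 : 0 < T by rewrite /T; lra.
have ratio_le v : T <= nm v -> forall a, a \in s -> nm ((v - refl a) / (v - a)) <= 1 + e.
  move=> vT a /HB aB.
  have h1 : (2 * B + 1) / e + 1 <= nm (v - a).
    have := normc_le_add v a; rewrite /T in vT; lra.
  have h2 : 0 < nm (v - a) by lra.
  have ra : nm (a - refl a) <= 2 * B + 1.
    apply: le_trans (normc_le_Re_Im _) _; rewrite ReB ImB /= subrr normr0 add0r.
    have := normIm_le a; rewrite !ler_norml => /andP[h3 h4]; apply/andP; split; lra.
  rewrite normcM normcV ler_pdivrMr//.
  have -> : v - refl a = (v - a) + (a - refl a) by ring.
  apply: le_trans (le_normcD _ _) _; rewrite mulrDl mul1r lerD2l.
  apply: (le_trans ra); rewrite -ler_pdivrMl// mulrC; lra.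
have aim a : a \in s -> 1 / 2 < Im a by case/fs.
have wn := normRe_le w; have wn2 := normIm_le w.
move: wn wn2; rewrite !ler_norml => /andP[wn1 wn2] /andP[wn3 wn4].
apply: (@max_modulus_square _ g (Complex (- T) (1 / 2)) (2 * T) _ w s) => //=.
- lra.
- by apply/andP; split; rewrite /T in T0 *; lra.
- by apply/andP; split; rewrite /T in T0 *; lra.
- move=> v /andP[_ /andP[/= v1 _]] vs.
  apply: derivable_mul_fun; first exact: fd.
  apply: derivable_prod => a as_; apply: derivable_ratio.
  by apply: contraNneq vs => ->.
- move=> v vs; have [vi fv] := fs v vs.
  (* At a zero [v] the pole of its own factor is absorbed by a difference quotient of [f]; as [s]
     has no repetition, the remaining factors are regular at [v]. *)
  have -> : g = (fun u => ((f u - f v) / (u - v)) *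
      ((u - refl v) * \prod_(a <- rem v s) ((u - refl a) / (u - a)))).
    by apply/funext => u; rewrite /g (big_rem v)//= fv subr0; ring.
  apply: locally_boundedM.
    by apply: derivable_quotient_bounded; apply: fd; exact: ltW.
  apply: locally_boundedM.
    apply: derivable_locally_bounded; exact: derivable_sub_cst.
  apply: locally_bounded_prod => a; rewrite mem_rem_uniq// inE => /andP[av _].
  by apply: derivable_locally_bounded; apply: derivable_ratio; rewrite eq_sym.
- move=> v vb; rewrite normcM.
  have vi : 1 / 2 <= Im v by case/andP: vb => /andP[_ /andP[]].
  apply: ler_pM; rewrite ?normc_ge0 ?fA//.
  rewrite normc_prod.
  have -> : (1 + e) ^+ size s = \prod_(a <- s) (1 + e).
    by rewrite big_const_seq count_predT iter_mulr_1.
  rewrite big_seq [leRHS]big_seq; apply: ler_prod => a as_; rewrite normc_ge0 /=.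
  (* On the bottom side, the axis of reflection, all ratios equal 1; the other three sides lie
     beyond modulus [T]. *)
  case: (eqVneq (Im v) (1 / 2)) => [vi2|vi2].
    rewrite normcM normcV refl_dist// divff; first by lra.
    rewrite normc_eq0 subr_eq0; apply/eqP => va; have := aim a as_.
    by rewrite -va vi2 ltxx.
  apply: ratio_le => //.
  have h1 := normRe_le v; have h2 := normIm_le v.
  move: h1 h2; rewrite !ler_norml => /andP[h1 h2] /andP[h3 h4].
  move: vb; rewrite /on_boundary /= => /andP[_ /or4P[]/eqP ee]; try lra.
Qed.

End CuspFormZeros.

(** * Bounding the dimension in weight 12 and level 1 *)

Section LevelOneDimension.
Variable R : realType.
Local Notation C := (R[i]).
Local Notation Re := (@complex.Re R).
Local Notation Im := (@complex.Im R).
Local Notation nm := (@ComplexField.Normc.normc R).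
Local Notation normcM := ComplexField.Normc.normcM.
Local Notation normcV := ComplexField.Normc.normcV.
Implicit Types (w z a : C) (f g : C^o -> C^o) (L : R).

(** Periodicity and decay at infinity reduce the half-plane to a square, where the maximum is
    attained; a translation then brings the maximum point to [|Re z0| <= 1/2]. *)
Lemma cuspform_strip_max k f : cuspforms k 1 f -> f <> 0 ->
  exists z0, [/\ `|Re z0| <= 1 / 2, 1 / 2 <= Im z0, f z0 != 0 &
    forall z, 1 / 2 <= Im z -> nm (f z) <= nm (f z0)].
Proof.
move=> cf f0.
have [z1 z1i fz1] : exists2 z, 1 / 2 <= Im z & f z != 0.
  apply: contrapT => H; apply: f0; apply: (cuspform_eq0_of_strip cf) => z zi.
  by apply/eqP; apply: contrapT => /negP fz; apply: H; exists z.
have [A HA] := cuspform_at_infinity cf (eps := nm (f z1)) (ltac:(by rewrite normc_gt0)).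
(* [1 <= L] makes the square at least one period wide; [A <= L] makes the form smaller above the
   square than at [z1]. *)
pose L := Num.max 1 A.
have L1 : 1 <= L by rewrite le_max lexx.
have LA : A <= L by rewrite le_max lexx orbT.
have L0 : 0 < L by apply: lt_le_trans L1.
pose c : C := Complex (- (1 / 2)) (1 / 2).
have sq z : `|Re z| <= 1 / 2 -> 1 / 2 <= Im z -> Im z <= L + 1 / 2 -> in_square c L z.
  rewrite /in_square /= ler_norml => /andP[h1 h2] h3 h4.
  by apply/andP; split; apply/andP; split; lra.
have [|z0 z0s z0m] := square_max (f := f) L0 (z := c).
  move=> v /andP[_ /andP[/= vi _]]; apply: (cuspform_derivable cf); lra.
have small z : 1 / 2 <= Im z -> Im z <= L + 1 / 2 -> nm (f z) <= nm (f z0).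
  move=> h1 h2; have [m zm] := exists_translate z.
  by rewrite -(cuspform_translate cf z m); apply: z0m; apply: sq; rewrite ?Im_translate.
have z1m : nm (f z1) <= nm (f z0).
  apply: small => //; rewrite leNgt; apply/negP => h.
  have : A < Im z1 by lra.
  by move=> /HA; rewrite ltxx.
have big z : 1 / 2 <= Im z -> nm (f z) <= nm (f z0).
  move=> h1; case: (leP (Im z) (L + 1 / 2)) => [/small|h2]; first exact.
  have /HA/ltW h3 : A < Im z by lra.
  exact: le_trans h3 z1m.
have z0i : 1 / 2 <= Im z0 by case/andP: z0s => _ /andP[].
have [m z0t] := exists_translate z0.
exists (z0 + m%:~R); rewrite Im_translate (cuspform_translate cf); split => //.
by rewrite -normc_gt0; apply: lt_le_trans z1m; rewrite normc_gt0.
Qed.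

Definition zero_point (j : nat) : C := Complex 0 (1 + j%:R / 200).

Lemma zero_point_inj : injective zero_point.
Proof.
move=> i j [] /addrI/(congr1 (fun x => x * 200)).
by rewrite !divfK ?pnatr_eq0// => /eqP; rewrite eqr_nat => /eqP.
Qed.

(** The reflected point is -is, and the two squared distances differ by (2 Im w - 1)(1 + 2s) >= 1,
    while the smaller one is at most 4. *)
Lemma reflection_ratio w (s : R) : 1 <= Im w -> nm w ^+ 2 <= 4 -> 0 <= s <= 1 ->
  w != Complex 0 (1 + s) ->
  9 / 8 <= (nm (w - refl (Complex 0 (1 + s))) / nm (w - Complex 0 (1 + s))) ^+ 2.
Proof.
move=> wi w4 /andP[s0 s1] ws; rewrite expr_div_n ler_pdivlMr; last first.
  by rewrite exprn_gt0// normc_gt0 subr_eq0.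
move: w4; rewrite !normc_sq !ReB !ImB /= subr0.
move: (Re w) (Im w) wi => x y y1 h.
have h1 : 0 <= (y - 1) * s by rewrite mulr_ge0//; lra.
have h2 : 0 <= s * (1 - s) by rewrite mulr_ge0//; lra.
nra.
Qed.

(** If the maximum lies strictly above the line Im z = 1/2, a single zero gives a contradiction, its
    ratio being greater than 1. On the line all ratios are 1, so the bound is applied at w = -1/z0
    instead. There |f(w)| = |z0|^12 |f(z0)| with |z0|^2 >= 1/4, so the product of ratios is at most
    4^6, whereas 200 zeros make its square at least (9/8)^200. *)
Lemma cuspform12_eq0 f : cuspforms 12 1 f ->
  (forall j, (j < 200)%N -> f (zero_point j) = 0) -> f = 0.
Proof.
move=> cf fz; apply: contrapT => f0.
have [z0 [z0r z0i fz0 z0m]] := cuspform_strip_max cf f0.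
have fd z : 1 / 2 <= Im z -> derivable f z 1.
  by move=> h; apply: (cuspform_derivable cf); lra.
have A0 : 0 < nm (f z0) by rewrite normc_gt0.
have zpi j : 1 <= Im (zero_point j).
  by rewrite -[Im _]/(1 + j%:R / 200 : R) lerDl divr_ge0.
move: z0i; rewrite le_eqVlt => /predU1P[z0i|z0i]; last first.
  have z0p : z0 != zero_point 0.
    by apply: contraNneq fz0 => ->; rewrite fz.
  have := @reflection_bound _ f _ [:: zero_point 0] z0 erefl fd z0m.
  rewrite big_seq1 => H.
  have : nm (f z0) * (nm (z0 - refl (zero_point 0)) / nm (z0 - zero_point 0)) <= nm (f z0).
    apply: H => //; last by rewrite inE.
    move=> a; rewrite inE => /eqP ->; split; last exact: fz.
    by have := zpi 0%N; lra.
  rewrite ger_pMr// ler_pdivrMr ?normc_gt0 ?subr_eq0// mul1r.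
  rewrite -ler_sqr ?nnegrE ?normc_ge0// !normc_sq !ReB !ImB /= mul0r !addr0; nra.
pose w := - z0^-1.
have z00 : 0 < Im z0 by lra.
have n4 : 1 / 4 <= nm z0 ^+ 2 <= 1 / 2.
  rewrite normc_sq -z0i; move: z0r; rewrite ler_norml => /andP[h1 h2].
  by apply/andP; split; nra.
move/andP: (n4) => [n41 n42].
have np : 0 < nm z0 ^+ 2 by lra.
have wi : 1 <= Im w by rewrite Im_inversion -z0i ler_pdivlMr//; lra.
have wn : nm w ^+ 2 <= 4.
  rewrite normcN normcV exprVn invf_ple ?posrE//; lra.
have fw : nm (f w) = (nm z0 ^+ 2) ^+ 6 * nm (f z0).
  by rewrite /w (cuspform_inversion cf)// normcM normcX -exprM.
have fw0 : f w != 0.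
  by rewrite -normc_gt0 fw mulr_gt0// exprn_gt0.
pose s := [seq zero_point j | j <- iota 0 200].
have ws : w \notin s.
  apply: contra fw0 => /mapP[j]; rewrite mem_iota /= add0n => j2 ->.
  by rewrite fz.
have := @reflection_bound _ f _ s w _ fd z0m.
rewrite map_inj_uniq ?iota_uniq; last exact: zero_point_inj.
move=> /(_ erefl) H.
have {H} : nm (f w) * \prod_(a <- s) (nm (w - refl a) / nm (w - a)) <= nm (f z0).
  apply: H => //; last by lra.
  move=> a /mapP[j]; rewrite mem_iota /= add0n => j2 ->; split; last exact: fz.
  by have := zpi j; lra.
set P := \prod_(a <- s) _ => hP.
have P0 : 0 <= P by apply: prodr_ge0 => a _; rewrite divr_ge0 ?normc_ge0.
have P1 : P <= 4 ^+ 6.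
  have : (1 / 4) ^+ 6 * P <= 1.
    have h6 : (1 / 4) ^+ 6 <= (nm z0 ^+ 2) ^+ 6.
      by rewrite lerXn2r ?nnegrE//; lra.
    rewrite -(ler_pM2r A0) [1 * nm _]mul1r; apply: le_trans hP; rewrite fw mulrAC.
    by rewrite ler_wpM2r// ler_wpM2r ?normc_ge0.
  rewrite expr_div_n expr1n mul1r mulrC ler_pdivrMr ?exprn_gt0// mul1r.
  by [].
have P2 : (9 / 8) ^+ 200 <= P ^+ 2.
  have -> : (9 / 8) ^+ 200 = \prod_(a <- s) (9 / 8 : R).
    by rewrite big_const_seq count_predT iter_mulr_1 size_map size_iota.
  rewrite /P -prodrXl big_seq [leRHS]big_seq; apply: ler_prod => a as_.
  apply/andP; split; first by lra.
  have aw : w != a by apply: contraNneq ws => ->.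
  move: as_ aw => /mapP[j]; rewrite mem_iota /= add0n => j2 -> aw.
  apply: reflection_ratio => //.
  by apply/andP; split; rewrite ?divr_ge0// ler_pdivrMr// mul1r ler_nat ltnW.
(* By Bernoulli (9/8)^8 >= 2; with this estimate 200 zeros yield 2^25, just above the admissible
   (4^6)^2 = 2^24. *)
have P3 : 2 ^+ 25 <= (9 / 8) ^+ 200 :> R.
  rewrite (_ : 200 = 8 * 25)%N// exprM lerXn2r ?nnegrE ?exprn_ge0//; last first.
    have := @bernoulli R (1 / 8) 8 (ltac:(lra)); rewrite (_ : 1 + 1 / 8 = 9 / 8); last by field.
    by apply: le_trans; lra.
have P4 : P ^+ 2 <= 2 ^+ 24.
  rewrite (_ : 2 ^+ 24 = (4 ^+ 6) ^+ 2).
    by rewrite lerXn2r ?nnegrE ?exprn_ge0.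
  by rewrite -exprM (_ : 4 = 2 ^+ 2) -?exprM//; ring.
have := le_trans P3 (le_trans P2 P4).
by rewrite [2 ^+ 25]exprS leNgt; have := exprn_gt0 24 (@ltr0Sn R 1) => h; rewrite ltr_pMl ?ltr1n.
Qed.

(** Evaluation at the 200 points is injective on cusp forms. A general [V] is allowed so that the
    bound applies to the sign spaces and to their new parts. *)
Lemma cuspforms12_dim (V : set (C -> C^o)) n (e : 'I_n -> (C -> C^o)) :
  (V `<=` cuspforms 12 1)%classic -> is_basis V e -> (n <= 200)%N.
Proof.
move=> Vc [Ve efree]; rewrite leqNgt; apply/negP => n2.
pose A : 'M[C]_(n, 200) := \matrix_(i, j) (e i (zero_point j) : C).
have : kermx A != 0.
  rewrite -mxrank_eq0 mxrank_ker subn_eq0 -ltnNge.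
  by apply: leq_ltn_trans n2; exact: rank_leq_col.
case/rowV0Pn => v /sub_kermxP vA /eqP v0; apply: v0.
pose f : C -> C^o := \sum_i v 0 i *: e i.
have f0 : f = 0.
  apply: cuspform12_eq0.
    by apply: Vc; rewrite Ve /=; exists (fun i => v 0 i).
  move=> j j2; have := congr1 (fun B : 'rV_200 => B 0 (Ordinal j2)) vA.
  rewrite !mxE => <-; rewrite /f fct_sumE; apply: eq_bigr => i _.
  by rewrite mxE.
apply/rowP => i; rewrite mxE; exact: (efree (fun i => v 0 i) f0).
Qed.

End LevelOneDimension.

(** * Unordered sums *)

Section UnorderedSum.
Variables (R : realType) (T : eqType).
Local Notation C := (R[i]).
Local Notation Re := (@complex.Re R).
Local Notation Im := (@complex.Im R).
Local Notation "x %:C" := (real_complex R x).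
Local Notation nm := (@ComplexField.Normc.normc R).
Implicit Types (f g : T -> C) (l : C) (F : seq T).

(** Convergence along the net of finite subsets, coded as duplicate-free sequences. The absence of
    an order is what allows the index lattice to be permuted by SL_2(Z). *)
Definition has_usum f l := forall e : R, 0 < e -> exists F0, forall F,
  uniq F -> {subset F0 <= F} -> nm (\sum_(i <- F) f i - l) <= e.

Definition abs_bounded f (K : R) :=
  forall F, uniq F -> \sum_(i <- F) nm (f i) <= K.

Lemma ler_sum_subseq (F G : seq T) (h : T -> R) : (forall i, 0 <= h i) ->
  uniq F -> {subset F <= G} -> \sum_(i <- F) h i <= \sum_(i <- G) h i.
Proof.
move=> h0; elim: F G => [|x F IH] G; first by move=> _ _; rewrite big_nil sumr_ge0.
move=> /= /andP[xF uF] sFG; have xG : x \in G by apply: sFG; rewrite mem_head.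
rewrite big_cons (big_rem x xG) /= lerD2l; apply: IH => // y yF.
have yG : y \in G by apply: sFG; rewrite inE yF orbT.
have yx : y != x by apply: contraNneq xF => <-.
by rewrite (perm_mem (perm_to_rem xG)) inE (negbTE yx) in yG.
Qed.

Lemma has_usum_ext f g l : (forall i, f i = g i) -> has_usum f l -> has_usum g l.
Proof. by move=> /funext ->. Qed.

Lemma has_usumD f g l l' : has_usum f l -> has_usum g l' ->
  has_usum (fun i => f i + g i) (l + l').
Proof.
move=> Hf Hg e e0; have e2 : 0 < e / 2 by rewrite divr_gt0.
have [F1 H1] := Hf _ e2; have [F2 H2] := Hg _ e2.
exists (F1 ++ F2) => F uF sF; rewrite big_split /=.
rewrite (_ : _ - _ = (\sum_(i <- F) f i - l) + (\sum_(i <- F) g i - l')); last by ring.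
apply: le_trans (le_normcD _ _) _; rewrite [leRHS]splitr; apply: lerD.
  by apply: H1 => // i i1; apply: sF; rewrite mem_cat i1.
by apply: H2 => // i i1; apply: sF; rewrite mem_cat i1 orbT.
Qed.

Lemma has_usumZ f l a : has_usum f l -> has_usum (fun i => a * f i) (a * l).
Proof.
move=> Hf e e0; have n0 : 0 < nm a + 1 by rewrite ltr_wpDl ?normc_ge0.
have [F1 H1] := Hf (e / (nm a + 1)) (divr_gt0 e0 n0).
exists F1 => F uF sF; rewrite -mulr_sumr -mulrBr ComplexField.Normc.normcM.
apply: le_trans (ler_wpM2l (normc_ge0 a) (H1 F uF sF)) _.
by rewrite mulrCA ger_pMr// ler_pdivrMr// mul1r lerDl.
Qed.

Lemma has_usumB f g l l' : has_usum f l -> has_usum g l' ->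
  has_usum (fun i => f i - g i) (l - l').
Proof.
move=> Hf Hg; apply: (@has_usum_ext (fun i => f i + -1 * g i)).
  by move=> i; rewrite mulN1r.
by rewrite -[- l']mulN1r; apply: has_usumD => //; apply: has_usumZ.
Qed.

Lemma has_usum_normc_le f l K : has_usum f l -> abs_bounded f K -> nm l <= K.
Proof.
move=> Hf Kf; apply/ler_addgt0Pr => e e0; have [F0 H] := Hf e e0.
have uF := undup_uniq F0; have := H _ uF (fun i iF => etrans (mem_undup F0 i) iF).
move=> h; apply: le_trans (normc_le_add _ (\sum_(i <- undup F0) f i)) _.
rewrite addrC normc_sub_sym; apply: lerD h.
exact: le_trans (normc_sum _ _ _) (Kf _ uF).
Qed.

Lemma has_usum_unique f l l' : has_usum f l -> has_usum f l' -> l = l'.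
Proof.
move=> H H'; apply/eqP; rewrite -subr_eq0 -normc_eq0 eq_le normc_ge0 andbT.
apply: has_usum_normc_le (has_usumB H H') _ => F _.
by rewrite big1// => i _; rewrite subrr ComplexField.Normc.normc0.
Qed.

Lemma has_usum_Re_ge f l c F0 : has_usum f l ->
  (forall F, uniq F -> {subset F0 <= F} -> c <= Re (\sum_(i <- F) f i)) -> c <= Re l.
Proof.
move=> Hf H; apply/ler_addgt0Pr => e e0; have [F1 H1] := Hf e e0.
pose F := undup (F0 ++ F1).
have uF : uniq F by exact: undup_uniq.
have := H1 F uF; have := H F uF => h h1.
have {}h : c <= Re (\sum_(i <- F) f i).
  by apply: h => i iF; rewrite mem_undup mem_cat iF.
have {h1} : nm (\sum_(i <- F) f i - l) <= e.
  by apply: h1 => i iF; rewrite mem_undup mem_cat iF orbT.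
have := normRe_le (\sum_(i <- F) f i - l); rewrite ReB ler_norml => /andP[h1 h2]; lra.
Qed.

Lemma has_usum_bij f l (h h' : T -> T) : cancel h h' -> cancel h' h ->
  has_usum f l -> has_usum (fun i => f (h i)) l.
Proof.
move=> hK h'K Hf e e0; have [F0 H] := Hf e e0.
exists [seq h' i | i <- F0] => F uF sF.
rewrite -(big_map h xpredT f); apply: H.
  by rewrite map_inj_uniq//; exact: can_inj hK.
move=> i iF; rewrite -(h'K i); apply: map_f; apply: sF; exact: map_f.
Qed.

Lemma nonneg_has_usum (u : T -> R) K : (forall i, 0 <= u i) ->
  (forall F, uniq F -> \sum_(i <- F) u i <= K) -> exists s : R, has_usum (fun i => (u i)%:C) s%:C.
Proof.
move=> u0 uK.
pose E := [set \sum_(i <- F) u i | F in [set F | uniq F]]%classic.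
have hE : has_sup E.
  by split; [exists (\sum_(i <- [::]) u i), [::]|exists K => _ [F uF <-]; apply: uK].
exists (sup E) => e e0.
have [_ [F0 uF0 <-] h0] := sup_adherent e0 hE.
exists F0 => F uF sF; rewrite -rmorph_sum -rmorphB normc_real.
have h1 : \sum_(i <- F) u i <= sup E by apply: ub_le_sup; [exact: hE.2|exists F].
have h2 := ler_sum_subseq u0 uF0 sF.
by rewrite ler_norml; apply/andP; split; lra.
Qed.

Lemma real_has_usum (u : T -> R) K :
  (forall F, uniq F -> \sum_(i <- F) `|u i| <= K) -> exists s : R, has_usum (fun i => (u i)%:C) s%:C.
Proof.
move=> uK; have [s Hs] := nonneg_has_usum (fun i => normr_ge0 (u i)) uK.
have [||t Ht] := @nonneg_has_usum (fun i => u i + `|u i|) (K + K).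
- by move=> i; have := ler_norm (- u i); rewrite normrN; lra.
- move=> F uF; rewrite big_split; apply: lerD; last exact: uK.
  by apply: le_trans (uK F uF); apply: ler_sum => i _; exact: ler_norm.
exists (t - s); rewrite rmorphB; apply: has_usum_ext (has_usumB Ht Hs) => i.
by rewrite -rmorphB addrK.
Qed.

Lemma abs_bounded_has_usum f K : abs_bounded f K -> exists l, has_usum f l.
Proof.
move=> fK.
have [|x Hx] := @real_has_usum (Re \o f) K.
  move=> F uF; apply: le_trans (fK F uF); apply: ler_sum => i _; exact: normRe_le.
have [|y Hy] := @real_has_usum (Im \o f) K.
  move=> F uF; apply: le_trans (fK F uF); apply: ler_sum => i _; exact: normIm_le.
exists (x%:C + Complex 0 1 * y%:C).
apply: has_usum_ext (has_usumD Hx (has_usumZ (Complex 0 1) Hy)) => i.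
by rewrite [RHS]complexE.
Qed.

Lemma abs_bounded_le f (h : T -> R) a K : 0 <= a -> (forall i, nm (f i) <= a * h i) ->
  (forall F, uniq F -> \sum_(i <- F) h i <= K) -> abs_bounded f (a * K).
Proof.
move=> a0 fh hK F uF; apply: le_trans (ler_sum _ (fun i _ => fh i)) _.
by rewrite -mulr_sumr ler_wpM2l// hK.
Qed.

End UnorderedSum.

(** * Uniform majorants for lattice sums *)

Section LatticeWeight.
Variable R : realType.
Local Notation C := (R[i]).
Local Notation Re := (@complex.Re R).
Local Notation Im := (@complex.Im R).
Local Notation "x %:C" := (real_complex R x).
Local Notation nm := (@ComplexField.Normc.normc R).
Local Notation normcM := ComplexField.Normc.normcM.
Local Notation normcV := ComplexField.Normc.normcV.
Implicit Types (z u : C) (p : int * int).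

(** The product form of [lattice_weight] reduces summability over the lattice to a telescoping sum
    over the integers. *)
Definition int_weight (m : int) : R := (1 + m%:~R ^+ 2)^-1.
Definition lattice_weight p : R := int_weight p.1 * int_weight p.2.
Definition sq_norm p : R := p.1%:~R ^+ 2 + p.2%:~R ^+ 2.

Lemma int_weight_ge0 m : 0 <= int_weight m.
Proof. by rewrite invr_ge0 addr_ge0 ?sqr_ge0. Qed.

Lemma lattice_weight_ge0 p : 0 <= lattice_weight p.
Proof. by rewrite mulr_ge0 ?int_weight_ge0. Qed.

Lemma weight_telescope (N : nat) :
  (1 + (N.+2)%:R ^+ 2)^-1 <= (N.+1)%:R^-1 - (N.+2)%:R^-1 :> R.
Proof.
have : 1 <= (N.+1)%:R :> R by rewrite ler1n.
rewrite -[(N.+2)%:R]natr1; move: (N.+1)%:R => x x1.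
have x0 : 0 < x by lra.
have x10 : 0 < x + 1 by lra.
have -> : x^-1 - (x + 1)^-1 = (x * (x + 1))^-1.
  by field; rewrite !gt_eqF.
rewrite lef_pV2 ?posrE ?mulr_gt0//; nra.
Qed.

Lemma sum_weight_nonneg N : \sum_(n < N) int_weight (Posz n) <= 5 / 2.
Proof.
have e0 : int_weight 0 = 1 by rewrite /int_weight mulr0z expr0n addr0 invr1.
have e1 : int_weight 1 = 1 / 2 by rewrite /int_weight mulr1z expr1n mul1r.
have H M : \sum_(n < M.+2) int_weight (Posz n) <= 5 / 2 - (M.+1)%:R^-1.
  elim: M => [|M IH].
    rewrite !big_ord_recr big_ord0 /= e0 e1 invr1; lra.
  have ew : int_weight (Posz M.+2) = (1 + M.+2%:R ^+ 2)^-1.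
    by rewrite /int_weight -pmulrn.
  rewrite big_ord_recr /= ew; apply: le_trans (lerD IH (weight_telescope M)) _.
  by rewrite addrA subrK.
have h M : 0 <= (M.+1)%:R^-1 :> R by rewrite invr_ge0.
case: N => [|[|M]]; first by rewrite big_ord0 divr_ge0.
  by rewrite big_ord_recr big_ord0 /= e0; lra.
by apply: le_trans (H M) _; rewrite gerBl.
Qed.

Lemma sum_weight_neg N : \sum_(n < N) int_weight (Negz n) <= 3 / 2.
Proof.
have e n : int_weight (Negz n) = (1 + n.+1%:R ^+ 2)^-1.
  by rewrite /int_weight NegzE mulrNz sqrrN -pmulrn.
have H M : \sum_(n < M.+1) int_weight (Negz n) <= 3 / 2 - (M.+1)%:R^-1.
  elim: M => [|M IH]; first by rewrite big_ord_recr big_ord0 /= e expr1n invr1 (_ : (1 + 1)^-1 = 1 / 2) ?mul1r//; lra.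
  rewrite big_ord_recr /= e; apply: le_trans (lerD IH (weight_telescope M)) _.
  by rewrite addrA subrK.
have h M : 0 <= (M.+1)%:R^-1 :> R by rewrite invr_ge0.
case: N => [|M]; first by rewrite big_ord0 divr_ge0.
by apply: le_trans (H M) _; rewrite gerBl.
Qed.

Lemma sum_int_weight (F : seq int) : uniq F -> \sum_(m <- F) int_weight m <= 4.
Proof.
move=> uF; have [N HN] : exists N, forall m, m \in F -> (`|m| < N)%N.
  elim: (F) => [|x G [N IH]]; first by exists 0%N.
  exists (maxn N `|x|.+1)%N => m; rewrite inE leq_max => /predU1P[->|/IH ->//].
  by rewrite ltnSn orbT.
pose H := [seq Posz n | n <- index_iota 0 N] ++ [seq Negz n | n <- index_iota 0 N].
apply: (@le_trans _ _ (\sum_(m <- H) int_weight m)).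
  apply: ler_sum_subseq => //; first exact: int_weight_ge0.
  move=> m /HN; rewrite mem_cat; case: m => n hn; apply/orP; [left|right]; apply: map_f.
    by rewrite mem_index_iota.
  by rewrite mem_index_iota /=; apply: ltn_trans hn; exact: ltnSn.
rewrite big_cat !big_map /= !big_mkord.
by have := sum_weight_nonneg N; have := sum_weight_neg N; lra.
Qed.

Lemma sum_lattice_weight (F : seq (int * int)) : uniq F ->
  \sum_(p <- F) lattice_weight p <= 16.
Proof.
move=> uF; pose G1 := undup [seq p.1 | p <- F]; pose G2 := undup [seq p.2 | p <- F].
apply: (@le_trans _ _ (\sum_(p <- [seq (x, y) | x <- G1, y <- G2]) lattice_weight p)).
  apply: ler_sum_subseq => //; first exact: lattice_weight_ge0.
  move=> [x y] xyF; apply: allpairs_f; rewrite mem_undup.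
    by apply: (map_f fst xyF).
  by apply: (map_f snd xyF).
rewrite big_allpairs /=.
have -> : \sum_(i <- G1) \sum_(j <- G2) lattice_weight (i, j) =
    (\sum_(i <- G1) int_weight i) * (\sum_(j <- G2) int_weight j).
  by rewrite mulr_suml; apply: eq_bigr => i _; rewrite mulr_sumr.
have h1 := sum_int_weight (undup_uniq [seq p.1 | p <- F]).
have h2 := sum_int_weight (undup_uniq [seq p.2 | p <- F]).
rewrite (_ : 16 = 4 * 4); last by ring.
by apply: ler_pM => //; apply: sumr_ge0 => *; exact: int_weight_ge0.
Qed.

Lemma sq_norm_ge0 p : 0 <= sq_norm p.
Proof. by rewrite addr_ge0 ?sqr_ge0. Qed.

Lemma intr_sqr_ge1 (m : int) : m != 0 -> 1 <= (m%:~R : R) ^+ 2.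
Proof.
move=> m0; rewrite -rmorphXn /= ler1z.
by rewrite -gtz0_ge1 exprn_even_gt0.
Qed.

Lemma sq_norm_ge1 p : p != (0, 0) -> 1 <= sq_norm p.
Proof.
case: p => m n; rewrite xpair_eqE negb_and => /orP[/intr_sqr_ge1 h|/intr_sqr_ge1 h].
  by apply: le_trans h _; rewrite lerDl sqr_ge0.
by apply: le_trans h _; rewrite lerDr sqr_ge0.
Qed.

(** With s = m^2 + n^2 >= 1, the arithmetic-geometric mean inequality gives (1 + m^2)(1 + n^2) <=
    ((2 + s)/2)^2 <= (3s/2)^2. *)
Lemma inv_sq_norm_le p : p != (0, 0) -> (sq_norm p ^+ 2)^-1 <= 9 / 4 * lattice_weight p.
Proof.
move=> p0; have s1 := sq_norm_ge1 p0.
rewrite /lattice_weight /int_weight -invfM -[9 / 4]invrK -invfM.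
have h1 : 0 <= (p.1%:~R : R) ^+ 2 by rewrite sqr_ge0.
have h2 : 0 <= (p.2%:~R : R) ^+ 2 by rewrite sqr_ge0.
rewrite lef_pV2 ?posrE; last 2 first.
- by rewrite exprn_gt0//; lra.
- by rewrite !mulr_gt0 ?invr_gt0//; lra.
move: s1; rewrite /sq_norm; move: (_ ^+ 2) (_ ^+ 2) h1 h2 => x y x0 y0 h.
have -> : (9 / 4)^-1 = 4 / 9 :> R by field.
have := sqr_ge0 (x - y); nra.
Qed.

Definition lattice_point p z : C := p.1%:~R * z + p.2%:~R.

Lemma lattice_point_sq p z : nm (lattice_point p z) ^+ 2 =
  (p.1%:~R * Re z + p.2%:~R) ^+ 2 + (p.1%:~R * Im z) ^+ 2.
Proof.
rewrite normc_sq /lattice_point ReD ImD -!(rmorph_int (real_complex R)) ReM ImM /=.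
by rewrite !mul0r subr0 !addr0.
Qed.

(** The quadratic form |m z + n|^2 is positive definite, uniformly on a half-strip. One [rho] for
    all [z] is what termwise differentiation and the limit at infinity require. *)
Lemma lattice_point_ge (delta X : R) : 0 < delta ->
  exists rho : R, [/\ 0 < rho, rho <= 1 & forall z, delta <= Im z -> `|Re z| <= X ->
    forall p, rho ^+ 2 * sq_norm p <= nm (lattice_point p z) ^+ 2].
Proof.
(* [c] bounds m^2 + n^2 against |m z + n|^2: the 2 comes from n^2 <= 2 (m Re z + n)^2 + 2 m^2 X^2,
   the quotient from [delta <= Im z]. As c <= c^2, taking rho = 1/c avoids a square root. *)
move=> d0; pose c := 2 + (1 + 2 * X ^+ 2) / delta ^+ 2.
have q0 : 0 <= (1 + 2 * X ^+ 2) / delta ^+ 2.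
  by rewrite divr_ge0 ?sqr_ge0// addr_ge0// mulr_ge0 ?sqr_ge0.
have c2 : 2 <= c by rewrite lerDl.
have c0 : 0 < c by lra.
exists c^-1; split; first by rewrite invr_gt0.
  by rewrite invf_le1//; lra.
move=> z zi zr p; rewrite lattice_point_sq exprVn mulrC ler_pdivrMr ?exprn_gt0//.
have {zr} zr : Re z ^+ 2 <= X ^+ 2.
  by rewrite -[Re z ^+ 2]real_normK ?num_real// lerXn2r ?nnegrE// (le_trans _ zr).
have {zi} zi : delta ^+ 2 <= Im z ^+ 2.
  by rewrite lerXn2r ?nnegrE//; lra.
rewrite /sq_norm; move: (p.1%:~R : R) (p.2%:~R : R) => m n.
have m0 := sqr_ge0 m.
have h1 : n ^+ 2 <= 2 * (m * Re z + n) ^+ 2 + 2 * (m ^+ 2 * X ^+ 2).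
  have := sqr_ge0 (n + 2 * m * Re z); have := ler_wpM2l m0 zr; nra.
have h2 : (1 + 2 * X ^+ 2) * m ^+ 2 <= (c - 2) * (m * Im z) ^+ 2.
  rewrite /c [2 + _]addrC addrK exprMn mulrAC -mulrA.
  apply: ler_wpM2l; first by rewrite addr_ge0// mulr_ge0 ?sqr_ge0.
  rewrite ler_pdivlMr ?exprn_gt0//; exact: ler_wpM2l.
have c1 : c <= c ^+ 2 by rewrite expr2 ler_peMl//; lra.
have h3 := sqr_ge0 (m * Re z + n); have h4 := sqr_ge0 (m * Im z).
apply: (@le_trans _ _ (((m * Re z + n) ^+ 2 + (m * Im z) ^+ 2) * c)); first nra.
by rewrite ler_wpM2l// addr_ge0.
Qed.

(** Four of the k powers pay for summability through [inv_sq_norm_le]; the others are bounded using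
    |m z + n| >= rho. *)
Lemma lattice_term_le (rho : R) k z p : 0 < rho -> rho <= 1 -> (4 <= k)%N ->
  rho ^+ 2 * sq_norm p <= nm (lattice_point p z) ^+ 2 ->
  nm (lattice_point p z ^- k) <= (rho ^- k * (9 / 4)) * lattice_weight p.
Proof.
move=> r0 r1 k4 h; have [p0|p0] := eqVneq p (0, 0).
  rewrite p0 /lattice_point !mulr0z mul0r addr0 expr0n; case: (k) k4 => // k' _.
  rewrite invr0 ComplexField.Normc.normc0 mulr_ge0 ?lattice_weight_ge0//.
  by rewrite mulr_ge0// invr_ge0 exprn_ge0 ?ltW.
have s1 := sq_norm_ge1 p0.
have rn : rho <= nm (lattice_point p z).
  rewrite -ler_sqr ?nnegrE ?normc_ge0 ?(ltW r0)//; apply: le_trans h.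
  by rewrite ler_peMr// sqr_ge0.
have n0 : 0 < nm (lattice_point p z) by apply: lt_le_trans rn.
rewrite normcV normcX -mulrA.
move: rn h n0; set x := nm _ => rn h n0.
have split4 (y : R) : y ^- k = y ^- (k - 4) * (y ^+ 4)^-1.
  by rewrite -invfM -exprD subnK.
rewrite !split4 -mulrA.
apply: ler_pM; rewrite ?invr_ge0 ?exprn_ge0 ?(ltW n0)//.
  by rewrite lef_pV2 ?posrE ?exprn_gt0// lerXn2r ?nnegrE ?(ltW r0) ?(ltW n0).
apply: (@le_trans _ _ ((rho ^+ 4)^-1 * (sq_norm p ^+ 2)^-1)).
  rewrite -invfM lef_pV2 ?posrE ?exprn_gt0//; last first.
    by rewrite mulr_gt0 ?exprn_gt0//; lra.
  have -> : x ^+ 4 = (x ^+ 2) ^+ 2 by rewrite -exprM.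
  have -> : rho ^+ 4 * sq_norm p ^+ 2 = (rho ^+ 2 * sq_norm p) ^+ 2 by ring.
  by rewrite lerXn2r ?nnegrE ?sqr_ge0// mulr_ge0 ?sqr_ge0 ?sq_norm_ge0.
by rewrite ler_wpM2l ?invr_ge0 ?exprn_ge0 ?(ltW r0)// inv_sq_norm_le.
Qed.

End LatticeWeight.

(** * Eisenstein series and their modularity *)

Section EisensteinSeries.
Variable R : realType.
Local Notation C := (R[i]).
Local Notation Re := (@complex.Re R).
Local Notation Im := (@complex.Im R).
Local Notation "x %:C" := (real_complex R x).
Local Notation nm := (@ComplexField.Normc.normc R).
Local Notation normcM := ComplexField.Normc.normcM.
Local Notation normcV := ComplexField.Normc.normcV.
Implicit Types (z u v a b : C) (p : int * int).

(** Since the inverse of 0 is 0, the pair (0, 0) contributes 0 when k > 0, and sums may run over the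
    whole lattice. The series is unnormalized, so its value at infinity is not 1 but is carried
    along as [eisenstein_infinity]. *)
Definition eisenstein_term k z p : C := lattice_point p z ^- k.

Definition eisenstein k : C^o -> C^o := fun z =>
  xget 0 [set l | has_usum (eisenstein_term k z) l]%classic.

(* The value at infinity: the terms with [p.1 = 0], which do not depend on
   the point used here. *)
Definition eisenstein_infinity k : C :=
  xget 0 [set l | has_usum (fun p => if p.1 == 0 then eisenstein_term k (Complex 0 1) p
                                     else 0) l]%classic.

Section Weight.
Variable k : nat.
Hypothesis k4 : (4 <= k)%N.

Lemma eisenstein_term_bound (delta X : R) : 0 < delta -> exists2 K : R, 0 <= K &
  forall z, delta <= Im z -> `|Re z| <= X ->
  forall p, nm (eisenstein_term k z p) <= K * lattice_weight R p.
Proof.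
move=> d0; have [rho [r0 r1 H]] := lattice_point_ge X d0.
exists (rho ^- k * (9 / 4)); first by rewrite mulr_ge0// invr_ge0 exprn_ge0 ?ltW.
by move=> z zi zr p; apply: lattice_term_le => //; apply: H.
Qed.

Lemma abs_bounded_weight (f : int * int -> C) (K : R) : 0 <= K ->
  (forall p, nm (f p) <= K * lattice_weight R p) -> abs_bounded f (K * 16).
Proof. by move=> K0 H; apply: abs_bounded_le H _ => //; exact: sum_lattice_weight. Qed.

Lemma has_usum_eisenstein z : 0 < Im z ->
  has_usum (eisenstein_term k z) (eisenstein k z).
Proof.
move=> z0; have [K K0 HK] := eisenstein_term_bound `|Re z| z0.
have [l Hl] := abs_bounded_has_usum (abs_bounded_weight K0 (HK z (lexx _) (lexx _))).
exact: (xgetPex 0 (ex_intro _ l Hl)).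
Qed.

Lemma has_usum_eisenstein_infinity :
  has_usum (fun p => if p.1 == 0 then eisenstein_term k (Complex 0 1) p else 0)
    (eisenstein_infinity k).
Proof.
have [K K0 HK] := eisenstein_term_bound 0 (@ltr01 R).
have [|l Hl] := @abs_bounded_has_usum _ _ (fun p => if p.1 == 0 then
    eisenstein_term k (Complex 0 1) p else 0) (K * 16).
  apply: abs_bounded_weight => // p; case: ifP => _.
    by apply: HK => //=; rewrite normr0.
  by rewrite ComplexField.Normc.normc0 mulr_ge0 ?lattice_weight_ge0.
exact: (xgetPex 0 (ex_intro _ l Hl)).
Qed.

Lemma normc_denom_gt0 (c d : int) z : 0 < Im z -> (c, d) != (0, 0) ->
  c%:~R * z + d%:~R != 0 :> C.
Proof.
move=> z0 cd; have := @lattice_point_sq R (c, d) z; rewrite /lattice_point /= => e.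
apply: contra_neq cd => h; move: e; rewrite h ComplexField.Normc.normc0 expr0n /=.
move=> /esym/eqP; rewrite paddr_eq0 ?sqr_ge0// !sqrf_eq0 mulf_eq0 => /andP[e1 e2].
move: e2; rewrite (gt_eqF z0) orbF intr_eq0 => /eqP c0; move: e1.
by rewrite c0 mul0r add0r intr_eq0 => /eqP ->.
Qed.

Lemma denom_neq0 (g : 'M[int]_2) z : \det g = 1 -> 0 < Im z ->
  (g 1 0)%:~R * z + (g 1 1)%:~R != 0 :> C.
Proof.
move=> g1 z0; apply: normc_denom_gt0 => //; apply/eqP => -[e1 e2].
by move: g1; rewrite det_mx2E e1 e2 !mulr0 subr0.
Qed.

Lemma Im_mobius (g : 'M[int]_2) z : \det g = 1 ->
  Im (mobius g z) = Im z / nm ((g 1 0)%:~R * z + (g 1 1)%:~R) ^+ 2.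
Proof.
move=> g1; have : ((g 0 0)%:~R * (g 1 1)%:~R - (g 0 1)%:~R * (g 1 0)%:~R : R) = 1.
  by rewrite -!intrM -intrB -det_mx2E g1.
rewrite /mobius; move: (g 0 0) (g 0 1) (g 1 0) (g 1 1) => a b c d.
rewrite ImM ReV ImV !ReD !ImD !ReM !ImM -!(rmorph_int (real_complex R)) /=.
move: (a%:~R) (b%:~R) (c%:~R) (d%:~R) => {a b c d} a b c d e.
rewrite mulrA mulrA -mulrDl; congr (_ / _).
transitivity ((a * d - b * c) * Im z); first by ring.
by rewrite e mul1r.
Qed.

Lemma Im_mobius_gt0 (g : 'M[int]_2) z : \det g = 1 -> 0 < Im z -> 0 < Im (mobius g z).
Proof.
by move=> g1 z0; rewrite Im_mobius// divr_gt0 ?exprn_gt0// normc_gt0 denom_neq0.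
Qed.

Lemma eisenstein_modular (g : 'M[int]_2) z : \det g = 1 -> 0 < Im z ->
  eisenstein k (mobius g z) = ((g 1 0)%:~R * z + (g 1 1)%:~R) ^+ k * eisenstein k z.
Proof.
move=> g1 z0.
(* Right multiplication of row vectors by [g], a permutation of the lattice; [h'] is multiplication
   by the inverse matrix. *)
pose h p : int * int :=
  (p.1 * g 0 0 + p.2 * g 1 0, p.1 * g 0 1 + p.2 * g 1 1).
pose h' p : int * int :=
  (p.1 * g 1 1 - p.2 * g 1 0, p.2 * g 0 0 - p.1 * g 0 1).
have e := det_mx2E g; rewrite g1 in e.
have hK : cancel h h'.
  move=> [m n]; rewrite /h /h' /=; congr pair.
    by rewrite -[RHS]mulr1 e; ring.
  by rewrite -[RHS]mulr1 e; ring.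
have h'K : cancel h' h.
  move=> [m n]; rewrite /h /h' /=; congr pair.
    by rewrite -[RHS]mulr1 e; ring.
  by rewrite -[RHS]mulr1 e; ring.
have j0 := denom_neq0 g1 z0.
apply: (has_usum_unique (has_usum_eisenstein (Im_mobius_gt0 g1 z0))).
apply: has_usum_ext (has_usumZ _ (has_usum_bij hK h'K (has_usum_eisenstein z0))) => p.
rewrite /eisenstein_term /lattice_point /mobius /h /= !intrD !intrM.
rewrite -[X in X * _]invrK -invfM; congr (_^-1).
rewrite -exprVn -exprMn; congr (_ ^+ _).
by field.
Qed.

End Weight.

(** Meant for a = 1/u and b = 1/(u + v), where it is the second-order Taylor estimate of u^-k.
    Stated in [a] and [b], it also covers the degenerate case u = v = 0. *)
Lemma power_taylor k : exists2 K : R, 0 <= K & forall a b v,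
  b - a = - v * a * b -> nm b <= 2 * nm a ->
  nm (b ^+ k - a ^+ k + k%:R * v * a ^+ k.+1) <= K * (nm v ^+ 2 * nm a ^+ k.+2).
Proof.
elim: k => [|k [K K0 IH]].
  exists 0 => // a b v _ _.
  by rewrite !expr0 subrr !mul0r addr0 ComplexField.Normc.normc0.
exists (2 * K + 2 * k.+1%:R); first by rewrite addr_ge0 ?mulr_ge0 ?ler0n.
move=> a b v ab ba; have H := IH a b v ab ba.
have D0 : v * a * b - (a - b) = 0 by rewrite -(opprB b a) ab; ring.
have -> : b ^+ k.+1 - a ^+ k.+1 + k.+1%:R * v * a ^+ k.+2 =
    b * (b ^+ k - a ^+ k + k%:R * v * a ^+ k.+1) + k.+1%:R * (v ^+ 2 * a ^+ k.+2 * b).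
  rewrite -[k.+1%:R]natr1 !exprS; apply/eqP; rewrite -subr_eq0; apply/eqP.
  (* The two sides differ by a multiple of the relation [D0]. *)
  transitivity (- (a ^+ k * ((k%:R + 1) * v * a - 1) * (v * a * b - (a - b)))).
    by ring.
  by rewrite D0 mulr0 oppr0.
apply: le_trans (le_normcD _ _) _; rewrite mulrDl; apply: lerD.
  rewrite normcM; apply: le_trans (ler_pM (normc_ge0 _) (normc_ge0 _) ba H) _.
  rewrite le_eqVlt; apply/orP; left; apply/eqP; rewrite !exprS; ring.
rewrite normcM (normcM _ b) (normcM (v ^+ 2)) !normcX natr_real_complex normc_real.
rewrite ger0_norm ?ler0n//.
have h : 0 <= k.+1%:R * (nm v ^+ 2 * nm a ^+ k.+2).
  rewrite mulr_ge0 ?ler0n// mulr_ge0//; first by rewrite sqr_ge0.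
  by rewrite exprn_ge0 ?normc_ge0.
rewrite [leLHS]mulrA; apply: le_trans (ler_wpM2l h ba) _.
by rewrite le_eqVlt; apply/orP; left; apply/eqP; rewrite !exprS; ring.
Qed.

End EisensteinSeries.

(** * Holomorphy of Eisenstein series *)

Section EisensteinAnalytic.
Variable R : realType.
Local Notation C := (R[i]).
Local Notation Re := (@complex.Re R).
Local Notation Im := (@complex.Im R).
Local Notation "x %:C" := (real_complex R x).
Local Notation nm := (@ComplexField.Normc.normc R).
Local Notation normcM := ComplexField.Normc.normcM.
Local Notation normcV := ComplexField.Normc.normcV.
Implicit Types (z u v a b : C) (p : int * int).
Variable k : nat.
Hypothesis k4 : (4 <= k)%N.

Lemma lattice_point_add p z h :
  lattice_point p (z + h) = lattice_point p z + p.1%:~R * h.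
Proof. by rewrite /lattice_point; ring. Qed.

Lemma normc_intr (m : int) : nm m%:~R = `|m%:~R|.
Proof. by rewrite -(rmorph_int (real_complex R)) normc_real. Qed.

Lemma normc_inv_mul_le1 u : nm u * nm u^-1 <= 1.
Proof.
have [->|u0] := eqVneq u 0; first by rewrite ComplexField.Normc.normc0 mul0r.
by rewrite -normcM divff// ComplexField.Normc.normc1.
Qed.

(** Termwise differentiation. Put u = m z + n and v = m (w - z): since |m| <= |u|/rho, the error
    |v|^2 |u|^(-k-2) of [power_taylor] is at most rho^-2 |w - z|^2 |u|^-k, which is summable, so the
    total error is O(|w - z|^2). *)
Lemma eisenstein_derivable z : 0 < Im z -> derivable (@eisenstein R k) z 1.
Proof.
move=> z0.
have d0 : 0 < Im z / 2 by rewrite divr_gt0.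
pose X := `|Re z| + 1.
have [rho [r0 r1 Hr]] := lattice_point_ge X d0.
have [K K0 HK] := @eisenstein_term_bound R k k4 _ X d0.
have [K1 K10 HT] := power_taylor R k.
have zi : Im z / 2 <= Im z by lra.
have zr : `|Re z| <= X by rewrite lerDl.
have mle p : `|p.1%:~R| * rho <= nm (lattice_point p z).
  rewrite -ler_sqr ?nnegrE ?normc_ge0 ?mulr_ge0 ?(ltW r0)//.
  apply: le_trans (Hr z zi zr p); rewrite exprMn mulrC ler_wpM2l ?sqr_ge0//.
  by rewrite real_normK ?num_real// lerDl sqr_ge0.
have mle1 p : `|p.1%:~R| * nm (lattice_point p z)^-1 <= rho^-1.
  rewrite -[rho^-1]mul1r ler_pdivlMr// mulrAC.
  apply: le_trans (normc_inv_mul_le1 (lattice_point p z)).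
  by rewrite ler_wpM2r ?normc_ge0.
pose D p : C := - (k%:R * p.1%:~R * (lattice_point p z)^-1 ^+ k.+1).
have [l Hl] : exists l, has_usum D l.
  apply: (@abs_bounded_has_usum _ _ D (k%:R * rho^-1 * K * 16)).
  apply: abs_bounded_weight => [|p]; first by rewrite !mulr_ge0 ?ler0n ?invr_ge0 ?(ltW r0).
  rewrite /D normcN exprS normcM (normcM k%:R) normcM normc_intr natr_real_complex normc_real.
  rewrite ger0_norm ?ler0n// -!mulrA ler_wpM2l ?ler0n// mulrA.
  apply: ler_pM; rewrite ?mulr_ge0 ?normc_ge0 ?mle1//.
  by have := HK z zi zr p; rewrite /eisenstein_term exprVn.
apply/derivable_complexP; exists l => e e0.
pose K2 := K1 * rho^-2 * K * 16.
have K20 : 0 <= K2 by rewrite !mulr_ge0// invr_ge0 sqr_ge0.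
(* The three radii keep [w] in the half-plane, give |v| <= |u|/2 for every lattice point, and turn
   the quadratic error into at most [e * nm (w - z)]. *)
exists (Num.min (Num.min (Im z / 2) (rho / 2)) (e / (K2 + 1))).
  by rewrite !lt_min d0 !divr_gt0// ltr_wpDl.
move=> w; rewrite !lt_min => /andP[/andP[w1 w2] w3].
have wi : 0 < Im w.
  have := normIm_le (w - z); rewrite ImB ler_norml => /andP[h1 h2]; lra.
pose E p : C := eisenstein_term k w p - eisenstein_term k z p - (w - z) * D p.
have HE : has_usum E (@eisenstein R k w - @eisenstein R k z - l * (w - z)).
  rewrite [l * _]mulrC; apply: has_usumB; last exact: has_usumZ.
  by apply: has_usumB; apply: has_usum_eisenstein.
apply: (@le_trans _ _ (K1 * rho^-2 * K * nm (w - z) ^+ 2 * 16)).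
  apply: has_usum_normc_le HE _; apply: abs_bounded_weight => [|p].
    by rewrite !mulr_ge0// ?invr_ge0 ?sqr_ge0 ?normc_ge0.
  pose u := lattice_point p z; pose v : C := p.1%:~R * (w - z).
  have ew : lattice_point p w = u + v.
    by rewrite /u /v -lattice_point_add [z + _]addrC subrK.
  have nv : nm v <= nm u / 2.
    rewrite normcM normc_intr ler_pdivlMr//.
    apply: le_trans (mle p); rewrite -mulrA ler_wpM2l//; lra.
  have -> : E p = (u + v)^-1 ^+ k - u^-1 ^+ k + k%:R * v * u^-1 ^+ k.+1.
    by rewrite /E /D /eisenstein_term ew -/u !exprVn /v; ring.
  have [ab ba] : (u + v)^-1 - u^-1 = - v * u^-1 * (u + v)^-1 /\ nm (u + v)^-1 <= 2 * nm u^-1.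
    have [u0|u0] := eqVneq u 0.
      have v0 : v = 0.
        apply/eqP; rewrite -normc_eq0 eq_le normc_ge0 andbT.
        by apply: (le_trans nv); rewrite u0 ComplexField.Normc.normc0 mul0r.
      by rewrite u0 v0 addr0 invr0 subrr oppr0 !mul0r ComplexField.Normc.normc0 mulr0.
    have nu : 0 < nm u by rewrite normc_gt0.
    have nuv : nm u / 2 <= nm (u + v).
      by have := normc_le_add u (- v); rewrite opprK normcN; lra.
    have nuv0 : 0 < nm (u + v) by lra.
    have uv0 : u + v != 0 by rewrite -normc_gt0.
    split; first by field; rewrite u0 uv0.
    by rewrite !normcV -ler_pdivrMl// mulrC -invfM lef_pV2 ?posrE ?mulr_gt0//; lra.
  apply: le_trans (HT _ _ _ ab ba) _.
  have nvr : nm v * nm u^-1 <= rho^-1 * nm (w - z).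
    rewrite normcM normc_intr mulrAC ler_wpM2r ?normc_ge0//; exact: mle1.
  have -> : nm v ^+ 2 * nm u^-1 ^+ k.+2 = (nm v * nm u^-1) ^+ 2 * nm u^-1 ^+ k.
    by rewrite -[k.+2]/(2 + k)%N exprD exprMn mulrA.
  have -> : K1 * rho^-2 * K * nm (w - z) ^+ 2 * lattice_weight R p =
      K1 * ((rho^-1 * nm (w - z)) ^+ 2 * (K * lattice_weight R p)).
    by rewrite exprMn exprVn; ring.
  rewrite ler_wpM2l//.
  apply: ler_pM; rewrite ?sqr_ge0 ?exprn_ge0 ?normc_ge0//.
    by rewrite lerXn2r ?nnegrE// ?mulr_ge0 ?invr_ge0 ?normc_ge0 ?(ltW r0).
  by have := HK z zi zr p; rewrite /eisenstein_term normcV normcX normcV exprVn.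
rewrite (_ : _ * 16 = K2 * nm (w - z) * nm (w - z)); last by rewrite /K2; ring.
rewrite ler_wpM2r ?normc_ge0//.
have K21 : 0 < K2 + 1 by rewrite ltr_wpDl.
move: w3; rewrite ltr_pdivlMr// => w3; have := normc_ge0 (w - z); nra.
Qed.

Lemma normc_exp_inv_le u (y : R) : 1 <= y -> y <= nm u -> nm (u ^- k) <= y^-1 * nm (u ^- k.-1).
Proof.
move=> y1 yu; have k0 : (0 < k)%N by apply: leq_trans k4.
rewrite -{1}(prednK k0) exprS invfM normcM ler_wpM2r ?normc_ge0// normcV.
by rewrite lef_pV2 ?posrE//; lra.
Qed.

End EisensteinAnalytic.

(** * Eisenstein series at infinity *)

Section EisensteinInfinity.
Variable R : realType.
Local Notation C := (R[i]).
Local Notation Re := (@complex.Re R).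
Local Notation Im := (@complex.Im R).
Local Notation nm := (@ComplexField.Normc.normc R).
Implicit Types (z u v a b : C) (p : int * int).

Lemma eisenstein_translate k z (m : int) : (4 <= k)%N -> 0 < Im z ->
  @eisenstein R k (z + m%:~R) = @eisenstein R k z.
Proof.
move=> k4 z0; have := @eisenstein_modular R k k4 (mx22 1 m 0 1) z.
have d1 : \det (mx22 1 m 0 1) = 1 by rewrite det_mx22; ring.
move=> /(_ d1 z0); rewrite /mobius.
case: (mx22E 1 m 0 1) => -> -> -> ->.
by rewrite mulr0z mulr1z mul0r add0r !mul1r divr1 expr1n mul1r.
Qed.

(** The terms with m = 0 cancel. For m != 0 one power of |m z + n| >= Im z is traded for the decay,
    and the remaining k - 1 >= 4 powers are still summable. *)
Lemma eisenstein_limit k : (5 <= k)%N -> exists2 K : R, 0 <= K &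
  forall z, 1 <= Im z -> nm (@eisenstein R k z - eisenstein_infinity R k) <= K / Im z.
Proof.
move=> k5; have k4 : (4 <= k)%N by exact: ltnW.
have k14 : (4 <= k.-1)%N by rewrite -ltnS prednK// (leq_trans _ k4).
have [K K0 HK] := @eisenstein_term_bound R k.-1 k14 _ (1 / 2) ltr01.
exists (K * 16); first by rewrite mulr_ge0.
move=> z z1; have [m zm] := exists_translate z.
have zi : 1 <= Im (z + m%:~R) by rewrite Im_translate.
rewrite -(eisenstein_translate m k4); last by lra.
rewrite -(Im_translate z m); move: zm zi; set w := z + m%:~R => wr wi.
have w0 : 0 < Im w by lra.
have H := has_usumB (has_usum_eisenstein k4 w0) (@has_usum_eisenstein_infinity R k k4).
rewrite mulrAC; apply: has_usum_normc_le H _.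
apply: abs_bounded_weight => [|p]; first by rewrite divr_ge0 ?(ltW w0).
case: eqP => p1.
  rewrite /eisenstein_term /lattice_point p1 mulr0z !mul0r subrr ComplexField.Normc.normc0.
  by rewrite mulr_ge0 ?lattice_weight_ge0 ?divr_ge0 ?(ltW w0).
rewrite subr0 mulrAC mulrC.
apply: le_trans (ler_wpM2l _ (HK w wi wr p)); last by rewrite invr_ge0 ltW.
apply: normc_exp_inv_le => //.
rewrite -ler_sqr ?nnegrE ?normc_ge0 ?(ltW w0)// lattice_point_sq exprMn.
have := @intr_sqr_ge1 R _ (introN eqP p1) => h.
rewrite -[X in X <= _]add0r; apply: lerD; first exact: sqr_ge0.
by rewrite ler_peMl ?sqr_ge0.
Qed.

End EisensteinInfinity.

(** * A nonzero cusp form of weight 12 *)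

Section CuspFormOfWeight12.
Variable R : realType.
Local Notation C := (R[i]).
Local Notation Re := (@complex.Re R).
Local Notation Im := (@complex.Im R).
Local Notation nm := (@ComplexField.Normc.normc R).
Local Notation normcM := ComplexField.Normc.normcM.
Local Notation normcV := ComplexField.Normc.normcV.
Local Notation E6 := (@eisenstein R 6).
Local Notation E12 := (@eisenstein R 12).
Local Notation Z6 := (eisenstein_infinity R 6).
Local Notation Z12 := (eisenstein_infinity R 12).
Local Notation I := (Complex (0 : R) 1).
Implicit Types (z u v a b : C) (p : int * int).

(** A multiple of the discriminant form. Choosing E_12 instead of the usual E_4^3 makes nonvanishing
    easy without q-expansions: E_6 vanishes at i, and E_12(i) is dominated by four lattice terms. *)
Definition cusp_form12 : C -> C^o := fun z =>
  if 0 < Im z then Z6 ^+ 2 * E12 z - Z12 * E6 z ^+ 2 else 0.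

Lemma derivable_local (f g : C^o -> C^o) z (d : R) : 0 < d ->
  (forall w, nm (w - z) < d -> f w = g w) -> derivable f z 1 -> derivable g z 1.
Proof.
move=> d0 fg /derivable_complexP[l Hl]; apply/derivable_complexP; exists l => e /Hl[d' d'0 H].
exists (Num.min d d'); first by rewrite lt_min d0.
move=> w; rewrite lt_min => /andP[h1 h2]; rewrite -!fg ?H//.
by rewrite subrr ComplexField.Normc.normc0.
Qed.

Lemma cusp_form12_derivable z : 0 < Im z -> derivable (cusp_form12 : C^o -> C^o) z 1.
Proof.
move=> z0.
apply: (@derivable_local (fun z => Z6 ^+ 2 * E12 z - Z12 * E6 z ^+ 2) _ _ _ z0).
  move=> w wz; rewrite /cusp_form12 ifT//.
  by have := normIm_le (w - z); rewrite ImB ler_norml => /andP[h1 h2]; lra.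
apply: (@derivable_sub_fun _ (fun z => Z6 ^+ 2 * E12 z) (fun z => Z12 * E6 z ^+ 2)).
  apply: (@derivable_mul_fun _ (fun=> Z6 ^+ 2)); first exact: derivable_cst_fun.
  exact: eisenstein_derivable.
apply: (@derivable_mul_fun _ (fun=> Z12) (fun z => E6 z ^+ 2)); first exact: derivable_cst_fun.
by apply: (@derivable_exp_fun _ E6); exact: eisenstein_derivable.
Qed.

Lemma cusp_form12_slash (g : 'M[int]_2) : \det g = 1 -> slash 12 g cusp_form12 = cusp_form12.
Proof.
move=> g1; apply/funext => z; rewrite slash_det1// /cusp_form12.
have Ig := @Im_mobius R g z g1; case: (ltP 0 (Im z)) => z0; last first.
  rewrite ifF ?mulr0// Ig; apply/negbTE; rewrite -leNgt.
  by rewrite mulr_le0_ge0// invr_ge0 sqr_ge0.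
rewrite Im_mobius_gt0// !eisenstein_modular//.
by have j0 := denom_neq0 g1 z0; field.
Qed.

Lemma cusp_form12_at_infinity : vanishes_at_infinity cusp_form12.
Proof.
have [K6 K60 H6] := @eisenstein_limit R 6 erefl.
have [K12 K120 H12] := @eisenstein_limit R 12 erefl.
pose K := nm Z6 ^+ 2 * K12 + nm Z12 * (K6 * (K6 + 2 * nm Z6)).
have n6 := normc_ge0 Z6; have n12 := normc_ge0 Z12.
have K0 : 0 <= K.
  by rewrite addr_ge0// mulr_ge0 ?sqr_ge0// mulr_ge0// addr_ge0// mulr_ge0.
move=> eps e0; exists (Num.max 1 (K / eps)) => z; rewrite gt_max => /andP[z1 zK].
have z0 : 0 < Im z by lra.
rewrite /cusp_form12 z0.
have -> : Z6 ^+ 2 * E12 z - Z12 * E6 z ^+ 2 = Z6 ^+ 2 * (E12 z - Z12)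
    - Z12 * ((E6 z - Z6) * ((E6 z - Z6) + 2 * Z6)) by ring.
apply: (@le_lt_trans _ _ (K / Im z)); last by rewrite ltr_pdivrMr// mulrC -ltr_pdivrMr.
have a6 := H6 z (ltW z1); have a12 := H12 z (ltW z1).
have b6 : K6 / Im z <= K6 by rewrite ler_pdivrMr// ler_peMr// ltW.
apply: le_trans (normcB _ _) _; rewrite /K [leRHS]mulrDl; apply: lerD.
  by rewrite normcM normcX -mulrA ler_wpM2l ?sqr_ge0.
rewrite normcM -mulrA ler_wpM2l// normcM mulrAC.
apply: ler_pM; rewrite ?normc_ge0//.
apply: le_trans (le_normcD _ _) _; apply: lerD; first exact: le_trans a6 b6.
by rewrite normcM natr_real_complex normc_real ger0_norm.
Qed.

Lemma cuspforms_cusp_form12 : cuspforms 12 1 cusp_form12.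
Proof.
split.
- by move=> z /negP z0; rewrite /cusp_form12 ifF//; apply/negbTE.
- by move=> z z0; exact: cusp_form12_derivable.
- by move=> g /Gamma0_1 g1; exact: cusp_form12_slash.
- by move=> g g1; rewrite cusp_form12_slash//; exact: cusp_form12_at_infinity.
Qed.

(** Inversion fixes i, with automorphy factor i^6 = -1. *)
Lemma E6_at_i : E6 I = 0.
Proof.
have d1 : \det (mx22 0 (-1) 1 0) = 1 by rewrite det_mx22.
have := @eisenstein_modular R 6 erefl (mx22 0 (-1) 1 0) I d1 ltr01.
rewrite /mobius; case: (mx22E 0 (-1) 1 0) => -> -> -> ->.
rewrite mulr0z mulr1z mul0r mul1r add0r addr0 mulrNz.
have I2 : I ^+ 2 = -1 by rewrite sqr_i.
have -> : -1%:~R / I = I.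
  have I0 : I != 0 by rewrite -normc_gt0 /= expr0n add0r expr1n sqrtr1.
  by apply: (mulIf I0); rewrite divfK// -expr2 I2.
have -> : I ^+ 6 = -1 by rewrite (_ : 6 = 2 * 3)%N// exprM I2 !exprS expr0; ring.
rewrite mulN1r => /eqP; rewrite -subr_eq0 opprK -mulr2n mulrn_eq0 /= => /eqP.
by [].
Qed.

(** All terms n^-6 are nonnegative, and n = 1 contributes 1. *)
Lemma Z6_neq0 : Z6 != 0.
Proof.
have := has_usum_Re_ge (c := 1) (F0 := [:: (0, 1)]) (@has_usum_eisenstein_infinity R 6 erefl).
move=> H; apply: contraTneq (@ltr01 R) => Z0; rewrite -leNgt.
have -> : (0 : R) = Re Z6 by rewrite Z0.
apply: H => F uF sF; rewrite Re_sum.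
have t1 : eisenstein_term 6 I (0, 1) = 1.
  by rewrite /eisenstein_term /lattice_point mulr0z mul0r add0r mulr1z expr1n invr1.
apply: le_trans (@ler_sum_subseq R _ [:: (0, 1)] F _ _ _ sF) => //.
  have h : 1 <= Re (eisenstein_term 6 I (0, 1)) by rewrite t1.
  by rewrite big_seq1; exact: h.
move=> [m n]; case: eqP => // /= ->.
rewrite /eisenstein_term /lattice_point mulr0z mul0r add0r -(rmorph_int (real_complex R)).
by rewrite -rmorphXn -fmorphV /= invr_ge0 exprn_even_ge0.
Qed.

(** The four Gaussian units contribute 4, as i^12 = 1. Every other nonzero p has [sq_norm p >= 2],
    so its term is at most 2^-4 times the inverse square of [sq_norm p], hence at most 9/64 of its
    weight; together these terms are at most 9/4. *)
Lemma E12_at_i : 1 <= Re (E12 I).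
Proof.
pose F0 : seq (int * int) := [:: (0, 1); (0, -1); (1, 0); (-1, 0)].
have uF0 : uniq F0 by [].
have I12 : I ^+ 12 = 1.
  by rewrite (_ : 12 = 2 * 6)%N// exprM sqr_i !exprS expr0; ring.
apply: (has_usum_Re_ge (F0 := F0) (@has_usum_eisenstein R 12 erefl I ltr01)).
move=> F uF sF.
have rest p : p \notin F0 -> nm (eisenstein_term 12 I p) <= 9 / 64 * lattice_weight R p.
  move=> pF0; have [->|p0] := eqVneq p (0, 0).
    rewrite /eisenstein_term /lattice_point mulr0z mul0r add0r expr0n invr0.
    by rewrite ComplexField.Normc.normc0 mulr_ge0 ?lattice_weight_ge0.
  have s2 : 2 <= sq_norm R p.
    have : (2 : int) <= p.1 * p.1 + p.2 * p.2.
      case: p pF0 p0 => m n; rewrite !inE !xpair_eqE /=.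
      case: (eqVneq m 0) => [->|m0]; case: (eqVneq n 0) => [->|n0];
        rewrite ?andbF ?andbT ?orbF //= => h1 h2; move: h1; rewrite ?negb_or => *; nia.
    by rewrite -(ler_int R) [X in _ <= X -> _]intrD !intrM -!expr2.
  have ls : nm (lattice_point p I) ^+ 2 = sq_norm R p.
    by rewrite lattice_point_sq /= mulr0 add0r mulr1 addrC.
  rewrite normcV normcX (_ : nm _ ^+ 12 = sq_norm R p ^+ 4 * sq_norm R p ^+ 2); last first.
    by rewrite -ls; ring.
  rewrite invfM (_ : 9 / 64 = 16^-1 * (9 / 4)); last by field.
  rewrite -mulrA; apply: ler_pM; rewrite ?invr_ge0 ?exprn_ge0 ?sq_norm_ge0//.
    rewrite lef_pV2 ?posrE ?exprn_gt0//; last by lra.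
    by rewrite (_ : 16 = 2 ^+ 4); [rewrite lerXn2r ?nnegrE ?sq_norm_ge0|ring].
  exact: inv_sq_norm_le.
have pF : perm_eq F (F0 ++ [seq p <- F | p \notin F0]).
  apply: uniq_perm => //.
    rewrite cat_uniq uF0 filter_uniq// andbT -all_predC.
    by apply/allP => p; rewrite mem_filter => /andP[].
  move=> p; rewrite mem_cat mem_filter; case: (boolP (p \in F0)) => //= h.
  exact: sF.
rewrite (perm_big _ pF) big_cat /= ReD.
have -> : \sum_(p <- F0) eisenstein_term 12 I p = 4.
  have I12' : (-1 * I) ^+ 12 = 1 by rewrite exprMn I12 mulr1 !exprS expr0; ring.
  have m12 : (-1 : C) ^+ 12 = 1 by rewrite !exprS expr0; ring.
  rewrite !big_cons big_nil /eisenstein_term /lattice_point /=.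
  rewrite !mulr0z !mulrNz !mulr1z !mul0r !add0r !addr0 mul1r I12 I12' m12 expr1n invr1.
  by ring.
set G := [seq p <- F | p \notin F0].
have uG : uniq G by apply: filter_uniq.
have : nm (\sum_(p <- G) eisenstein_term 12 I p) <= 9 / 64 * 16.
  apply: le_trans (normc_sum _ _ _) _.
  apply: (@le_trans _ _ (\sum_(p <- G) 9 / 64 * lattice_weight R p)).
    rewrite big_seq [leRHS]big_seq; apply: ler_sum => p.
    by rewrite mem_filter => /andP[h _]; exact: rest.
  by rewrite -mulr_sumr ler_wpM2l// sum_lattice_weight.
have := normRe_le (\sum_(p <- G) eisenstein_term 12 I p).
rewrite ler_norml => /andP[h1 _] h2.
rewrite natr_real_complex /=; lra.
Qed.

Lemma cusp_form12_neq0 : cusp_form12 <> 0.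
Proof.
move=> /(congr1 (fun f => f I)); rewrite /cusp_form12 /= ltr01 E6_at_i expr0n mulr0 subr0.
move=> /eqP; rewrite mulf_eq0 expf_eq0 (negbTE Z6_neq0) andbF /= => /eqP e.
by have := E12_at_i; rewrite e /= ler10.
Qed.

End CuspFormOfWeight12.

(** * Multisets of eigenvalues *)

Section EigenvalueMultisets.
Variables (K : fieldType) (E : lmodType K).
Implicit Types (V : set E) (T : E -> E) (s : seq K).

Definition spectrum V T s := exists n (e : 'I_n -> E) (A : 'M[K]_n),
  [/\ is_basis V e, forall j, T (e j) = \sum_i A i j *: e i
    & char_poly A = \prod_(x <- s) ('X - x%:P)].

(** Substituting aX for X turns the characteristic matrix of aA into a times that of A, and the
    resulting factor a^n is spread over the n roots. *)
Lemma char_poly_scale n (A : 'M[K]_n) (a : K) s : a != 0 ->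
  char_poly A = \prod_(x <- s) ('X - x%:P) ->
  char_poly (a *: A) = \prod_(x <- [seq a * x | x <- s]) ('X - x%:P).
Proof.
move=> a0 As; have sn : size s = n.
  by apply: succn_inj; rewrite -(size_prod_XsubC s id) -As size_char_poly.
have compK p : (p \Po (a *: 'X)) \Po (a^-1 *: 'X) = p.
  by rewrite -comp_polyA comp_polyZ comp_polyX scalerA divff// scale1r comp_polyXr.
rewrite -[LHS]compK -[RHS]compK; congr (_ \Po _).
rewrite /char_poly -(det_map_mx (comp_poly (a *: 'X))).
have -> : map_mx (comp_poly (a *: 'X)) (char_poly_mx (a *: A)) = a%:P *: char_poly_mx A.
  apply/matrixP => i j; rewrite !mxE rmorphB /= rmorphMn /= comp_polyX comp_polyC.
  by rewrite mulrBr mulrnAr -mul_polyC polyCM.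
have an : a%:P ^+ n = \prod_(x <- s) a%:P by rewrite big_const_seq count_predT iter_mulr_1 sn.
rewrite detZ -/(char_poly A) As big_map rmorph_prod an -big_split /=.
by apply: eq_bigr => x _; rewrite rmorphB /= comp_polyX comp_polyC mulrBr -mul_polyC polyCM.
Qed.

Lemma basis_change V n m (e : 'I_n -> E) (e' : 'I_m -> E) :
  is_basis V e -> is_basis V e' -> exists (P : 'M[K]_(n, m)) (Q : 'M[K]_(m, n)),
  [/\ forall j, e' j = \sum_i P i j *: e i, P *m Q = 1%:M & Q *m P = 1%:M].
Proof.
move=> [Ve fe] [Ve' fe'].
have inV p (b : 'I_p -> E) (W : set E) : is_basis W b -> forall i, W (b i).
  move=> [-> _] i; exists (fun j => (j == i)%:R).
  rewrite (bigD1 i)//= eqxx scale1r big1 ?addr0// => j /negbTE ->.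
  by rewrite scale0r.
have /choice[P HP] j : exists c : 'I_n -> K, e' j = \sum_i c i *: e i.
  by have := inV _ e' V (conj Ve' fe') j; rewrite Ve.
have /choice[Q HQ] j : exists c : 'I_m -> K, e j = \sum_i c i *: e' i.
  by have := inV _ e V (conj Ve fe) j; rewrite Ve'.
have eq1 p q (b : 'I_p -> E) (b' : 'I_q -> E) (X : 'I_q -> 'I_p -> K) (Y : 'I_p -> 'I_q -> K) :
    (forall c : 'I_p -> K, \sum_i c i *: b i = 0 -> forall i, c i = 0) ->
    (forall j, b' j = \sum_i X j i *: b i) -> (forall j, b j = \sum_i Y j i *: b' i) ->
    (\matrix_(i, j) X j i) *m (\matrix_(i, j) Y j i) = 1%:M.
  move=> fb HX HY; apply/matrixP => i j.
  apply/eqP; rewrite -subr_eq0; apply/eqP.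
  pose c i := ((\matrix_(i, j) X j i) *m (\matrix_(i, j) Y j i)) i j - 1%:M i j.
  apply: (fb c); rewrite /c.
  under eq_bigr do rewrite scalerBl.
  rewrite sumrB (_ : \sum_i 1%:M i j *: b i = b j); last first.
    rewrite (bigD1 j)//= mxE eqxx scale1r big1 ?addr0// => l /negbTE lj.
    by rewrite mxE lj scale0r.
  apply/eqP; rewrite subr_eq0; apply/eqP; rewrite [RHS]HY.
  under eq_bigr do rewrite mxE scaler_suml.
  rewrite exchange_big /=; apply: eq_bigr => l _.
  rewrite HX scaler_sumr; apply: eq_bigr => i' _.
  by rewrite !mxE scalerA mulrC.
exists (\matrix_(i, j) P j i), (\matrix_(i, j) Q j i); split.
- by move=> j; rewrite HP; apply: eq_bigr => i _; rewrite mxE.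
- exact: (eq1 _ _ e e').
- exact: (eq1 _ _ e' e).
Qed.

Lemma basis_size_unique V n m (e : 'I_n -> E) (e' : 'I_m -> E) :
  is_basis V e -> is_basis V e' -> n = m.
Proof.
move=> h h'; have [P [Q [_ PQ QP]]] := basis_change h h'.
by apply/eqP; rewrite eqn_leq (mulmx1_min PQ) (mulmx1_min QP).
Qed.

Lemma vdim_basis V n (e : 'I_n -> E) : is_basis V e -> vdim V = n.
Proof.
move=> h; have : exists m, exists e : 'I_m -> E, is_basis V e by exists n, e.
by move=> /(xgetPex 0%N)[e' h']; exact: basis_size_unique h' h.
Qed.

Lemma char_poly_conj n (P Q A B : 'M[K]_n) : P *m Q = 1%:M -> P *m B = A *m P ->
  char_poly A = char_poly B.
Proof.
move=> PQ PB; have e : map_mx polyC P *m char_poly_mx B = char_poly_mx A *m map_mx polyC P.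
  by rewrite /char_poly_mx mulmxBr mulmxBl scalar_mxC -!map_mxM PB.
have := congr1 determinant e; rewrite !det_mulmx [RHS]mulrC -!/(char_poly _).
move/mulfI => -> //; rewrite det_map_mx polyC_eq0.
by have := congr1 determinant PQ; rewrite det_mulmx det1; apply: contra_eq_neq => ->; rewrite mul0r eq_sym oner_eq0.
Qed.

Definition linear_map T := forall n (c : 'I_n -> K) (g : 'I_n -> E),
  T (\sum_i c i *: g i) = \sum_i c i *: T (g i).

(** Matrices of [T] in two bases are conjugate and unique factorization identifies the roots, so the
    choices hidden in [eigen] affect only the order. *)
Lemma spectrum_perm V T s s' : linear_map T ->
  spectrum V T s -> spectrum V T s' -> perm_eq s s'.
Proof.
move=> lT [n [e [A [be TA cA]]]] [m [e' [A' [be' TA' cA']]]].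
have nm := basis_size_unique be be'; subst m.
have [P [Q [e'P PQ QP]]] := basis_change be be'.
have PA : P *m A' = A *m P.
  apply/matrixP => i j; apply/eqP; rewrite -subr_eq0; apply/eqP.
  apply: (be.2 (fun i => (P *m A') i j - (A *m P) i j)).
  under eq_bigr do rewrite scalerBl.
  rewrite sumrB; apply/eqP; rewrite subr_eq0; apply/eqP.
  transitivity (T (e' j)).
    rewrite TA'; under eq_bigr do rewrite mxE scaler_suml.
    rewrite exchange_big; apply: eq_bigr => l _; rewrite e'P scaler_sumr.
    by apply: eq_bigr => i' _; rewrite scalerA mulrC.
  rewrite e'P lT; under [RHS]eq_bigr do rewrite mxE scaler_suml.
  rewrite [RHS]exchange_big; apply: eq_bigr => l _; rewrite TA scaler_sumr.
  by apply: eq_bigr => i' _; rewrite scalerA mulrC.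
by apply: prod_XsubC_eq; rewrite -cA -cA'; exact: char_poly_conj PQ PA.
Qed.

Lemma spectrum_scale V T a s : a != 0 -> spectrum V T s ->
  spectrum V (fun f => a *: T f) [seq a * x | x <- s].
Proof.
move=> a0 [n [e [A [be TA cA]]]]; exists n, e, (a *: A); split => //.
  move=> j; rewrite TA scaler_sumr; apply: eq_bigr => i _.
  by rewrite mxE scalerA.
exact: char_poly_scale.
Qed.

Lemma spectrum_size V T s : spectrum V T s -> size s = vdim V.
Proof.
move=> [n [e [A [be _ cA]]]]; rewrite (vdim_basis be).
by apply: succn_inj; rewrite -(size_prod_XsubC s id) -cA size_char_poly.
Qed.

Lemma eigen_cases V T : eigen V T = [::] \/ spectrum V T (eigen V T).
Proof.
case: (pselect (exists s, spectrum V T s)) => [/(xgetPex [::])|H]; first by right.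
left; rewrite /eigen; case: xgetP => // s _ hs; by exfalso; apply: H; exists s.
Qed.

Lemma eigen_spectrum V T s : spectrum V T s -> spectrum V T (eigen V T).
Proof. by move=> h; exact: (xgetPex [::] (ex_intro _ s h)). Qed.

Lemma eigen_size V T : (size (eigen V T) <= vdim V)%N.
Proof. by case: (eigen_cases V T) => [->//|/spectrum_size ->]. Qed.

Lemma eigen_scale V T a : a != 0 -> linear_map T ->
  perm_eq (eigen V (fun f => a *: T f)) [seq a * x | x <- eigen V T].
Proof.
move=> a0 lT.
have laT : linear_map (fun f => a *: T f).
  move=> n c g; rewrite lT scaler_sumr; apply: eq_bigr => i _.
  by rewrite !scalerA mulrC.
(* When [eigen V T] is empty, scaling back by 1/a turns any spectrum of the scaled map into one of
   [T], which forces [vdim V = 0] and both multisets empty. *)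
case: (eigen_cases V T) => [e0|sT].
  rewrite e0; case: (eigen_cases V (fun f => a *: T f)) => [->//|saT].
  have a'0 : a^-1 != 0 by rewrite invr_eq0.
  have := spectrum_scale a'0 saT; rewrite (_ : (fun f => _) = T); last first.
    by apply/funext => f; rewrite scalerA mulVf// scale1r.
  move=> h; have := spectrum_size (eigen_spectrum h); rewrite e0 -(spectrum_size saT).
  by move=> /esym/size0nil ->.
by apply: (spectrum_perm laT) (spectrum_scale a0 sT); exact: eigen_spectrum (spectrum_scale a0 sT).
Qed.

End EigenvalueMultisets.

(** * Counting large Hecke eigenvalues *)

Section HeckeEigenvalueCounts.
Variable R : realType.
Local Notation C := (R[i]).
Local Notation nm := (@ComplexField.Normc.normc R).
Implicit Types (V : set (C -> C^o)) (f : C -> C^o).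

Lemma sum_fct_apply n (c : 'I_n -> C) (g : 'I_n -> C -> C^o) z :
  (\sum_i c i *: g i) z = \sum_i c i * g i z.
Proof. by rewrite fct_sumE; apply: eq_bigr => i _. Qed.

Lemma slash_linear k (g : 'M[int]_2) : linear_map (@slash R k g).
Proof.
move=> n c f; apply/funext => z; rewrite sum_fct_apply /slash sum_fct_apply mulr_sumr.
by apply: eq_bigr => i _; rewrite mulrCA.
Qed.

Lemma hecke_linear k p : linear_map (@hecke R k p).
Proof.
move=> n c f; rewrite /hecke slash_linear.
under [X in _ *: (_ + X)]eq_bigr do rewrite slash_linear.
rewrite exchange_big -big_split scaler_sumr; apply: eq_bigr => i _ /=.
by rewrite -scaler_sumr -scalerDr !scalerA mulrC.
Qed.

Lemma eigen_hecke_normalized V k p : (0 < p)%N ->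
  perm_eq (eigen V (@hecke_normalized R k p))
    [seq real_complex R (p%:R `^ (- ((k%:R - 1) / 2))) * x | x <- eigen V (@hecke R k p)].
Proof.
move=> p0; apply: eigen_scale (@hecke_linear k p).
by rewrite -normc_gt0 normc_real normr_gt0 gt_eqF// powR_gt0// ltr0n.
Qed.

Lemma large_eigen_count_add V k p (d : R) : (0 < p)%N ->
  d = p%:R `^ (- ((k%:R - 1) / 2)) ->
  (large_eigen_count V k p +
   eigen_count_in V (@hecke_normalized R k p) `[(- (2 - d))%R, (2 - d)%R]
   <= vdim V)%N.
Proof.
move=> p0 dE; apply: leq_trans (eigen_size V (@hecke R k p)).
rewrite /eigen_count_in (permP (eigen_hecke_normalized V k p0)) count_map -count_predUI.
rewrite [X in (_ + X)%N](_ : _ = count pred0 (eigen V (@hecke R k p))).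
  by rewrite count_pred0 addn0 count_size.
apply: eq_count => l /=.
apply/negP => /andP[/= large /andP[/eqP im0]]; rewrite itv_boundlr /= !lteBSide /=.
rewrite -dE in im0 *.
have p0R : 0 < p%:R :> R by rewrite ltr0n.
have d0 : 0 < d by rewrite dE powR_gt0.
have dX : p%:R `^ ((k%:R - 1) / 2) = d^-1 by rewrite dE powRN invrK.
move=> /andP[re1 re2]; have nl : nm (real_complex R d * l) <= 2 - d.
  apply: le_trans (normc_le_Re_Im _) _; rewrite im0 normr0 addr0 ler_norml.
  by rewrite re1 re2.
move: nl; rewrite ComplexField.Normc.normcM normc_real gtr0_norm// mulrC -ler_pdivlMr//.
move: large; rewrite dX => large nl.
have := floorD1_gt (2 / d); rewrite intrD => fl.
have : (2 - d) / d = 2 / d - 1 by field; rewrite gt_eqF.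
move=> h; rewrite h in nl; have := lt_le_trans fl (lerD (le_trans large nl) (lexx _)).
by rewrite subrK ltxx.
Qed.

End HeckeEigenvalueCounts.

(** * Mass of mu_p on symmetric intervals *)

Section SpectralMeasureMass.
Variable R : realType.
Implicit Types (x b t c : R).

Lemma atan_inv_pos x : 0 < x -> atan x = pi / 2 - atan x^-1.
Proof.
move=> x0; have xi0 : 0 < x^-1 by rewrite invr_gt0.
have a0 : 0 < atan x^-1 by rewrite -atan0; exact: lt_atan.
have a2 := atan_ltpi2 x^-1.
rewrite -[RHS]tanK; last by rewrite in_itv /=; apply/andP; split; lra.
congr atan; rewrite /tan sinB cosB sin_pihalf cos_pihalf !mul0r !mul1r subr0 add0r.
by rewrite -[LHS]invrK -[in LHS](atanK x^-1) /tan invf_div.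
Qed.

Section DerivativeRules.
Variables (f g : R -> R) (x df dg : R).
Hypotheses (hf : is_derive x 1 f df) (hg : is_derive x 1 g dg).

Lemma is_derive_sub_fun : is_derive x 1 (fun y => f y - g y) (df - dg).
Proof. exact: is_deriveB. Qed.

Lemma is_derive_mul_fun : is_derive x 1 (fun y => f y * g y) (f x * dg + g x * df).
Proof. exact: (is_deriveM hf hg). Qed.

Lemma is_derive_inv_fun : f x != 0 -> is_derive x 1 (fun y => (f y)^-1) (- (f x) ^- 2 * df).
Proof. by move=> fx; exact: (is_deriveV fx hf). Qed.

Lemma is_derive_atan_fun : is_derive x 1 (fun y => atan (f y)) ((1 + f x ^+ 2)^-1 * df).
Proof. exact: (is_derive1_comp (is_derive1_atan (f x)) hf). Qed.

Lemma is_derive_sqrt_fun : 0 < f x ->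
  is_derive x 1 (fun y => Num.sqrt (f y)) ((2 * Num.sqrt (f x))^-1 * df).
Proof. by move=> fx; exact: (is_derive1_comp (is_derive1_sqrt fx) hf). Qed.

End DerivativeRules.

Lemma is_derive_cst_fun (a x : R) : is_derive x 1 (fun=> a) 0.
Proof. exact: is_derive_cst. Qed.

Lemma is_derive_id_fun x : is_derive x 1 (fun y : R => y) 1.
Proof. exact: is_derive_id. Qed.

Lemma is_derive_scale_fun (a x : R) (f : R -> R) df : is_derive x 1 f df ->
  is_derive x 1 (fun y => a * f y) (a * df).
Proof.
move=> hf; apply: is_derive_eq (is_derive_mul_fun (is_derive_cst_fun a x) hf) _.
by rewrite mulr0 addr0.
Qed.

Lemma is_derive_continuous (f : R -> R) x df : is_derive x 1 f df -> {for x, continuous f}.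
Proof. by move=> [dfx _]; apply: differentiable_continuous; exact/derivable1_diffP. Qed.

Lemma is_derive_derive1 (f : R -> R) x df : is_derive x 1 f df -> (f^`())%classic x = df.
Proof. by move=> h; rewrite derive1E; exact: derive_val. Qed.

(** Both sides vanish at 0, and the derivative (1 + t^2)^-1 - (1 + (t/c)^2)^-1 of the left one is at
    most (c^-2 - 1) t^2. The cubic order is the source of the exponent 3/2 of d. *)
Lemma atan_diff_le t c : 0 <= t -> 0 < c -> c <= 1 ->
  atan t - c * atan (t * c^-1) <= (c^-2 - 1) * t ^+ 3 / 3.
Proof.
move=> t0 c0 c1.
pose f s := (c^-2 - 1) / 3 * (s * (s * s)) - (atan s - c * atan (s * c^-1)).
have c2 : 0 <= c^-2 - 1 by rewrite subr_ge0 invf_ge1 ?exprn_gt0// exprn_ile1// ltW.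
have nz x : [&& c != 0, c ^+ 2 + x ^+ 2 != 0 & 1 + x ^+ 2 != 0].
  have := sqr_ge0 x; have : 0 < c ^+ 2 by rewrite exprn_gt0.
  by move=> h1 h2; rewrite !gt_eqF//; lra.
have df x : is_derive x 1 f ((c^-2 - 1) * x ^+ 2 - ((1 + x ^+ 2)^-1 - (1 + (x * c^-1) ^+ 2)^-1)).
  have hid := is_derive_id_fun x.
  have h := is_derive_sub_fun (is_derive_scale_fun ((c^-2 - 1) / 3)
      (is_derive_mul_fun hid (is_derive_mul_fun hid hid)))
    (is_derive_sub_fun (is_derive_atan_fun hid) (is_derive_scale_fun c
      (is_derive_atan_fun (is_derive_mul_fun hid (is_derive_cst_fun c^-1 x))))).
  by apply: is_derive_eq h _; field; exact: nz.
have : f 0 <= f t.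
  apply: (@ger0_derive1_ndecr _ f 0 t) => //.
  - move=> x; rewrite in_itv /= => /andP[x0 _]; rewrite (is_derive_derive1 (df x)).
    have x2 : 0 <= x ^+ 2 by exact: sqr_ge0.
    have h1 : 0 < 1 + x ^+ 2 by lra.
    have h2 : 0 < 1 + (x * c^-1) ^+ 2 by rewrite ltr_pwDl// sqr_ge0.
    have -> : (1 + x ^+ 2)^-1 - (1 + (x * c^-1) ^+ 2)^-1 =
        (c^-2 - 1) * x ^+ 2 * ((1 + x ^+ 2)^-1 * (1 + (x * c^-1) ^+ 2)^-1).
      by rewrite exprMn; field; exact: nz.
    rewrite subr_ge0 ler_piMr//; first exact: mulr_ge0.
    by rewrite mulr_ile1 ?invr_ge0 ?invf_le1 ?(ltW h1) ?(ltW h2)// lerDl// sqr_ge0.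
  - by apply: continuous_in_subspaceT => x _; exact: is_derive_continuous (df x).
rewrite /f !mul0r atan0 !mulr0 subrr oppr0 addr0 subr_ge0 => h.
apply: (le_trans h); rewrite le_eqVlt; apply/orP; left; apply/eqP; field.
by have /andP[] := nz 0.
Qed.

(** The left side is the derivative of the primitive of the density up to a constant factor, in the
    unsimplified form in which the derivative rules deliver it; [du] is the derivative of x/s, with
    s the square root. Eliminating x^2 in favour of s^2 makes it a rational identity. *)
Lemma density_identity (Q x s : R) : 0 < Q -> 0 < s -> s ^+ 2 = 4 - x ^+ 2 ->
  let c := (Q - 1) / (Q + 1) in let du := x * (- s ^- 2 * (- x / s)) + s^-1 * 1 in
  (1 + (x / s) ^+ 2)^-1 * du - c * ((1 + (x / s * c) ^+ 2)^-1 * (x / s * 0 + c * du)) =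
  s / ((Q + 1) ^+ 2 / Q - x ^+ 2).
Proof.
move=> Q0 s0 ss c du.
have x2 : x ^+ 2 = 4 - s ^+ 2 by rewrite ss; ring.
have sn : s != 0 by rewrite gt_eqF.
have Qn : Q != 0 by rewrite gt_eqF.
have Q1n : Q + 1 != 0 by rewrite gt_eqF//; lra.
pose W := (Q - 1) ^+ 2 + Q * s ^+ 2.
have Wn : W != 0.
  by rewrite gt_eqF// ltr_wpDl ?sqr_ge0// mulr_gt0// exprn_gt0.
have -> : du = 4 / s ^+ 3.
  have -> : du = (x ^+ 2 + s ^+ 2) / s ^+ 3 by rewrite /du; field.
  by rewrite x2 subrK.
have -> : 1 + (x / s) ^+ 2 = 4 / s ^+ 2 by rewrite expr_div_n x2; field.
have -> : 1 + (x / s * c) ^+ 2 = 4 * W / ((Q + 1) ^+ 2 * s ^+ 2).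
  by rewrite exprMn expr_div_n x2 /c /W; field; rewrite Q1n sn.
have -> : (Q + 1) ^+ 2 / Q - x ^+ 2 = W / Q by rewrite x2 /W; field.
have -> : (4 * W / ((Q + 1) ^+ 2 * s ^+ 2))^-1 = (Q + 1) ^+ 2 * s ^+ 2 / (4 * W).
  by field; rewrite Wn sn Q1n.
have -> : s / (W / Q) = s^-1 * ((W - (Q - 1) ^+ 2) / W).
  by rewrite [W - _]addrAC subrr add0r; field; rewrite Wn Qn sn.
by rewrite /c; field; rewrite Wn sn Q1n.
Qed.

Section Mass.
Variable p : nat.
Hypothesis p2 : (2 <= p)%N.
Local Notation q := (p%:R : R).
Let c := (q - 1) / (q + 1).

Let q2 : 2 <= q. Proof. by rewrite ler_nat. Qed.

Lemma mu_density_denom : (q `^ (1 / 2) + q `^ (- (1 / 2))) ^+ 2 = (q + 1) ^+ 2 / q.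
Proof.
have q0 : 0 < q by rewrite ltr0n (leq_trans _ p2).
have e : q `^ (1 / 2) ^+ 2 = q by rewrite -powR_mulrn ?powR_ge0// -powRrM mul1r mulVf// powRr1// ltW.
have s0 : 0 < q `^ (1 / 2) by rewrite powR_gt0.
rewrite powRN; move: (q `^ (1 / 2)) e s0 => s <- s0.
by field; rewrite gt_eqF.
Qed.

(** The substitution x = 2 sin theta, u = tan theta = x / sqrt(4 - x^2) makes the integrand rational
    in u, and partial fractions leave two arctangents. The condition b < 2 keeps u finite. *)
Lemma integral_mu_density b : 0 < b < 2 ->
  \int[lebesgue_measure]_(x in [set` `[- b, b]]) mu_density p x =
    (q + 1) / pi * (atan (b / Num.sqrt (4 - b ^+ 2)) - c * atan (b / Num.sqrt (4 - b ^+ 2) * c)).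
Proof.
move=> /andP[b0 b2].
have q0 : 0 < q by rewrite ltr0n (leq_trans _ p2).
have pi0 := pi_gt0 R.
pose s (x : R) := Num.sqrt (4 - x ^+ 2).
pose G (x : R) := (q + 1) / (2 * pi) * (atan (x * (s x)^-1) - c * atan (x * (s x)^-1 * c)).
have dG x : `|x| <= b -> is_derive x 1 G (mu_density p x).
  rewrite ler_norml => /andP[x1 x2].
  have s2 : 0 < 4 - x ^+ 2 by nra.
  have s0 : 0 < s x by rewrite sqrtr_gt0.
  have ss : s x ^+ 2 = 4 - x ^+ 2 by rewrite sqr_sqrtr// ltW.
  have hid := is_derive_id_fun x.
  have hs : is_derive x 1 s (- x / s x).
    have h := is_derive_sqrt_fun (is_derive_sub_fun (is_derive_cst_fun 4 x)
      (is_derive_mul_fun hid hid)) s2.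
    apply: is_derive_eq h _; rewrite -[Num.sqrt _]/(s x).
    by field; rewrite gt_eqF.
  have hu := is_derive_mul_fun hid (is_derive_inv_fun hs (lt0r_neq0 s0)).
  have h := is_derive_scale_fun ((q + 1) / (2 * pi)) (is_derive_sub_fun
    (is_derive_atan_fun hu) (is_derive_scale_fun c (is_derive_atan_fun
      (is_derive_mul_fun hu (is_derive_cst_fun c x))))).
  apply: is_derive_eq h _; rewrite /mu_density mu_density_denom -[Num.sqrt _]/(s x).
  by rewrite -(density_identity q0 s0 ss).
have nb x : x \in `[- b, b] -> `|x| <= b by rewrite in_itv /= ler_norml.
have Gc x : `|x| <= b -> {for x, continuous G}.
  by move=> /dG; exact: is_derive_continuous.
rewrite /Rintegral (@continuous_FTC2 _ (mu_density p) G) /=; last 4 first.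
- lra.
- apply: continuous_in_subspaceT => x; rewrite inE => /nb; rewrite ler_norml => /andP[x1 x2].
  have s2 : 0 < 4 - x ^+ 2 by nra.
  have A4 : 4 <= (q + 1) ^+ 2 / q.
    by rewrite ler_pdivlMr//; have := sqr_ge0 (q - 1); nra.
  have dn : (q `^ (1 / 2) + q `^ (- (1 / 2))) ^+ 2 - x * x != 0.
    by rewrite mu_density_denom gt_eqF//; move: s2; rewrite expr2; lra.
  have hid := is_derive_id_fun x.
  have hs := is_derive_sqrt_fun (is_derive_sub_fun (is_derive_cst_fun 4 x)
    (is_derive_mul_fun hid hid)) s2.
  have hA := is_derive_sub_fun (is_derive_cst_fun ((q `^ (1 / 2) + q `^ (- (1 / 2))) ^+ 2) x)
    (is_derive_mul_fun hid hid).
  exact: is_derive_continuous (is_derive_scale_fun ((q + 1) / (2 * pi))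
    (is_derive_mul_fun hs (is_derive_inv_fun hA dn))).
- split.
  + by move=> x /subset_itv_oo_cc/nb/dG[].
  + by apply: cvg_at_right_filter; apply: Gc; rewrite normrN gtr0_norm.
  + by apply: cvg_at_left_filter; apply: Gc; rewrite gtr0_norm.
- by move=> x /subset_itv_oo_cc/nb/dG; exact: is_derive_derive1.
have GN : G (- b) = - G b.
  by rewrite /G /s sqrrN mulNr (mulNr _ c) !atanN; ring.
rewrite GN opprK /G /s; move: (atan _) (atan _) => y z.
have q1 : 0 < q + 1 by rewrite addr_gt0.
clear G dG nb Gc GN; move: pi pi0 => P P0.
by field; rewrite !gt_eqF.
Qed.


(** Writing atan u = pi/2 - atan(1/u) splits off the total mass, which is 1 because 1 - c = 2/(q +
    1). The deficit is bounded by [atan_diff_le], with c^-2 - 1 = 4q/(q - 1)^2. *)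
Lemma integral_mu_density_ge b : 0 < b < 2 ->
  1 - (q + 1) / pi * (4 * q / (q - 1) ^+ 2 * (Num.sqrt (4 - b ^+ 2) / b) ^+ 3 / 3)
  <= \int[lebesgue_measure]_(x in [set` `[- b, b]]) mu_density p x.
Proof.
move=> hb; rewrite integral_mu_density//; move: hb => /andP[b0 b2].
have q0 : 0 < q by rewrite ltr0n (leq_trans _ p2).
have q1 : 0 < q - 1 by have := q2; lra.
have q1' : 0 < q + 1 by have := q2; lra.
have pi0 := pi_gt0 R.
have c0 : 0 < c by rewrite divr_gt0.
have c1 : c <= 1 by rewrite ler_pdivrMr//; lra.
have s2 : 0 < 4 - b ^+ 2 by nra.
set s := Num.sqrt (4 - b ^+ 2).
have s0 : 0 < s by rewrite sqrtr_gt0.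
set t := s / b; have t0 : 0 < t by rewrite divr_gt0.
have u0 : 0 < b / s by rewrite divr_gt0.
rewrite (atan_inv_pos u0) (atan_inv_pos (mulr_gt0 u0 c0)).
have -> : (b / s)^-1 = t by rewrite invf_div.
have -> : (b / s * c)^-1 = t * c^-1 by rewrite invfM invf_div.
have h := atan_diff_le (ltW t0) c0 c1.
have e4 : c^-2 - 1 = 4 * q / (q - 1) ^+ 2.
  by rewrite /c; field; rewrite !gt_eqF.
rewrite e4 in h.
have ec : (q + 1) / pi * (pi / 2 - c * (pi / 2)) = 1.
  by rewrite /c; move: pi pi0 => P P0; field; rewrite !gt_eqF.
have k0 : 0 <= (q + 1) / pi by rewrite divr_ge0 ?ltW.
have := ler_wpM2l k0 h.
move: (4 * q / (q - 1) ^+ 2 * t ^+ 3 / 3) (atan t) (atan (t / c)) => X y z hX.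
rewrite lerBlDr; apply: le_trans (lerD (lexx _) hX).
rewrite -[leLHS]ec le_eqVlt; apply/orP; left; apply/eqP; ring.
Qed.

End Mass.
End SpectralMeasureMass.

(** * Lower bound for the equidistribution constant *)

Section EquidistributionConstant.
Variable R : realType.
Local Notation C := (R[i]).
Local Notation nm := (@ComplexField.Normc.normc R).
Implicit Types (V : set (C -> C^o)).

Lemma expR_half_le2 : expR (1 / 2) <= 2 :> R.
Proof.
have h := @expR_ge1Dx R (- (1 / 2)).
have := expRN (1 / 2 : R) => e; rewrite e in h.
have e0 := @expR_gt0 R (1 / 2).
have : 1 / 2 <= (expR (1 / 2))^-1 :> R by lra.
by rewrite -[1 / 2]invrK mul1r invrK lef_pV2 ?posrE.
Qed.

Lemma ln2_ge_half : 1 / 2 <= ln 2 :> R.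
Proof. by rewrite -[leLHS]expRK ler_ln ?posrE ?expR_gt0// expR_half_le2. Qed.

Lemma ln_ge_nat n (x : R) : 4 ^+ n <= x -> n%:R <= ln x.
Proof.
move=> hx; have x0 : 0 < x by apply: lt_le_trans hx; rewrite exprn_gt0.
rewrite -[leLHS]expRK ler_ln ?posrE ?expR_gt0//; apply: le_trans hx.
have e1 : expR 1 <= 4 :> R.
  have -> : expR 1 = expR (1 / 2) * expR (1 / 2) :> R by rewrite -expRD; congr expR; field.
  have h1 := expR_half_le2; have h2 := @expR_ge0 R (1 / 2); nra.
by rewrite -[n%:R]mulr1 expRM_natl lerXn2r ?nnegrE ?expR_ge0.
Qed.

Lemma vdim_le V M : (forall n (e : 'I_n -> (C -> C^o)), is_basis V e -> (n <= M)%N) ->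
  (vdim V <= M)%N.
Proof. by move=> H; rewrite /vdim; case: xgetP => // n _ [e /H]. Qed.

Lemma sign_pattern_one N : sign_pattern N (fun=> 1).
Proof. by split => [Q _|Q Q' _ _ _]; [left|rewrite mulr1]. Qed.

(** 15/8 is close enough to 2 for the crude bounds sqrt(4 - b^2) <= 3/4 and pi >= 2 to suffice; they
    leave a mass above 7/10. *)
Lemma integral_mu_density2 : 1 / 200 <=
  \int[lebesgue_measure]_(x in [set` `[- (15 / 8), 15 / 8]]) mu_density 2 x :> R.
Proof.
have hb : 0 < (15 / 8 : R) < 2 by apply/andP; split; lra.
apply: le_trans (@integral_mu_density_ge R 2 isT _ hb).
set s := Num.sqrt _; have s0 : 0 <= s := sqrtr_ge0 _.
have s1 : s <= 3 / 4.
  by rewrite -ler_sqr ?nnegrE ?sqr_sqrtr; lra.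
set t := s / (15 / 8); have t0 : 0 <= t by rewrite divr_ge0//; lra.
have t1 : t <= 2 / 5 by rewrite ler_pdivrMr; lra.
have t3 : t ^+ 3 <= (2 / 5) ^+ 3 by rewrite lerXn2r ?nnegrE//; lra.
have pi2 := @pi_ge2 R; have pi0 := pi_gt0 R.
have ip : pi^-1 <= 1 / 2 :> R by rewrite mul1r lef_pV2 ?posrE.
have ip0 : 0 <= pi^-1 :> R by rewrite invr_ge0 ltW.
have -> : (2 + 1) / pi * (4 * 2 / (2 - 1) ^+ 2 * t ^+ 3 / 3) = 8 * (pi^-1 * t ^+ 3) :> R.
  by move: pi pi0 => P P0; field; rewrite gt_eqF.
have : pi^-1 * t ^+ 3 <= 1 / 2 * (2 / 5) ^+ 3 by apply: ler_pM; rewrite ?exprn_ge0.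
move: (_ * t ^+ 3) => X hX; lra.
Qed.

Section LowerBound.
Variables (S : nat -> nat -> (nat -> int) -> set (C -> C^o))
  (adm : nat -> (nat -> int) -> Prop) (C0 : R).
Hypotheses (hC : equidistribution_constant S adm C0) (adm1 : adm 1 (fun=> 1))
  (S1 : (S 12 1 (fun=> 1) `<=` cuspforms 12 1)%classic) (S1n : nonzero_space (S 12 1 (fun=> 1))).

(* Weight 12 and level 1: the space is nonzero and has dimension at most 200, so
   a single eigenvalue, or the absence of eigenvalues in [-2, 2], already forces
   a discrepancy. *)
Lemma equidistribution_constant_ge : 1 / 200 <= C0 * ln 2.
Proof.
set V := S 12 1 (fun=> 1).
have H (J : interval R) : {subset J <= `[-2, 2]} -> _ :=
  @hC 2 1 12 (fun=> 1) J isT isT isT (sign_pattern_one 1) adm1 isT isT S1n.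
have V200 : (vdim V <= 200)%N.
  by apply: vdim_le => n e; exact: cuspforms12_dim S1.
have l12 : 1 <= ln 12 :> R by apply: (@ln_ge_nat 1); rewrite expr1; lra.
suff : 1 / 200 <= C0 * (ln 2 / ln 12).
  rewrite mulrA ler_pdivlMr; last by lra.
  apply: le_trans; lra.
case: (boolP (has (fun l : C => (complex.Im l == 0) && (-2 <= complex.Re l <= 2))
    (eigen V (@hecke_normalized R 12 2)))) => [/hasP[l le /andP[l0 l2]]|nh].
  (* The interval reduced to this eigenvalue has measure 0, yet it carries at least 1/200 of the
     multiset. *)
  have := H `[complex.Re l, complex.Re l]; rewrite set_itv1 Rintegral_set1 subr0 muln1.
  set cnt := eigen_count_in _ _ _ => hH.
  have c1 : (0 < cnt)%N.
    rewrite /cnt /eigen_count_in -has_count; apply/hasP; exists l => //.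
    by rewrite l0 in_itv /= lexx.
  have v1 : (0 < vdim V)%N.
    apply: leq_trans (eigen_size V (@hecke_normalized R 12 2)).
    by case: (eigen V _) le.
  apply: le_trans (hH _); last first.
    by move=> x; rewrite !in_itv /= => /le_anti <-.
  rewrite ger0_norm ?divr_ge0// ler_pdivlMr ?ltr0n//.
  apply: (@le_trans _ _ 1).
    have : (vdim V)%:R <= 200%:R :> R by rewrite ler_nat.
    move: ((vdim V)%:R : R) => v hv; lra.
  by rewrite ler1n.
(* With no eigenvalue in [-2, 2] the count is 0, whatever [vdim V] is, and the whole mass of the
   interval is discrepancy. *)
have := H `[- (15 / 8), 15 / 8]; set cnt := eigen_count_in _ _ _ => hH.
have c0 : cnt = 0%N.
  apply/eqP; rewrite -leqn0 leqNgt -has_count; apply: contra nh => /hasP[l le].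
  rewrite in_itv /= => /andP[l0 /andP[l1 l2]]; apply/hasP; exists l => //.
  by rewrite l0; apply/andP; split; lra.
move: hH; rewrite c0 mul0r sub0r normrN muln1 => hH.
apply: le_trans (hH _); last by move=> x; rewrite !in_itv /= => /andP[x1 x2]; apply/andP; split; lra.
exact: le_trans integral_mu_density2 (ler_norm _).
Qed.

End LowerBound.
End EquidistributionConstant.

(** * The bound for large eigenvalues *)

Section LargeEigenvalues.
Variable R : realType.
Local Notation C := (R[i]).

(** [d ^+ 3 * L ^+ 2 <= 1] is d^(3/2) <= 1/L without roots, and t^3 has the order of d^(3/2) because
    4 - (2 - d)^2 = d (4 - d). The numerical factor 4/3 * 1/2 * (8/7)^3, with pi >= 2, is just below
    1. *)
Lemma integral_mu_density_tail (p : nat) (d L : R) : (2 <= p)%N -> 0 < d -> 8 <= L ->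
  d ^+ 3 * L ^+ 2 <= 1 ->
  1 - ((p%:R + 1) / (p%:R - 1)) ^+ 2 / L <=
    \int[lebesgue_measure]_(x in [set` `[- (2 - d), 2 - d]]) mu_density p x.
Proof.
move=> p2 d0 L8 dL; have L0 : 0 < L by lra.
have L2 : 64 <= L ^+ 2 by rewrite expr2; nra.
have d3 : d ^+ 3 <= (1 / 4) ^+ 3.
  have d30 : 0 < d ^+ 3 by rewrite exprn_gt0.
  have := ler_wpM2l (ltW d30) L2; move: (d ^+ 3) d30 dL => y y0; lra.
have d4 : d <= 1 / 4.
  by move: d3; rewrite ler_pXn2r ?nnegrE ?(ltW d0)//; lra.
have hb : 0 < 2 - d < 2 by apply/andP; split; lra.
apply: le_trans (@integral_mu_density_ge R p p2 _ hb).
set s := Num.sqrt _; set t := s / (2 - d).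
have s2 : s ^+ 2 = d * (4 - d).
  by rewrite sqr_sqrtr; [ring|nra].
have b0 : 0 < 2 - d by lra.
have t0 : 0 <= t by rewrite divr_ge0 ?sqrtr_ge0// ltW.
(* From d <= 1/4 follows 2 - d >= 7/4, and 8/7 is 2 divided by 7/4. *)
have t2 : t ^+ 2 <= (8 / 7) ^+ 2 * d.
  rewrite /t expr_div_n s2 ler_pdivrMr ?exprn_gt0//.
  rewrite mulrAC [leRHS]mulrC ler_wpM2l ?(ltW d0)//; nra.
have tL0 : 0 <= t ^+ 3 * L by apply: mulr_ge0; [exact: exprn_ge0|exact: ltW].
have tL : t ^+ 3 * L <= (8 / 7) ^+ 3.
  have r0 : 0 <= (8 / 7 : R) by lra.
  rewrite -(@ler_pXn2r _ 2) ?nnegrE ?tL0 ?exprn_ge0//.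
  have -> : (t ^+ 3 * L) ^+ 2 = (t ^+ 2) ^+ 3 * L ^+ 2 by ring.
  apply: (@le_trans _ _ (((8 / 7) ^+ 2 * d) ^+ 3 * L ^+ 2)).
    rewrite ler_wpM2r ?sqr_ge0// lerXn2r ?nnegrE ?sqr_ge0// mulr_ge0 ?sqr_ge0//; exact: ltW.
  have -> : ((8 / 7) ^+ 2 * d) ^+ 3 * L ^+ 2 = ((8 / 7) ^+ 3) ^+ 2 * (d ^+ 3 * L ^+ 2) by ring.
  by rewrite ler_piMr// sqr_ge0.
have q2 : 2 <= p%:R :> R by rewrite ler_nat.
move: (p%:R : R) q2 => q q2.
have q1 : 0 < q - 1 by lra.
have qp : 0 < q + 1 by lra.
have pi2 := @pi_ge2 R; have pi0 := pi_gt0 R.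
have ip : pi^-1 <= 1 / 2 :> R by rewrite mul1r lef_pV2 ?posrE.
have ip0 : 0 <= pi^-1 :> R by rewrite invr_ge0 ltW.
rewrite lerD2l lerN2.
have -> : (q + 1) / pi * (4 * q / (q - 1) ^+ 2 * t ^+ 3 / 3) =
    ((q + 1) / (q - 1)) ^+ 2 / L * (4 * (q / (q + 1)) * pi^-1 * (t ^+ 3 * L) / 3).
  by move: pi pi0 => P P0; field; rewrite !gt_eqF.
rewrite ler_piMr//; first by rewrite divr_ge0 ?sqr_ge0// ltW.
have qq : q / (q + 1) <= 1 by rewrite ler_pdivrMr//; lra.
have qq0 : 0 <= q / (q + 1) by rewrite divr_ge0//; lra.
have h1 : (q / (q + 1)) * pi^-1 <= 1 * (1 / 2) by apply: ler_pM.
have h2 : (q / (q + 1)) * pi^-1 * (t ^+ 3 * L) <= 1 * (1 / 2) * (8 / 7) ^+ 3.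
  by apply: ler_pM => //; exact: mulr_ge0.
rewrite -(mulrA 4) -(mulrA 4).
move: h2; move: (q / (q + 1) * pi^-1 * (t ^+ 3 * L)) => X hX; lra.
Qed.

(** On taking logarithms, the conclusion is the assumed lower bound on log p. *)
Lemma hecke_scale_bound (k p : nat) (L : R) : (2 <= k)%N -> (0 < p)%N -> 1 <= L ->
  4 * ln L / (3 * (k%:R - 1)) <= ln p%:R ->
  (p%:R `^ (- ((k%:R - 1) / 2))) ^+ 3 * L ^+ 2 <= 1.
Proof.
move=> k2 p0 L1 hp; have L0 : 0 < L by lra.
have k1 : 0 < k%:R - 1 :> R by rewrite subr_gt0 ltr1n.
have p0R : p%:R != 0 :> R by rewrite pnatr_eq0 -lt0n.
rewrite /powR (negbTE p0R) -[L](lnK L0) -!expRM_natl -expRD -[leRHS]expR0 ler_expR.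
move: hp; rewrite ?(lnK L0) ler_pdivrMr ?mulr_gt0//.
by move: (ln p%:R) (ln L) (k%:R - 1) => x y z h; lra.
Qed.

(** The family [S] and the condition [adm] stay abstract, so that the full and the new spaces share
    the argument; only the lower bound on C_0 is established for each. *)
Lemma large_eigen_bound (S : nat -> nat -> (nat -> int) -> set (C -> C^o))
    (adm : nat -> (nat -> int) -> Prop) (C0 : R) (k N p : nat) (sigma : nat -> int) :
  equidistribution_constant S adm C0 -> 1 / 200 <= C0 * ln 2 ->
  (2 <= k)%N -> ~~ odd k -> (0 < N)%N -> prime p -> coprime p N ->
  4 * ln (ln (k * N)%:R) / (3 * (k%:R - 1)) <= ln p%:R :> R ->
  sign_pattern N sigma -> adm N sigma -> nonzero_space (S k N sigma) ->
  expR 8 <= (k * N)%:R :> R ->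
  (large_eigen_count (S k N sigma) k p)%:R / (vdim (S k N sigma))%:R
  <= (83 + 58 / 10 ^+ 2 + 53 / 10 ^+ 4) * C0 * ((p%:R + 1) / (p%:R - 1)) ^+ 2
     * (ln p%:R * (ln (ln (k * N)%:R + 1000)) ^+ 2 / ln (k * N)%:R).
Proof.
move=> hC hC0 k2 ek N0 pp cpN hp hs ha hn hkN.
set V := S k N sigma in hn *; set L := ln (k * N)%:R in hp *.
have p2 := prime_gt1 pp; have p0 : (0 < p)%N by exact: prime_gt0.
have L8 : 8 <= L.
  have x0 : 0 < (k * N)%:R :> R by apply: lt_le_trans hkN; exact: expR_gt0.
  by rewrite -[leLHS]expRK ler_ln ?posrE ?expR_gt0.
have L0 : 0 < L by lra.
pose d : R := p%:R `^ (- ((k%:R - 1) / 2)).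
have d0 : 0 < d by rewrite powR_gt0// ltr0n.
have dL : d ^+ 3 * L ^+ 2 <= 1 by apply: hecke_scale_bound => //; lra.
have mass := integral_mu_density_tail p2 d0 L8 dL.
have d2 : d < 2.
  rewrite ltNge; apply/negP => h.
  have h3 : 2 ^+ 3 <= d ^+ 3 by rewrite lerXn2r ?nnegrE ?(ltW d0).
  have : 1 < d ^+ 3 * L ^+ 2 by nra.
  by rewrite ltNge dL.
have hI : {subset `[- (2 - d), 2 - d] <= `[(-2 : R), 2]}.
  by move=> x; rewrite !in_itv /= => /andP[x1 x2]; apply/andP; split; lra.
have eq_ := hC p N k sigma _ pp N0 cpN hs ha k2 ek hn hI.
have cnt := @large_eigen_count_add R V k p d p0 erefl.
rewrite -/V -/L in eq_.
set Q := ((p%:R + 1) / (p%:R - 1)) ^+ 2 in mass *.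
have Q1 : 1 <= Q.
  have p1 : 0 < p%:R - 1 :> R by rewrite subr_gt0 ltr1n.
  by rewrite exprn_ege1// ler_pdivlMr//; lra.
have A0 : 1 / 200 <= C0 * ln p%:R.
  apply: (le_trans hC0); have l2 := @ln2_ge_half R.
  have C00 : 0 < C0 by nra.
  by rewrite ler_wpM2l ?(ltW C00)// ler_ln ?posrE ?ltr0n// ler_nat.
set M := ln (L + 1000).
have M2 : 4 <= M ^+ 2.
  have : 2 <= M by apply: (@ln_ge_nat R 2); rewrite expr2; lra.
  by move=> h; rewrite expr2; nra.
have -> : (83 + 58 / 10 ^+ 2 + 53 / 10 ^+ 4) * C0 * Q * (ln p%:R * M ^+ 2 / L) =
    Q * ((83 + 58 / 10 ^+ 2 + 53 / 10 ^+ 4) * (C0 * ln p%:R) * M ^+ 2) / L.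
  by field; rewrite gt_eqF.
move: eq_ mass; set mu := \int[_]_(x in _) _ => eq_ mass.
move: eq_; rewrite ler_norml => /andP[eq_ _]; rewrite [C0 * (_ / L)]mulrA in eq_.
move: A0 eq_; set A := C0 * ln p%:R => A0 eq_.
have main : (large_eigen_count V k p)%:R / (vdim V)%:R <= Q / L + A / L.
  (* In dimension 0 the proportion is 0 by the convention x / 0 = 0. *)
  have [v0|v0] := posnP (vdim V).
    rewrite v0 invr0 mulr0 addr_ge0 ?divr_ge0 ?(ltW L0)//; lra.
  have v0R : 0 < (vdim V)%:R :> R by rewrite ltr0n.
  have : (large_eigen_count V k p)%:R / (vdim V)%:R +
      (eigen_count_in V (@hecke_normalized R k p) `[(- (2 - d))%R, (2 - d)%R])%:R / (vdim V)%:R <= 1 :> R.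
    by rewrite -mulrDl ler_pdivrMr// mul1r -natrD ler_nat.
  lra.
apply: (le_trans main); rewrite -mulrDl ler_pM2r ?invr_gt0//.
have AM : A * 4 <= A * M ^+ 2 by rewrite ler_wpM2l//; lra.
(* From A >= 1/200 and M^2 >= 4 alone, the right side is at least 334 A, hence at least 1 + A. *)
have h1 : 1 + A <= (83 + 58 / 10 ^+ 2 + 53 / 10 ^+ 4) * A * M ^+ 2.
  rewrite -mulrA; move: (A * M ^+ 2) AM => Y AM; lra.
have h0 : 0 <= A by lra.
apply: (@le_trans _ _ (Q * (1 + A))); last by rewrite ler_wpM2l//; lra.
nra.
Qed.

Lemma atkin_lehner_one f : cuspforms 12 1 f -> @atkin_lehner R 12 1 1 f = f.
Proof.
move=> cf; rewrite /atkin_lehner; case: cf => _ _ H _; apply: H; apply/Gamma0_1.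
by rewrite det_mx22.
Qed.

Lemma cuspforms_sigma12 f : cuspforms 12 1 f -> @cuspforms_sigma R 12 1 (fun=> 1) f.
Proof.
move=> cf; split => // Q /andP[]; rewrite dvdn1 => /eqP -> _.
by rewrite atkin_lehner_one// mulr1z scale1r.
Qed.

Lemma old_subspace1 k g : @old_subspace R k 1 g -> g = 0.
Proof.
case=> n [c [e [He ->]]]; apply: big1 => i _.
by have [M [d [f [M1 M0 _ _ _]]]] := He i; move: M0 M1; rewrite ltnS leqn0 => /eqP ->.
Qed.

(** The old subspace is zero at level 1, and the Petersson product with 0 is the integral of 0 over
    any domain. *)
Lemma new_subspace1 k f : cuspforms k 1 f -> @new_subspace R k 1 f.
Proof.
move=> cf; split => // D g _ /old_subspace1 ->; rewrite /petersson /=.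
have e u : f (Complex u.1 u.2) * (0 : C)^*%C * real_complex R (u.2 ^+ k / u.2 ^+ 2) = 0.
  by rewrite conjc0 mulr0 mul0r.
rewrite (_ : (fun u => complex.Re _) = cst 0); last by apply/funext => u; rewrite e.
rewrite (_ : (fun u => complex.Im _) = cst 0); last by apply/funext => u; rewrite e.
by rewrite /Rintegral /= integral0.
Qed.

Lemma cuspforms_sigma_constant (C0 : R) :
  equidistribution_constant (@cuspforms_sigma R) (fun _ _ => True) C0 -> 1 / 200 <= C0 * ln 2.
Proof.
move=> /equidistribution_constant_ge; apply => //; first by move=> f [].
exists (@cusp_form12 R); split; last exact: cusp_form12_neq0.
exact/cuspforms_sigma12/cuspforms_cusp_form12.
Qed.

Lemma new_subspace_sigma_constant (C0 : R) :
  equidistribution_constant (@new_subspace_sigma R) new_admissible C0 -> 1 / 200 <= C0 * ln 2.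
Proof.
move=> /equidistribution_constant_ge; apply.
- by case=> /andP[]; rewrite dvdn1.
- by move=> f [_ []].
- exists (@cusp_form12 R); split; last exact: cusp_form12_neq0.
  have cf := cuspforms_cusp_form12 R.
  by split; [exact: new_subspace1|exact: cuspforms_sigma12].
Qed.

End LargeEigenvalues.

Theorem proposition1p5 (R : realType) :
  (forall C0 : R,
     equidistribution_constant (@cuspforms_sigma R) (fun _ _ => True) C0 ->
   forall (k N p : nat) (sigma : nat -> int),
     (2 <= k)%N -> ~~ odd k -> (0 < N)%N -> prime p -> coprime p N ->
     4 * ln (ln (k * N)%:R) / (3 * (k%:R - 1)) <= ln p%:R :> R ->
     sign_pattern N sigma ->
     nonzero_space (@cuspforms_sigma R k N sigma) ->
     expR 8 <= (k * N)%:R :> R ->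
     (large_eigen_count (@cuspforms_sigma R k N sigma) k p)%:R
       / (vdim (@cuspforms_sigma R k N sigma))%:R
     <= (83 + 58 / 10 ^+ 2 + 53 / 10 ^+ 4) * C0 * ((p%:R + 1) / (p%:R - 1)) ^+ 2
        * (ln p%:R * (ln (ln (k * N)%:R + 1000)) ^+ 2 / ln (k * N)%:R))
  /\
  (forall C0new : R,
     equidistribution_constant (@new_subspace_sigma R) new_admissible C0new ->
   forall (k N p : nat) (sigma : nat -> int),
     (2 <= k)%N -> ~~ odd k -> (0 < N)%N -> prime p -> coprime p N ->
     4 * ln (ln (k * N)%:R) / (3 * (k%:R - 1)) <= ln p%:R :> R ->
     sign_pattern N sigma -> new_admissible N sigma ->
     nonzero_space (@new_subspace_sigma R k N sigma) ->
     expR 8 <= (k * N)%:R :> R ->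
     (large_eigen_count (@new_subspace_sigma R k N sigma) k p)%:R
       / (vdim (@new_subspace_sigma R k N sigma))%:R
     <= (83 + 58 / 10 ^+ 2 + 53 / 10 ^+ 4) * C0new * ((p%:R + 1) / (p%:R - 1)) ^+ 2
        * (ln p%:R * (ln (ln (k * N)%:R + 1000)) ^+ 2 / ln (k * N)%:R)).
Proof.
split=> C0 hC k N p sigma k2 ek N0 pp cpN hp hs.
- move=> hn hk; apply: (large_eigen_bound hC) => //; exact: cuspforms_sigma_constant.
- move=> ha hn hk; apply: (large_eigen_bound hC) => //; exact: new_subspace_sigma_constant.
Qed.
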